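(* Let $\mu,\nu$ be probability densities with respect to a reference measure $\lambda$ on a space $\mathsf{X}$, such that $g=\mu/\nu$ is bounded from above. For each $m$, let $\{\xi^i\}_{1\le i\le m}$ be $\mathsf{X}$-valued random variables such that, for all bounded (measurable) $f:\mathsf{X}\to\mathbb{R}$, as $m\to\infty$, $$\frac1m\sum_{i=1}^m f(\xi^i)\to\nu(f)\ \text{in probability},\qquad \sqrt m\Big[\frac1m\sum_{i=1}^m f(\xi^i)-\nu(f)\Big]\to \mathrm{N}(0,\sigma^2(f))\ \text{in distribution},$$ where $\sigma^2(f)$ denotes the asymptotic variance. Let $\omega^i=g(\xi^i)/\sum_{j=1}^m g(\xi^j)$, and let $n=n(m)\to\infty$ be non-random integers with $n/m\to\alpha\in(0,\infty)$. Assume that $$\mu\big(\{x:\ \alpha\tfrac{\mu}{\nu}(x)\in\mathbb{N}\}\big)=0 .$$ Let $\{\tilde\xi^i\}_{1\le i\le n}$ be obtained from $\{(\xi^i,\omega^i)\}_{1\le i\le m}$ by residual resampling. Then for all bounded $f$, $$n\operatorname{Var}\Big[\frac1n\sum_{i=1}^n f(\tilde\xi^i)\,\Big|\,\mathcal{G}^n\Big]\to\kappa(f)\quad\text{in probability},$$ where $$\kappa(f)=\nu\Big\{\Big(\frac\mu\nu-\frac1\alpha\Big\lfloor\frac{\alpha\mu}{\nu}\Big\rfloor\Big)f^2\Big\}-\frac{\Big[\nu\Big\{\Big(\frac\mu\nu-\frac1\alpha\Big\lfloor\frac{\alpha\mu}{\nu}\Big\rfloor\Big)f\Big\}\Big]^2}{1-\nu\Big\{\frac1\alpha\Big\lfloor\frac{\alpha\mu}{\nu}\Big\rfloor\Big\}}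 .$$ Hence the resampled particles satisfy a central limit theorem: for all bounded $f$, $$\sqrt n\Big[\frac1n\sum_{i=1}^n f(\tilde\xi^i)-\mu(f)\Big]\to\mathrm{N}\big(0,\tilde\sigma^2(f)\big)\ \text{in distribution},\qquad \tilde\sigma^2(f)=\kappa(f)+\alpha\,\sigma^2\Big(\frac\mu\nu\,[f-\mu(f)]\Big).$$
   Context: For a density $\nu$ and a function $f$, $\nu(f)=\int f\,\nu\,d\lambda$; for a set $A$, $\mu(A)=\int_A\mu\,d\lambda$. $\lfloor\cdot\rfloor$ is the integer part. The condition that $\mu/\nu$ is a well-defined bounded function includes that $\mu$ vanishes where $\nu$ does. The weights $\omega^i$ are unchanged if $g$ is multiplied by a positive constant, so $g$ need be known only up to a constant; in the formulas $\mu/\nu$ is the normalized ratio. $\mathcal{G}^n$ is the $\sigma$-field generated by the particles and weights before resampling (including all earlier generations, if any). Residual resampling: let $R=\sum_{i=1}^m\lfloor n\omega^i\rfloor$. Each $\xi^i$ is copied $\lfloor n\omega^i\rfloor+\bar N^i$ times, where, conditionally on $\mathcal{G}^n$, $(\bar N^1,\dots,\bar N^m)$ is multinomial with $n-R$ trials and probabilities $\bar\omega^i=(n\omega^i-\lfloor n\omega^i\rfloor)/(n-R)$ (all $\bar N^i=0$ if $R=n$). Equivalently $\sum_{i=1}^n f(\tilde\xi^i)=\sum_{i=1}^m\lfloor n\omega^i\rfloor f(\xi^i)+\sum_{i=1}^{n-R}f(\xi^{\bar I^i})$ with $\bar I^1,\dots,\bar I^{n-R}$ conditionally i.i.d. given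 $\mathcal{G}^n$ with $\Pr(\bar I^i=j\mid\mathcal{G}^n)=\bar\omega^j$. *)

(* Defs.v *)
From HB Require Import structures.
From mathcomp Require Export all_boot all_order all_algebra.
From mathcomp Require Export all_classical all_reals all_analysis.
Export Order.TTheory GRing.Theory Num.Theory.
Export numFieldNormedType.Exports.

Set Implicit Arguments.
Unset Strict Implicit.
Unset Printing Implicit Defensive.

Local Open Scope classical_set_scope.
Local Open Scope ring_scope.

Definition bounded_measurable d (X : measurableType d) (R : realType)
    (f : X -> R) : Prop :=
  measurable_fun setT f /\ exists M : R, forall x, `|f x| <= M.

Definition is_density d (X : measurableType d) (R : realType)
    (lambda : {measure set X -> \bar R}) (p : X -> R) : Prop :=
  [/\ measurable_fun setT p, forall x, 0 <= p x
    & (\int[lambda]_x (p x)%:E = 1)%E].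

Definition density_mean d (X : measurableType d) (R : realType)
    (lambda : {measure set X -> \bar R}) (p f : X -> R) : R :=
  \int[lambda]_x (f x * p x).

(* The probability space may change with m; a fixed one is the constant case. *)
Definition cvg_in_probability (R : realType) (d : nat -> measure_display)
    (Omega : forall m, measurableType (d m))
    (P : forall m, probability (Omega m) R)
    (Z : forall m, Omega m -> R) (c : R) : Prop :=
  forall eps : R, 0 < eps ->
    (P m [set t | eps <= `|Z m t - c|] @[m --> \oo] --> 0%E).

Definition cvg_in_distribution (R : realType) (d : nat -> measure_display)
    (Omega : forall m, measurableType (d m))
    (P : forall m, probability (Omega m) R)
    (Z : forall m, Omega m -> R) (L : probability (measurableTypeR R) R)
    : Prop :=
  forall h : R -> R, continuous h -> (exists M : R, forall x, `|h x| <= M) ->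
    (\int[P m]_t h (Z m t)) @[m --> \oo] --> \int[L]_x h x.

(* N(a, v), parametrized by the variance v.  [normal_prob a 0] is not the point
   mass at a (it is the uniform law on [0, 1]), hence the case distinction. *)
Definition normal_law (R : realType) (a v : R)
    : probability (measurableTypeR R) R :=
  if v == 0 then (@dirac _ (measurableTypeR R) a R : probability (measurableTypeR R) R)
  else (normal_prob a (Num.sqrt v) : probability (measurableTypeR R) R).

(* Y is a version of E[Z | G], for a sub-sigma-algebra G and integrable Z. *)
Definition is_cond_exp d (T : measurableType d) (R : realType)
    (P : probability T R) (G : set (set T)) (Z Y : T -> R) : Prop :=
  [/\ forall B : set R, measurable B -> G (Y @^-1` B),
      P.-integrable setT (EFin \o Y)
    & forall A, G A ->
        (\int[P]_(t in A) (Y t)%:E = \int[P]_(t in A) (Z t)%:E)%E].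

(* An arbitrary version; one exists, by Radon-Nikodym, for integrable Z. *)
Definition cond_exp d (T : measurableType d) (R : realType)
    (P : probability T R) (G : set (set T)) (Z : T -> R) : T -> R :=
  xget (fun=> 0) [set Y | is_cond_exp P G Z Y].

Definition cond_var d (T : measurableType d) (R : realType)
    (P : probability T R) (G : set (set T)) (Z : T -> R) : T -> R :=
  cond_exp P G (fun t => (Z t - cond_exp P G Z t) ^+ 2).

Section resampling.
Context d (T : measurableType d) dX (X : measurableType dX) (R : realType).
Implicit Types (P : probability T R) (m n : nat).

(* If all the g (xi j t) vanish, the weights are 0 (division by zero). *)
Definition weight P m (g : X -> R) (xi : 'I_m -> {RV P >-> X}) (i : 'I_m)
    (t : T) : R :=
  g (xi i t) / \sum_(j < m) g (xi j t).

(* The class [past] stands for the events of the earlier generations. *)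
Definition sigma_before P m (past : set (set T)) (xi : 'I_m -> {RV P >-> X})
    (w : 'I_m -> T -> R) : set (set T) :=
  <<s past
      `|` \bigcup_(i in [set: 'I_m])
            preimage_set_system setT (xi i) (@measurable _ X)
      `|` \bigcup_(i in [set: 'I_m])
            preimage_set_system setT (w i) (@measurable _ (measurableTypeR R))
  >>.

Definition multinomial_pmf m (N : nat) (p : 'I_m -> R) (k : 'I_m -> nat) : R :=
  if (\sum_(i < m) k i == N)%N
  then (N`!)%:R / (\prod_(i < m) ((k i)`!)%:R) * \prod_(i < m) p i ^+ k i
  else 0.

(* [Num.truncn] is the integer part, all its arguments here being >= 0. *)
Definition sure_copies n m (w : 'I_m -> T -> R) (i : 'I_m) (t : T) : nat :=
  Num.truncn (n%:R * w i t).

(* n - R; there is no truncation when the weights sum to 1 *)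
Definition residual_trials n m (w : 'I_m -> T -> R) (t : T) : nat :=
  (n - \sum_(i < m) sure_copies n w i t)%N.

Definition residual_prob n m (w : 'I_m -> T -> R) (t : T) (i : 'I_m) : R :=
  (n%:R * w i t - (sure_copies n w i t)%:R) / (residual_trials n w t)%:R.

(* [J] gives the ancestors of the n new particles: [xi i] is copied as many
   times as [i] has preimages under [J].  The sampling scheme makes sense only
   on the event [E] that the weights sum to 1 (for the weights above: that their
   denominator is nonzero); nothing is required of the new particles off [E].
   The last clause says that, on [E], the residual counts are multinomial
   conditionally on G. *)
Definition residual_resampling P (G : set (set T)) m n
    (xi : 'I_m -> {RV P >-> X}) (w : 'I_m -> T -> R)
    (xit : 'I_n -> {RV P >-> X}) : Prop :=
  let E := [set t | \sum_(i < m) w i t = 1] in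
  exists Nbar : 'I_m -> {RV P >-> nat},
    (forall t, E t -> exists J : 'I_n -> 'I_m,
       (forall l, xit l t = xi (J l) t) /\
       (forall i, #|[set l | J l == i]%SET|
                  = (sure_copies n w i t + Nbar i t)%N)) /\
    (forall k : 'I_m -> nat,
       is_cond_exp P G
         (\1_(E `&` [set t | forall i, Nbar i t = k i]))
         (fun t => \1_E t
            * multinomial_pmf (residual_trials n w t) (residual_prob n w t) k)).

End resampling.

(* Where nu vanishes, mu x / nu x is 0; nu-integrals ignore this set. *)
Definition kappa d (X : measurableType d) (R : realType)
    (lambda : {measure set X -> \bar R}) (mu nu : X -> R) (alpha : R)
    (f : X -> R) : R :=
  let fl := fun x => alpha^-1 * (Num.truncn (alpha * (mu x / nu x)))%:R in
  density_mean lambda nu (fun x => (mu x / nu x - fl x) * f x ^+ 2)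
  - (density_mean lambda nu (fun x => (mu x / nu x - fl x) * f x)) ^+ 2
    / (1 - density_mean lambda nu fl).

(* Main.v *)
(* The number of copies of a particle is a sure part plus a multinomial one, so,
   conditionally on G, the resampled mean is the weighted mean plus a centred sum
   of i.i.d. terms whose conditional variance is an explicit function of the
   particles.  Writing n w_i = s_m r(xi_i) with r = mu/nu and s_m -> alpha in
   probability, that function converges to kappa by the law of large numbers: the
   integer parts of s_m r and alpha r differ only where alpha r is close to an
   integer, a set of small mu-measure.  For the central limit theorem, a
   Lindeberg replacement conditionally on G turns the residual noise into an
   independent Gaussian of variance kappa, the weighted mean is treated by the
   hypothesis on the initial sample and Slutsky's lemma, and the two Gaussian
   laws convolve. *)
Require Import Defs.
From mathcomp Require Import measurable_realfun ring lra zify.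

Set Implicit Arguments.
Unset Strict Implicit.
Unset Printing Implicit Defensive.

Local Open Scope classical_set_scope.
Local Open Scope ring_scope.

(** * Bounded functions and convergence in probability *)

(** No Gaussian variable is ever adjoined to a probability space: [heat v F] is [F] averaged over a
    centred Gaussian of variance [v], so replacing noise means comparing functions of a real
    variable, and the limit law is recognised through the semigroup identity. Given the particles,
    the residual noise has an explicit finite multinomial average, equal to an iterated one-step
    average; Lindeberg's bound is therefore a deterministic inequality at each sample point. Its
    summation requires test functions whose third order Taylor constant survives [heat] unchanged.
    Two nuisances shape the rest. Conditional expectations are arbitrary versions, and the scheme is
    specified only where the weights sum to 1, so conditional statements carry the indicator of that
    event and comparisons hold off null sets, on events of probability tending to 1. Moreover the
    quotient in [kappa] needs a positive denominator: this is where the assumption that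
    [alpha * mu / nu] is almost never an integer enters a second time, and it also makes residual
    trials occur with probability tending to 1. *)

Section bounded_measurable_theory.
Context d (T : measurableType d) (R : realType).
Implicit Types (f g : T -> R) (P : probability T R).

Lemma bm_meas f : bounded_measurable f -> measurable_fun setT f.
Proof. by case. Qed.

Lemma bm_cst (r : R) : bounded_measurable (fun _ : T => r).
Proof. by split=> //; exists `|r|. Qed.

Lemma bmD f g : bounded_measurable f -> bounded_measurable g ->
  bounded_measurable (fun x => f x + g x).
Proof.
move=> [mf [M fM]] [mg [N gN]]; split; first exact: measurable_funD.
by exists (M + N) => x; rewrite (le_trans (ler_normD _ _))// lerD.
Qed.

Lemma bmN f : bounded_measurable f -> bounded_measurable (fun x => - f x).
Proof.
move=> [mf [M fM]]; split; first exact: measurableT_comp.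
by exists M => x; rewrite normrN.
Qed.

Lemma bmB f g : bounded_measurable f -> bounded_measurable g ->
  bounded_measurable (fun x => f x - g x).
Proof. by move=> bf bg; apply: bmD => //; apply: bmN. Qed.

Lemma bmM f g : bounded_measurable f -> bounded_measurable g ->
  bounded_measurable (fun x => f x * g x).
Proof.
move=> [mf [M fM]] [mg [N gN]]; split; first exact: measurable_funM.
by exists (M * N) => x; rewrite normrM ler_pM.
Qed.

Lemma bmX f k : bounded_measurable f -> bounded_measurable (fun x => f x ^+ k).
Proof.
move=> bf; elim: k => [|k IH]; first by under eq_fun do rewrite expr0; exact: bm_cst.
by under eq_fun do rewrite exprS; exact: bmM.
Qed.

Lemma bm_sum (I : Type) (s : seq I) (F : I -> T -> R) :
  (forall i, bounded_measurable (F i)) ->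
  bounded_measurable (fun x => \sum_(i <- s) F i x).
Proof.
move=> bF; elim: s => [|i s IH].
  by under eq_fun do rewrite big_nil; exact: bm_cst.
by under eq_fun do rewrite big_cons; exact: bmD.
Qed.

Lemma bm_indic (A : set T) : measurable A -> bounded_measurable (\1_A : T -> R).
Proof.
move=> mA; split; first exact: measurable_indic.
by exists 1 => x; rewrite indicE; case: (_ \in _); rewrite ?normr1 ?normr0.
Qed.

Lemma bm_le f (M : R) : measurable_fun setT f -> (forall x, `|f x| <= M) ->
  bounded_measurable f.
Proof. by move=> mf fM; split=> //; exists M. Qed.

Lemma bm_integrable P f : bounded_measurable f -> P.-integrable setT (EFin \o f).
Proof.
move=> [mf [M fM]]; apply: measurable_bounded_integrable => //.
  by rewrite (le_lt_trans (probability_le1 P _)) ?ltry.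
exists M; split; first by rewrite num_real.
by move=> y My x _ /=; rewrite (le_trans (fM x))// ltW.
Qed.

Lemma bm_exD P f g : bounded_measurable f -> bounded_measurable g ->
  \int[P]_x (f x + g x) = \int[P]_x f x + \int[P]_x g x.
Proof. by move=> bf bg; rewrite RintegralD//; exact: bm_integrable. Qed.

Lemma bm_exB P f g : bounded_measurable f -> bounded_measurable g ->
  \int[P]_x (f x - g x) = \int[P]_x f x - \int[P]_x g x.
Proof. by move=> bf bg; rewrite RintegralB//; exact: bm_integrable. Qed.

Lemma bm_exZ P f (r : R) : bounded_measurable f ->
  \int[P]_x (r * f x) = r * \int[P]_x f x.
Proof. by move=> bf; rewrite RintegralZl//; exact: bm_integrable. Qed.

Lemma ex_cst P (r : R) : \int[P]_x r = r.
Proof.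
have /= -> := @Rintegral_cst _ _ _ P _ measurableT r.
by have /= -> := probability_setT P; rewrite mulr1.
Qed.

Lemma bm_le_ex P f g : bounded_measurable f -> bounded_measurable g ->
  (forall x, f x <= g x) -> \int[P]_x f x <= \int[P]_x g x.
Proof. by move=> bf bg fg; apply: le_Rintegral => //; exact: bm_integrable. Qed.

Lemma bm_norm_ex P f (M : R) : bounded_measurable f ->
  (forall x, `|f x| <= M) -> `|\int[P]_x f x| <= M.
Proof.
move=> bf fM; rewrite (le_trans (le_normr_Rintegral _ _))//.
  exact: bm_integrable.
rewrite -[leRHS](ex_cst P); apply: bm_le_ex => //; last exact: bm_cst.
case: bf => mf _; apply: (@bm_le _ M); first exact: measurableT_comp.
by move=> x; rewrite normr_id.
Qed.

Lemma ex_indic P (A : set T) : measurable A -> \int[P]_x \1_A x = fine (P A).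
Proof. by move=> mA; rewrite /Rintegral integral_indic// setIT. Qed.

(** Pointwise, [|f - g|] is at most [e] plus [M] times the indicator of the complement of [A]. *)
Lemma bm_ex_close P f g (A : set T) (e M : R) : measurable A ->
  bounded_measurable f -> bounded_measurable g ->
  (forall x, A x -> `|f x - g x| <= e) -> (forall x, `|f x - g x| <= M) ->
  0 <= e -> `|\int[P]_x f x - \int[P]_x g x| <= e + M * fine (P (~` A)).
Proof.
move=> mA bf bg fge fgM e0; rewrite -bm_exB//.
have mA' : measurable (~` A) by exact: measurableC.
rewrite -ex_indic// -{1}(ex_cst P e) -bm_exZ; last exact: bm_indic.
rewrite -bm_exD; [|exact: bm_cst|by apply: bmM; [exact: bm_cst|exact: bm_indic]].
have bfg := bmB bf bg.
rewrite (le_trans (le_normr_Rintegral _ _))//; first exact: bm_integrable.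
apply: bm_le_ex => //.
- case: bfg => mfg _; apply: (@bm_le _ M); first exact: measurableT_comp.
  by move=> x; rewrite normr_id.
- apply: bmD; first exact: bm_cst.
  by apply: bmM; [exact: bm_cst|exact: bm_indic].
move=> x; rewrite indicE; have [xA|xA] := pselect (A x).
  rewrite memNset ?mulr0 ?addr0; first exact: fge.
  by move=> /(_ xA).
by rewrite mem_set// mulr1 (le_trans (fgM x))// lerDr.
Qed.

End bounded_measurable_theory.

(** * Events of probability tending to one *)

Section whp.
Context (R : realType) (d : nat -> measure_display)
  (Omega : forall m, measurableType (d m)) (P : forall m, probability (Omega m) R).

Definition whp (A : forall m, set (Omega m)) : Prop :=
  (forall m, measurable (A m)) /\
  forall e : R, 0 < e -> \forall m \near \oo, fine (P m (~` A m)) <= e.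

Lemma fine_prob_le d' (T : measurableType d') (Q : probability T R) (A : set T) (e : R) :
  measurable A -> (fine (Q A) <= e) = (Q A <= e%:E)%E.
Proof. by move=> mA; rewrite -lee_fin fineK// fin_num_measure. Qed.

Lemma fine_prob_mono d' (T : measurableType d') (Q : probability T R) (A B : set T) :
  measurable A -> measurable B -> A `<=` B -> fine (Q A) <= fine (Q B).
Proof.
move=> mA mB AB; rewrite fine_le ?fin_num_measure//.
by apply: le_measure => //; rewrite inE.
Qed.

Lemma whp_le (A B : forall m, set (Omega m)) : (forall m, measurable (B m)) ->
  (\forall m \near \oo, A m `<=` B m) -> whp A -> whp B.
Proof.
move=> mB AB [mA PA]; split=> // e e0; near=> m.
apply: (@le_trans _ _ (fine (P m (~` A m)))); last by near: m; exact: PA.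
apply: fine_prob_mono; [exact: measurableC|exact: measurableC|].
by apply: subsetC; near: m.
Unshelve. all: by end_near. Qed.

Lemma whpI (A B : forall m, set (Omega m)) :
  whp A -> whp B -> whp (fun m => A m `&` B m).
Proof.
move=> [mA PA] [mB PB]; split; first by move=> m; exact: measurableI.
move=> e e0; have e2 : 0 < e / 2 by rewrite divr_gt0.
near=> m; rewrite setCI.
have mA' : measurable (~` A m) by exact: measurableC.
have mB' : measurable (~` B m) by exact: measurableC.
rewrite fine_prob_le; last exact: measurableU.
rewrite (le_trans (measureU2 _ _ _))// (splitr e) EFinD.
by rewrite leeD// -fine_prob_le//; near: m; [exact: PA|exact: PB].
Unshelve. all: by end_near. Qed.

Lemma whp_dist_measurable d' (T : measurableType d') (Z : T -> R) (c e : R) :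
  measurable_fun setT Z -> measurable [set t | `|Z t - c| < e].
Proof.
move=> mZ; rewrite -[X in measurable X]setTI.
rewrite (_ : [set t | _] = (fun t => `|Z t - c|) @^-1` `]-oo, e[%classic).
  have mf : measurable_fun setT (fun t => `|Z t - c|).
    by apply: measurableT_comp => //; exact: measurable_funB.
  by apply: mf => //; exact: measurable_itv.
by apply/seteqP; split=> t /=; rewrite in_itv.
Qed.

Lemma setC_dist (T : Type) (Z : T -> R) (c e : R) :
  ~` [set t | `|Z t - c| < e] = [set t | e <= `|Z t - c|].
Proof.
by apply/seteqP; split=> t /= => [/negP|H]; [rewrite -leNgt|apply/negP; rewrite -leNgt].
Qed.

(** Rephrasing convergence through events lets finitely many limits be used together, by
    intersection. *)
Lemma cvg_in_probabilityP (Z : forall m, Omega m -> R) (c : R) :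
  (forall m, measurable_fun setT (Z m)) ->
  cvg_in_probability P Z c <->
  (forall e, 0 < e -> whp (fun m => [set t | `|Z m t - c| < e])).
Proof.
move=> mZ; split=> H e e0.
  split=> [m|e' e'0]; first exact: whp_dist_measurable.
  have /fine_cvgP[_ /cvgrPdist_le /(_ _ e'0)] := H _ e0.
  apply: filterS => m /=; rewrite sub0r normrN setC_dist.
  exact: le_trans (ler_norm _).
apply/fine_cvgP; split.
  near=> m; apply: fin_num_measure; rewrite -setC_dist.
  exact/measurableC/whp_dist_measurable.
apply/cvgrPdist_le => e' e'0; have [_ /(_ _ e'0)] := H _ e0.
apply: filterS => m /=; rewrite sub0r normrN -setC_dist.
by rewrite ger0_norm// fine_ge0.
Unshelve. all: by end_near. Qed.

Lemma cvg_in_probability_whp (Z : forall m, Omega m -> R) (c : R) :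
  (forall m, measurable_fun setT (Z m)) ->
  (forall e, 0 < e -> exists2 A, whp A &
     \forall m \near \oo, A m `<=` [set t | `|Z m t - c| < e]) ->
  cvg_in_probability P Z c.
Proof.
move=> mZ H; apply/cvg_in_probabilityP => // e e0.
have [A wA AZ] := H _ e0; apply: whp_le wA => //.
by move=> m; exact: whp_dist_measurable.
Qed.

(** The limits are constants, so continuity of [phi] at the single point [(c1, c2)] suffices; this
    is what admits inverses. *)
Lemma cvg_in_probability_map2 (Z1 Z2 : forall m, Omega m -> R) (c1 c2 : R)
    (phi : R -> R -> R) :
  (forall m, measurable_fun setT (Z1 m)) -> (forall m, measurable_fun setT (Z2 m)) ->
  (forall m, measurable_fun setT (fun t => phi (Z1 m t) (Z2 m t))) ->
  phi x.1 x.2 @[x --> (c1, c2)] --> phi c1 c2 ->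
  cvg_in_probability P Z1 c1 -> cvg_in_probability P Z2 c2 ->
  cvg_in_probability P (fun m t => phi (Z1 m t) (Z2 m t)) (phi c1 c2).
Proof.
move=> m1 m2 m12 cphi /(cvg_in_probabilityP _ m1) H1 /(cvg_in_probabilityP _ m2) H2.
apply: cvg_in_probability_whp => // e e0.
move/cvgrPdist_lt : cphi => /(_ _ e0) [[/= U1 U2] [/= /nbhs_ballP[/= e1 e10 B1]
   /nbhs_ballP[/= e2 e20 B2]] U12].
exists (fun m => [set t | `|Z1 m t - c1| < e1] `&` [set t | `|Z2 m t - c2| < e2]).
  by apply: whpI; [exact: H1|exact: H2].
apply: nearW => m t [/= Z1t Z2t]; rewrite distrC.
by apply: (U12 (_, _)); split => /=; [apply: B1|apply: B2]; rewrite /ball/= distrC.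
Qed.

Lemma cvg_in_probabilityD (Z1 Z2 : forall m, Omega m -> R) (c1 c2 : R) :
  (forall m, measurable_fun setT (Z1 m)) -> (forall m, measurable_fun setT (Z2 m)) ->
  cvg_in_probability P Z1 c1 -> cvg_in_probability P Z2 c2 ->
  cvg_in_probability P (fun m t => Z1 m t + Z2 m t) (c1 + c2).
Proof.
move=> m1 m2; apply: (@cvg_in_probability_map2 _ _ _ _ +%R) => //.
  by move=> m; exact: measurable_funD.
by apply: (@cvgD _ R^o); [exact: cvg_fst|exact: cvg_snd].
Qed.

Lemma cvg_in_probabilityB (Z1 Z2 : forall m, Omega m -> R) (c1 c2 : R) :
  (forall m, measurable_fun setT (Z1 m)) -> (forall m, measurable_fun setT (Z2 m)) ->
  cvg_in_probability P Z1 c1 -> cvg_in_probability P Z2 c2 ->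
  cvg_in_probability P (fun m t => Z1 m t - Z2 m t) (c1 - c2).
Proof.
move=> m1 m2; apply: (@cvg_in_probability_map2 _ _ _ _ (fun x y => x - y)) => //.
  by move=> m; exact: measurable_funB.
by apply: (@cvgB _ R^o); [exact: cvg_fst|exact: cvg_snd].
Qed.

Lemma cvg_in_probabilityM (Z1 Z2 : forall m, Omega m -> R) (c1 c2 : R) :
  (forall m, measurable_fun setT (Z1 m)) -> (forall m, measurable_fun setT (Z2 m)) ->
  cvg_in_probability P Z1 c1 -> cvg_in_probability P Z2 c2 ->
  cvg_in_probability P (fun m t => Z1 m t * Z2 m t) (c1 * c2).
Proof.
move=> m1 m2; apply: (@cvg_in_probability_map2 _ _ _ _ *%R) => //.
  by move=> m; exact: measurable_funM.
by apply: cvgM; [exact: cvg_fst|exact: cvg_snd].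
Qed.

(** Inversion is continuous off 0, and any function is measurable on the remaining singleton. *)
Lemma measurable_inv : measurable_fun [set: R] (@GRing.inv R).
Proof.
rewrite -(setvU [set 0 : R]); apply/measurable_funU => //.
  exact: measurableC.
split; last exact: measurable_fun_set1.
apply: open_continuous_measurable_fun.
  by apply: closed_openC; exact: closed_eq.
by move=> x; rewrite inE => /= /eqP x0; exact: inv_continuous.
Qed.

Lemma measurable_fun_inv d' (T : measurableType d') (f : T -> R) :
  measurable_fun setT f -> measurable_fun setT (fun t => (f t)^-1).
Proof. by move=> mf; apply: measurableT_comp => //; exact: measurable_inv. Qed.

Lemma cvg_in_probabilityV (Z1 : forall m, Omega m -> R) (c1 : R) :
  (forall m, measurable_fun setT (Z1 m)) -> c1 != 0 ->
  cvg_in_probability P Z1 c1 ->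
  cvg_in_probability P (fun m t => (Z1 m t)^-1) c1^-1.
Proof.
move=> m1 c10 Z1c; apply: (@cvg_in_probability_map2 Z1 Z1 c1 c1 (fun x y => x^-1)) => //.
  by move=> m; exact: measurable_fun_inv.
by apply: cvgV => //; exact: cvg_fst.
Qed.

Lemma cvg_in_probability_cst (u : nat -> R) (c : R) :
  u @ \oo --> c -> cvg_in_probability P (fun m t => u m) c.
Proof.
move=> /cvgrPdist_lt uc; apply: cvg_in_probability_whp => // e e0.
exists (fun m => setT).
  by split=> // e' e'0; apply: nearW => m; rewrite setCT measure0 ltW.
by near=> m => t _ /=; rewrite distrC; near: m; exact: uc.
Unshelve. all: by end_near. Qed.

End whp.

(** * Gaussian integrals *)

Section gauss.
Context (R : realType).
Notation leb := (@lebesgue_measure R).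
Definition std_normal : probability (measurableTypeR R) R := normal_prob 0 1.
Notation phi := (@normal_pdf R 0 1).

(** The Radon-Nikodym derivative of [normal_prob] has the same integrals as [normal_pdf] over
    measurable sets, so the two agree almost everywhere. *)
Lemma integral_normal_prob (m s : R) (f : R -> \bar R) : s != 0 ->
  measurable_fun setT f -> (forall x, (0 <= f x)%E) ->
  (\int[normal_prob m s]_x f x = \int[leb]_x (f x * (normal_pdf m s x)%:E))%E.
Proof.
move=> s0 mf f0.
have dom := @normal_prob_dominates R m s.
rewrite -(Radon_Nikodym_SigmaFinite.change_of_variables dom)//.
apply: ae_eq_integral => //.
- apply: emeasurable_funM => //; apply: (measurable_int leb).
  exact: Radon_Nikodym_SigmaFinite.f_integrable.
- by apply: emeasurable_funM => //; apply/measurable_EFinP; exact: measurable_normal_pdf.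
- apply: ae_eqe_mul2l; apply: integral_ae_eq => //.
  + exact: Radon_Nikodym_SigmaFinite.f_integrable.
  + by apply/measurable_EFinP; exact: measurable_normal_pdf.
  + by move=> E _ mE; rewrite -Radon_Nikodym_SigmaFinite.f_integral.
Qed.

Lemma normal_pdf_std (x : R) : phi x = phi 0 * expR (- (x ^+ 2 / 2)).
Proof.
rewrite !normal_pdfE ?oner_neq0// /normal_fun !subr0 expr1n mulr2n.
by rewrite expr0n/= oppr0 mul0r expR0 mulr1 mulNr.
Qed.

Lemma normal_pdf_scale (m s z : R) : 0 < s ->
  normal_pdf m s (m + s * z) * s = phi z.
Proof.
move=> s0; have sn0 : s != 0 by rewrite gt_eqF.
rewrite !normal_pdfE ?oner_neq0// /normal_fun /normal_peak subr0.
rewrite (_ : m + s * z - m = s * z); last by ring.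
have s2 : s ^+ 2 != 0 by rewrite expf_neq0.
have -> : - (s * z) ^+ 2 / (s ^+ 2 *+ 2) = - z ^+ 2 / (1 ^+ 2 *+ 2).
  rewrite exprMn -[s ^+ 2 *+ 2]mulr_natr expr1n -mulrN.
  by rewrite -mulf_div divff// mul1r.
rewrite expr1n mul1r -mulrnAr sqrtrM ?sqr_ge0// sqrtr_sqr gtr0_norm//.
by rewrite invfM mulrC !mulrA divff// mul1r.
Qed.

Lemma integral_normal_pdf_scale (m s : R) (h : R -> R) : 0 < s ->
  continuous h -> (forall x, 0 <= h x) ->
  (\int[leb]_x (h x * normal_pdf m s x)%:E =
   \int[leb]_z (h (m + s * z) * phi z)%:E)%E.
Proof.
move=> s0 ch h0; have sn0 : s != 0 by rewrite gt_eqF.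
pose F (z : R) := m + s * z.
have dF (z : R) : is_derive z 1 F s.
  rewrite /F; apply: is_derive_eq.
  by rewrite add0r mul1r -[LHS]/(s * 1) mulr1.
have F'E : F^`()%classic = cst s.
  by apply/funext => z; rewrite derive1E; apply: derive_val.
rewrite (@increasing_ge0_integration_by_substitutionT _ F).
- apply: eq_integral => z _; rewrite F'E /= fctE /= -mulrA.
  by rewrite -(normal_pdf_scale m z s0).
- by move=> x y xy; rewrite /F ltrD2l ltr_pM2l.
- by rewrite F'E => x; exact: cvg_cst.
- by rewrite F'E; exact: is_cvg_cst.
- by rewrite F'E; exact: is_cvg_cst.
- by move=> x; exact: ex_derive.
- apply/cvgrNyPle => A; near=> z; rewrite /F.
  rewrite -lerBrDl mulrC -ler_pdivlMr//; near: z; exact: nbhs_ninfty_le.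
- apply/cvgryPge => A; near=> z; rewrite /F.
  rewrite -lerBlDl mulrC -ler_pdivrMr//; near: z; exact: nbhs_pinfty_ge.
- move=> x; apply: cvgM; [exact: ch|exact: continuous_normal_pdf].
- by move=> x; rewrite mulr_ge0// normal_pdf_ge0.
Unshelve. all: by end_near. Qed.

Lemma integral_std_normal (h : R -> R) : continuous h -> (forall x, 0 <= h x) ->
  (\int[std_normal]_x (h x)%:E = \int[leb]_z (h z * phi z)%:E)%E.
Proof.
move=> ch h0; rewrite integral_normal_prob ?oner_neq0//.
by apply/measurable_EFinP; exact: continuous_measurable_fun.
Qed.

Lemma integral_normal_std_normal (m s : R) (h : R -> R) : 0 < s ->
  continuous h -> (forall x, 0 <= h x) ->
  (\int[normal_prob m s]_x (h x)%:E = \int[std_normal]_z (h (m + s * z))%:E)%E.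
Proof.
move=> s0 ch h0; rewrite integral_normal_prob ?gt_eqF//; last first.
  by apply/measurable_EFinP; exact: continuous_measurable_fun.
rewrite integral_normal_pdf_scale// integral_std_normal//.
move=> x; apply: (continuous_comp (f := fun z => m + s * z)); last exact: ch.
by apply: cvgD; [exact: cvg_cst|apply: cvgM; [exact: cvg_cst|exact: cvg_id]].
Qed.

(** Cut at 0 and reflect the negative half-line: passing to the opposite variable only exchanges the
    two half-line integrals. *)
Lemma ge0_integral_opp (f : R -> R) : continuous f -> (forall x, 0 <= f x) ->
  (\int[leb]_x (f (- x))%:E = \int[leb]_x (f x)%:E)%E.
Proof.
have half (g : R -> R) : continuous g -> (forall x, 0 <= g x) ->
    (\int[leb]_x (g x)%:E = \int[leb]_(x in `[0%R, +oo[) (g (- x))%:E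
       + \int[leb]_(x in `[0%R, +oo[) (g x)%:E)%E.
  move=> cg g0.
  have mg : measurable_fun [set: R] g by exact: continuous_measurable_fun.
  rewrite -(setUv `]-oo, (- (0:R))%R]%classic) ge0_integral_setU//= ; last 4 first.
  - exact: measurableC.
  - by apply/measurable_EFinP; rewrite setUv.
  - by move=> x _; rewrite lee_fin.
  - exact/disj_setPCl.
  rewrite ge0_integration_by_substitutionNy//; last exact: continuous_subspaceT.
  congr (_ + _)%E; rewrite oppr0 setCitvl.
  by rewrite integral_itv_obnd_cbnd//; exact/measurable_EFinP/measurable_funTS.
move=> cf f0; rewrite (half f)//.
rewrite (half (fun x => f (- x))); last by move=> x.
  rewrite addeC; congr (_ + _)%E.
  by apply: eq_integral => x _; rewrite opprK.
move=> x; apply: continuous_comp; last exact: cf.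
exact: opp_continuous.
Qed.

Lemma std_normal_opp (h : R -> R) : continuous h -> (forall x, 0 <= h x) ->
  \int[std_normal]_x h (- x) = \int[std_normal]_x h x.
Proof.
move=> ch h0; rewrite /Rintegral integral_std_normal//; last first.
  by move=> x; apply: continuous_comp; [exact: opp_continuous|exact: ch].
rewrite integral_std_normal//; congr fine.
rewrite -(@ge0_integral_opp (fun x => h x * phi x)).
- apply: eq_integral => x _; congr (_ * _)%:E.
  by rewrite [RHS]normal_pdf_std sqrrN -normal_pdf_std.
- by move=> x; apply: cvgM; [exact: ch|apply: continuous_normal_pdf; rewrite oner_neq0].
- by move=> x; rewrite mulr_ge0// normal_pdf_ge0.
Qed.

Lemma is_derive_phi (z : R) : is_derive z 1 phi (- z * phi z).
Proof.
rewrite (_ : phi = fun x => phi 0 * expR (- (x ^+ 2 / 2))); last first.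
  by apply/funext => x; exact: normal_pdf_std.
apply: is_derive_eq.
set e := expR _.
rewrite -[LHS]/(phi 0 * (e * - (z ^+ 2 * (- 2 ^- 2 * 0) + 2^-1 * (z * 1 + z * 1)))).
by move: (phi 0) e => p e; field.
Qed.

Lemma phi_gt0 (z : R) : 0 < phi z.
Proof.
rewrite normal_pdfE ?oner_neq0//.
by rewrite mulr_gt0// ?expR_gt0// normal_peak_gt0// oner_neq0.
Qed.

Lemma cvg_cstM (c l : R) (f : R -> R) : f x @[x --> +oo%R] --> l ->
  c * f x @[x --> +oo%R] --> c * l.
Proof. by move=> fl; apply: cvgM => //; exact: cvg_cst. Qed.

Lemma cvg_sqrD2_phi : (z ^+ 2 + 2) * phi z @[z --> +oo%R] --> (0 : R).
Proof.
(* The second order term of the exponential series gives [z ^+ 4 <= 8 * e] with [e] the exponential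
   of [z ^+ 2 / 2], and [(z ^+ 2 + 2) * z <= 3 * z ^+ 4] for [z >= 1]; hence 24. *)
have key (z : R) : 1 <= z -> (z ^+ 2 + 2) * phi z <= 24 * phi 0 / z.
  move=> z1; have z0 : 0 < z by exact: lt_le_trans z1.
  have := @expR_ge1Dxn R (z ^+ 2 / 2) 1.
  move=> /(_ (divr_ge0 (sqr_ge0 _) (ler0n _ _))); rewrite normal_pdf_std expRN.
  set e := expR _ => He.
  have e0 : 0 < e by exact: expR_gt0.
  have He' : z ^+ 4 <= 8 * e.
    have -> : z ^+ 4 = 8 * ((z ^+ 2 / 2) ^+ 2 / (2`!)%:R) by rewrite -[(2`!)%:R]/(2 : R); field.
    by rewrite ler_pM2l//; apply: le_trans He; rewrite lerDr.
  have H : (z ^+ 2 + 2) / e <= 24 / z.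
    rewrite ler_pdivrMr// mulrAC ler_pdivlMr//.
    apply: (@le_trans _ _ (3 * z ^+ 4)); last by lra.
    have z3 : 1 <= z ^+ 3 by exact: exprn_ege1.
    have : z <= z ^+ 4 by rewrite [leRHS]exprS ler_peMr// ltW.
    have : z ^+ 3 <= z ^+ 4 by rewrite [leRHS]exprS ler_peMl// exprn_ge0// ltW.
    have -> : (z ^+ 2 + 2) * z = z ^+ 3 + 2 * z by ring.
    lra.
  have := ler_wpM2l (ltW (phi_gt0 0)) H.
  by rewrite mulrCA => /le_trans; apply; rewrite mulrA [24 * _]mulrC.
have cvg0 : 24 * phi 0 / z @[z --> +oo%R] --> (0 : R).
  have zV : z^-1 @[z --> +oo%R] --> (0 : R).
    by apply/gtr0_cvgV0; [near=> z|exact: cvg_id]; near: z; exact: nbhs_pinfty_gt.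
  by have := @cvg_cstM (24 * phi 0) _ _ zV; rewrite mulr0.
apply: (squeeze_cvgr _ (cvg_cst (0 : R)) cvg0); near=> z.
have z1 : 1 <= z by near: z; exact: nbhs_pinfty_ge.
by rewrite key// andbT mulr_ge0 ?normal_pdf_ge0// addr_ge0// sqr_ge0.
Unshelve. all: by end_near. Qed.

Lemma std_normal_even (h : R -> R) : continuous h -> (forall x, 0 <= h x) ->
  (forall x, h (- x) = h x) ->
  (\int[std_normal]_x (h x)%:E =
   2%:E * \int[leb]_(z in `[0%R, +oo[) (h z * phi z)%:E)%E.
Proof.
move=> ch h0 he; rewrite integral_std_normal// ge0_symfun_integralT//.
- by rewrite set_itvcy.
- by move=> x; rewrite mulr_ge0// normal_pdf_ge0.
- by move=> x; apply: cvgM; [exact: ch|apply: continuous_normal_pdf; rewrite oner_neq0].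
- by move=> x /=; rewrite he; congr (_ * _); rewrite [RHS]normal_pdf_std sqrrN -normal_pdf_std.
Qed.

Lemma continuous_phi : continuous phi.
Proof. by apply: continuous_normal_pdf; rewrite oner_neq0. Qed.

Lemma FTC2y0 (f F : R -> R) (l : R) : (forall x, 0 <= x -> 0 <= f x) ->
  continuous f -> F x @[x --> +oo%R] --> l -> (forall x : R, is_derive x 1 F (f x)) ->
  (\int[leb]_(x in `[0%R, +oo[) (f x)%:E = (l - F 0)%:E)%E.
Proof.
move=> f0 cf Fl dF; rewrite (@ge0_continuous_FTC2y _ f F 0 l) ?EFinB//.
- exact: continuous_subspaceT.
- have /derivable1_diffP/differentiable_continuous cF : derivable F 0 1.
    exact: ex_derive.
  exact: cvg_at_right_filter.
- by move=> x _; rewrite derive1E derive_val.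
Qed.

Lemma integral0y_phi3 :
  (\int[leb]_(z in `[0%R, +oo[) (z ^+ 3 * phi z)%:E = (2 * phi 0)%:E)%E.
Proof.
transitivity (0 - (fun z => - ((z ^+ 2 + 2) * phi z)) 0)%:E; last first.
  by congr EFin => /=; move: (phi 0) => p; ring.
apply: (@FTC2y0 _ (fun z => - ((z ^+ 2 + 2) * phi z))).
- by move=> z z0; rewrite mulr_ge0 ?exprn_ge0 ?normal_pdf_ge0.
- by move=> z; apply: cvgM; [exact: exprn_continuous|exact: continuous_phi].
- have : - ((z ^+ 2 + 2) * phi z) @[z --> +oo%R] --> - (0 : R).
    by apply: cvgN; exact: cvg_sqrD2_phi.
  by rewrite oppr0.
- move=> z; have := is_derive_phi z => dphi; apply: is_derive_eq.
  rewrite -[LHS]/(- ((z ^+ 2 + 2) * (- z * phi z) + phi z * (z * 1 + z * 1 + 0))).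
  by move: (phi z) => p; ring.
Qed.

Lemma integral0y_expRN : (\int[leb]_(z in `[0%R, +oo[) (expR (- z))%:E = 1%:E)%E.
Proof.
transitivity (0 - (fun z : R => - expR (- z)) 0)%:E; last first.
  by congr EFin => /=; rewrite oppr0 expR0; ring.
apply: (@FTC2y0 _ (fun z => - expR (- z))).
- by move=> z _; rewrite expR_ge0.
- by move=> z; apply: continuous_comp; [exact: opp_continuous|exact: continuous_expR].
- by rewrite -oppr0; apply: cvgN; exact: cvgr_expR.
- move=> z; apply: is_derive_eq.
  by move: (expR _) => p; rewrite -[LHS]/(- (p * - 1)) mulrN1 opprK.
Qed.

(** The difference of the integrands, [(z ^+ 2 - 1) * phi z], is the derivative of [- (z * phi z)],
    which vanishes at both ends. It changes sign at 1 while [FTC2y0] wants a nonnegative integrand,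
    so a multiple of [expR (- z)], of known integral, is added and cancelled at the end. *)
Lemma integral0y_phi2 :
  (\int[leb]_(z in `[0%R, +oo[) (z ^+ 2 * phi z)%:E =
   \int[leb]_(z in `[0%R, +oo[) (phi z)%:E)%E.
Proof.
(* For [z] in [0, 1], [(1 - z ^+ 2) * phi z <= 2 * (1 - z) * phi 0 <= C * expR (- z)]. *)
pose C := 2 * phi 0.
have C0 : 0 <= C by rewrite mulr_ge0// ltW// phi_gt0.
pose f (z : R) := (z ^+ 2 - 1) * phi z + C * expR (- z).
have f0 z : 0 <= z -> 0 <= f z.
  move=> z0; rewrite /f; have [z1|z1] := leP 1 z.
    by rewrite addr_ge0// mulr_ge0 ?normal_pdf_ge0 ?expR_ge0// subr_ge0 exprn_ege1.
  have p01 : phi z <= phi 0.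
    rewrite normal_pdf_std ler_piMr ?normal_pdf_ge0// -expR0 ler_expR.
    by rewrite oppr_le0 divr_ge0 ?sqr_ge0.
  have := expR_ge1Dx (- z); have := normal_pdf_ge0 0 1 z.
  rewrite /C; move: (expR _) (phi z) (phi 0) p01 => e p q pq p0 ez.
  have h1 : 0 <= q * (e - (1 - z)) by rewrite mulr_ge0 ?subr_ge0// (le_trans p0).
  have h2 : 0 <= (q - p) * (1 - z) by rewrite mulr_ge0 ?subr_ge0// ltW.
  have h3 : 0 <= p * (1 - z) ^+ 2 by rewrite mulr_ge0 ?sqr_ge0.
  nra.
have cf : continuous f.
  move=> z; apply: cvgD; apply: cvgM.
  - by apply: cvgB; [exact: exprn_continuous|exact: cvg_cst].
  - exact: continuous_phi.
  - exact: cvg_cst.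
  - by apply: continuous_comp; [exact: opp_continuous|exact: continuous_expR].
have If : (\int[leb]_(z in `[0%R, +oo[) (f z)%:E = C%:E)%E.
  transitivity (0 - (fun z : R => - (z * phi z) - C * expR (- z)) 0)%:E; last first.
    by congr EFin => /=; rewrite mul0r !oppr0 expR0; ring.
  apply: (@FTC2y0 _ (fun z => - (z * phi z) - C * expR (- z))) => //.
  - have H1 : z * phi z @[z --> +oo%R] --> (0 : R).
      apply: (squeeze_cvgr _ (cvg_cst (0 : R)) cvg_sqrD2_phi); near=> z.
      have z1 : 1 <= z by near: z; exact: nbhs_pinfty_ge.
      rewrite mulr_ge0 ?normal_pdf_ge0 ?(le_trans ler01)//=.
      rewrite ler_wpM2r ?normal_pdf_ge0//; nra.
    have H2 := @cvg_cstM C _ _ (@cvgr_expR R).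
    have : - (z * phi z) - C * expR (- z) @[z --> +oo%R] --> - 0 - C * 0.
      by apply: cvgB => //; exact: cvgN.
    by rewrite mulr0 oppr0 addr0.
  - move=> z; have := is_derive_phi z => dphi; apply: is_derive_eq.
    rewrite /f; move: (expR _) (phi z) => e p.
    rewrite -[LHS]/(- (z * (- z * p) + p * 1) - (C * (e * - 1))).
    by ring.
have mexp : measurable_fun [set: R] (fun z : R => C * expR (- z)).
  apply: measurable_funM => //; apply: measurableT_comp => //.
have mphi : measurable_fun [set: R] phi by exact: measurable_normal_pdf.
have mphi2 : measurable_fun [set: R] (fun z => z ^+ 2 * phi z) by exact: measurable_funM.
have mf : measurable_fun [set: R] f by exact: continuous_measurable_fun.
have Iexp : (\int[leb]_(z in `[0%R, +oo[) (C * expR (- z))%:E = C%:E)%E.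
  under eq_integral do rewrite EFinM.
  rewrite ge0_integralZl_EFin//; last first.
    by apply/measurable_EFinP/measurable_funTS; apply: measurableT_comp.
  by rewrite integral0y_expRN mule1.
have : (\int[leb]_(z in `[0%R, +oo[) (z ^+ 2 * phi z)%:E + C%:E =
        \int[leb]_(z in `[0%R, +oo[) (phi z)%:E + C%:E)%E.
  rewrite -{1}Iexp -If -!ge0_integralD//.
  - by apply: eq_integral => z _; rewrite -!EFinD /f; congr EFin; ring.
  - by move=> z _; rewrite lee_fin normal_pdf_ge0.
  - exact/measurable_EFinP/measurable_funTS.
  - by move=> z; rewrite /= in_itv/= andbT lee_fin => /f0.
  - exact/measurable_EFinP/measurable_funTS.
  - by move=> z _; rewrite lee_fin mulr_ge0 ?normal_pdf_ge0 ?sqr_ge0.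
  - exact/measurable_EFinP/measurable_funTS.
  - by move=> z _; rewrite lee_fin mulr_ge0 ?expR_ge0.
  - exact/measurable_EFinP/measurable_funTS.
by move=> /(congr1 (fun x => x - C%:E)%E); rewrite !addeK.
Unshelve. all: by end_near. Qed.

Lemma std_normal_sqr : (\int[std_normal]_z (z ^+ 2)%:E = 1)%E.
Proof.
rewrite std_normal_even//; last 3 first.
- exact: exprn_continuous.
- by move=> x; exact: sqr_ge0.
- by move=> x; rewrite sqrrN.
rewrite integral0y_phi2.
transitivity (\int[std_normal]_x (cst 1 x))%E; last first.
  by rewrite integral_cst// mul1e; exact: probability_setT.
rewrite (@std_normal_even (cst 1) (@cst_continuous _ _ _) (fun=> ler01) (fun=> erefl)).
by under [in RHS]eq_integral do rewrite mul1r.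
Qed.

Definition std_normal_abs3 : R := \int[std_normal]_z `|z| ^+ 3.

Lemma integral_std_normal_abs3 : (\int[std_normal]_z (`|z| ^+ 3)%:E = (4 * phi 0)%:E)%E.
Proof.
rewrite std_normal_even//.
- under eq_integral.
    move=> z; rewrite inE /= in_itv/= andbT => z0; rewrite ger0_norm//; over.
  by rewrite /= integral0y_phi3 -EFinM mulrA; congr (_ * _)%:E; lra.
- by move=> x; apply: (@continuous_comp _ _ _ (@Num.norm R R) (fun y => y ^+ 3)); [exact: norm_continuous|exact: exprn_continuous].
- by move=> x; rewrite normrN.
Qed.

Lemma std_normal_integrable (f : R -> R) (C : R) : continuous f ->
  (forall z, `|f z| <= C * (1 + `|z| ^+ 3)) ->
  std_normal.-integrable setT (EFin \o f).
Proof.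
move=> cf fC; have mf := continuous_measurable_fun cf.
have m3 : measurable_fun [set: R] (fun z : R => `|z| ^+ 3).
  by apply: measurable_funX; exact: (@normr_measurable R setT).
have i1 : std_normal.-integrable setT (EFin \o (cst 1 : R -> R)).
  by apply: bm_integrable; exact: bm_cst.
have i3 : std_normal.-integrable setT (EFin \o (fun z : R => `|z| ^+ 3)).
  apply/integrableP; split; first exact/measurable_EFinP.
  under eq_integral do rewrite /= ger0_norm ?exprn_ge0//.
  by rewrite integral_std_normal_abs3 ltry.
have ig := integrableZl measurableT C (integrableD measurableT i1 i3).
apply: (le_integrable measurableT _ _ ig) => //; first exact/measurable_EFinP.
by move=> z _; rewrite /= lee_fin (le_trans (fC z))// ler_norm.
Qed.

(** The reflection lemma is for nonnegative functions, so it is applied to the positive and negative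
    parts, which it exchanges. *)
Lemma std_normal_mean : \int[std_normal]_z z = 0.
Proof.
have cpos : continuous (fun z : R => Num.max z 0).
  by move=> z; apply: continuous_max; [exact: cvg_id|exact: cvg_cst].
have cneg : continuous (fun z : R => Num.max (- z) 0).
  by move=> z; apply: continuous_max; [exact: opp_continuous|exact: cvg_cst].
have bnd (z : R) : `|Num.max z 0| <= 1 * (1 + `|z| ^+ 3).
  rewrite mul1r ger0_norm ?le_max ?lexx ?orbT// ge_max addr_ge0 ?exprn_ge0// andbT.
  rewrite (le_trans (ler_norm _))//; have [z1|z1] := leP `|z| 1.
    by rewrite (le_trans z1)// lerDl exprn_ge0.
  rewrite exprS (@le_trans _ _ (`|z| * `|z| ^+ 2))//; last by rewrite lerDr.
  by rewrite ler_peMr// exprn_ege1// ltW.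
have -> : \int[std_normal]_z z =
    \int[std_normal]_z (Num.max z 0 - Num.max (- z) 0).
  apply: eq_Rintegral => z _; move: (z : R) => {}z.
  have [z0|z0] := leP z 0; have [z0'|z0'] := leP (- z) 0; lra.
rewrite RintegralB//.
- rewrite (std_normal_opp cpos) ?subrr// => x.
  by rewrite le_max lexx orbT.
- exact: (std_normal_integrable cpos bnd).
- apply: (std_normal_integrable (C := 1) cneg) => z.
  by have := bnd (- z); rewrite normrN.
Qed.

(** Put [y = A * z + B * w] and exchange the integrals over [z] and [y]. The joint density factors
    into the density of [y], with standard deviation [S], and the conditional density of [z] given
    [y], normal with mean [A * y / S ^+ 2] and standard deviation [B / S]; the latter integrates to
    1. *)
Lemma normal_convolution (A B S : R) (h : R -> R) : 0 < A -> 0 < B -> 0 < S ->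
  S ^+ 2 = A ^+ 2 + B ^+ 2 -> continuous h -> (forall x, 0 <= h x) ->
  (\int[std_normal]_z \int[std_normal]_w (h (A * z + B * w))%:E =
   \int[std_normal]_z (h (S * z))%:E)%E.
Proof.
move=> A0 B0 S0 SAB ch h0.
have mh : measurable_fun [set: R] h by exact: continuous_measurable_fun.
have mphi : measurable_fun [set: R] phi by exact: measurable_normal_pdf.
have pdfE (m s y : R) : 0 < s -> normal_pdf m s y = phi ((y - m) / s) / s.
  move=> s0; have sn0 : s != 0 by rewrite gt_eqF.
  by rewrite -(@normal_pdf_scale m s _ s0) mulfK// mulrC divfK// addrC subrK.
have mid : measurable_fun [set: R] (@id R) by [].
have inner z : (\int[std_normal]_w (h (A * z + B * w))%:E =
    \int[leb]_y (h y * normal_pdf (A * z) B y)%:E)%E.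
  rewrite integral_normal_pdf_scale//.
  rewrite integral_std_normal// => w.
  apply: (continuous_comp (f := fun w => A * z + B * w)); last exact: ch.
  by apply: cvgD; [exact: cvg_cst|apply: cvgM; [exact: cvg_cst|exact: cvg_id]].
pose J (zy : R * R) : R := h zy.2 * (phi ((zy.2 - A * zy.1) / B) / B).
have J0 zy : 0 <= J zy by rewrite /J mulr_ge0// mulr_ge0 ?normal_pdf_ge0// invr_ge0 ltW.
have mJ : measurable_fun [set: R * R] J.
  apply: measurable_funM; first by apply: measurableT_comp.
  apply: measurable_funM => //; apply: measurableT_comp => //.
  apply: measurable_funM => //; apply: measurable_funB => //.
  by apply: measurable_funM.
under eq_integral do rewrite inner.
rewrite integral_normal_prob ?oner_neq0//; last 2 first.
- have /= H := @measurable_fun_fubini_tonelli_F _ _ _ _ R leb (EFin \o J).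
  have -> : (fun x => \int[leb]_y (h y * normal_pdf (A * x) B y)%:E)%E =
            (fun x => \int[leb]_y (J (x, y))%:E)%E.
    by apply/funext => x; apply: eq_integral => y _; rewrite pdfE.
  apply: H; last by move=> x; rewrite lee_fin.
  exact/measurable_EFinP.
- by move=> x; apply: integral_ge0 => y _; rewrite lee_fin mulr_ge0// normal_pdf_ge0.
pose L (zy : R * R) : R := J zy * phi zy.1.
have mL : measurable_fun [set: R * R] L.
  by apply: measurable_funM => //; apply: measurableT_comp.
transitivity (\int[leb]_z \int[leb]_y (L (z, y))%:E)%E.
  apply: eq_integral => z _.
  rewrite -ge0_integralZr ?lee_fin ?normal_pdf_ge0//.
  - by apply: eq_integral => y _; rewrite /L /J pdfE.
  - apply/measurable_EFinP; apply: measurable_funM => //.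
    exact: measurable_normal_pdf.
  - by move=> y _; rewrite lee_fin mulr_ge0// normal_pdf_ge0.
transitivity (\int[leb]_y \int[leb]_z (L (z, y))%:E)%E.
  apply: (@fubini_tonelli _ _ _ _ _ leb leb (EFin \o L)).
    exact/measurable_EFinP.
  by move=> x; rewrite lee_fin mulr_ge0// normal_pdf_ge0.
transitivity (\int[leb]_y (h y * normal_pdf 0 S y)%:E)%E; last first.
  rewrite integral_normal_pdf_scale//.
  under eq_integral do rewrite add0r.
  rewrite integral_std_normal// => z.
  apply: (continuous_comp (f := fun w => S * w)); last exact: ch.
  by apply: cvgM; [exact: cvg_cst|exact: cvg_id].
apply: eq_integral => y _.
have BS : 0 < B / S by rewrite divr_gt0.
have LE z : L (z, y) = (h y * normal_pdf 0 S y) * normal_pdf (A * y / S ^+ 2) (B / S) z.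
  rewrite /L /J /= (pdfE 0 S y)// (pdfE (A * y / S ^+ 2) (B / S) z)// [phi z]normal_pdf_std.
  rewrite [phi ((y - A * z) / B)]normal_pdf_std [phi ((y - 0) / S)]normal_pdf_std.
  rewrite [phi ((z - A * y / S ^+ 2) / (B / S))]normal_pdf_std.
  set e1 := expR _; set e2 := expR (- (z ^+ 2 / 2)); set e3 := expR _; set e4 := expR _.
  have E : e1 * e2 = e3 * e4.
    rewrite /e1 /e2 /e3 /e4 -!expRD; congr expR.
    have Sn0 : S != 0 by rewrite gt_eqF.
    have Bn0 : B != 0 by rewrite gt_eqF.
    have A2 : A ^+ 2 = S ^+ 2 - B ^+ 2 by rewrite SAB addrK.
    (* Completing the square in [z]. *)
    have key : (y - A * z) ^+ 2 + B ^+ 2 * z ^+ 2 =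
        B ^+ 2 * (y ^+ 2 / S ^+ 2) + (S * (z - A * y / S ^+ 2)) ^+ 2.
      transitivity (y ^+ 2 - 2 * A * y * z + (A ^+ 2 + B ^+ 2) * z ^+ 2); first by ring.
      rewrite -SAB; transitivity (B ^+ 2 * (y ^+ 2 / S ^+ 2) + A ^+ 2 * (y ^+ 2 / S ^+ 2)
         - 2 * A * y * z + S ^+ 2 * z ^+ 2); last by field.
      by rewrite A2; field.
    rewrite subr0 -!opprD; congr (- _); rewrite -!mulrDl; congr (_ / _).
    apply: (mulfI (expf_neq0 2 Bn0)).
    transitivity ((y - A * z) ^+ 2 + B ^+ 2 * z ^+ 2); first by field.
    by rewrite key; field; rewrite Sn0.
  have Sn0 : S != 0 by rewrite gt_eqF.
  have Bn0 : B != 0 by rewrite gt_eqF.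
  transitivity (h y * phi 0 * phi 0 / B * (e1 * e2)).
    by move: (phi 0) e1 e2 {E} => p e1 e2; ring.
  rewrite E; move: (phi 0) e3 e4 {E} => p e3 e4; field.
  by rewrite Sn0 Bn0.
under eq_integral do rewrite LE EFinM.
rewrite ge0_integralZl_EFin//.
- by rewrite integral_normal_pdf mule1.
- by move=> z _; rewrite lee_fin normal_pdf_ge0.
- by apply/measurable_EFinP; exact: measurable_normal_pdf.
- by rewrite mulr_ge0// normal_pdf_ge0.
Qed.

(* The mean of F under N(x, v), including v = 0. *)
Definition heat (v : R) (F : R -> R) (x : R) : R :=
  \int[std_normal]_z F (x + Num.sqrt v * z).

End gauss.

(** * The heat semigroup *)

Section smooth_functions.
Context (R : realType).
Notation leb := (@lebesgue_measure R).
Implicit Types (f F : R -> R).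

(** Boundedness gives integrability under every law, the Lipschitz bound stability under small
    changes of the argument; both pass to [heat v F] with the same constants. *)
Definition bounded_lipschitz F : Prop :=
  exists M L : R, (forall x, `|F x| <= M) /\
    (forall x y, `|F x - F y| <= L * `|x - y|).

(** [F1] and [F2] stand for the first two derivatives but only the Taylor bound is asked of them: it
    passes through a Gaussian average by plain integration, without differentiating under the
    integral. *)
Definition taylor2 (K : R) F F1 F2 : Prop :=
  forall x y, `|F (x + y) - F x - y * F1 x - y ^+ 2 / 2 * F2 x| <= K * `|y| ^+ 3.

Definition smooth2 (K : R) F F1 F2 : Prop :=
  [/\ bounded_lipschitz F, bounded_lipschitz F1, bounded_lipschitz F2
    & taylor2 K F F1 F2].

Lemma bounded_lipschitz_continuous F : bounded_lipschitz F -> continuous F.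
Proof.
move=> [M [L [_ FL]]] x; apply/cvgrPdist_lt => e e0.
pose L' := `|L| + 1.
have L'0 : 0 < L' by rewrite ltr_wpDl.
near=> y; apply: (@le_lt_trans _ _ (L' * `|x - y|)).
  by rewrite (le_trans (FL _ _))// ler_wpM2r// (le_trans (ler_norm _))// lerDl.
rewrite mulrC -ltr_pdivlMr//; near: y.
by apply: cvgr_dist_lt; rewrite ?divr_gt0//; exact: cvg_id.
Unshelve. all: by end_near. Qed.

Lemma bounded_continuous_bm F (M : R) : continuous F -> (forall x, `|F x| <= M) ->
  bounded_measurable (F : measurableTypeR R -> R).
Proof. by move=> cF FM; apply: (bm_le _ FM); exact: continuous_measurable_fun. Qed.

Lemma bounded_lipschitz_bm d (T : measurableType d) F (g : T -> R) :
  bounded_lipschitz F -> measurable_fun setT g ->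
  bounded_measurable (fun t => F (g t)).
Proof.
move=> bF mg; have cF := bounded_lipschitz_continuous bF.
case: bF => M [_ [FM _]]; apply: (@bm_le _ _ _ _ M) => //.
by apply: measurableT_comp => //; exact: continuous_measurable_fun.
Qed.

Lemma measurable_affine (x v : R) : measurable_fun [set: measurableTypeR R] (fun z : R => x + v * z).
Proof. by apply: measurable_funD => //; exact: measurable_funM. Qed.

Lemma heat_bm (v x : R) F : bounded_lipschitz F ->
  bounded_measurable ((fun z => F (x + Num.sqrt v * z)) : measurableTypeR R -> R).
Proof. by move=> bF; apply: bounded_lipschitz_bm => //; exact: measurable_affine. Qed.

Lemma heat_le (v x M : R) F : bounded_lipschitz F -> (forall x, `|F x| <= M) ->
  `|heat v F x| <= M.
Proof. by move=> bF FM; apply: bm_norm_ex => //; exact: heat_bm. Qed.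

Lemma heat_lip (v L : R) F : bounded_lipschitz F ->
  (forall x y, `|F x - F y| <= L * `|x - y|) ->
  forall x y, `|heat v F x - heat v F y| <= L * `|x - y|.
Proof.
move=> bF FL x y; rewrite /heat -bm_exB; [|exact: heat_bm|exact: heat_bm].
apply: bm_norm_ex; first by apply: bmB; exact: heat_bm.
by move=> z; rewrite (le_trans (FL _ _))// opprD addrACA subrr addr0.
Qed.

Lemma bounded_lipschitz_heat (v : R) F : bounded_lipschitz F -> bounded_lipschitz (heat v F).
Proof.
move=> bF; case: (bF) => M [L [FM FL]]; exists M, L; split.
  by move=> x; exact: heat_le.
exact: heat_lip.
Qed.

Lemma heat0 F : heat 0 F = F.
Proof.
apply/funext => x; rewrite /heat sqrtr0.
by under eq_Rintegral do rewrite mul0r addr0; exact: ex_cst.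
Qed.

Lemma abs_le_abs3 (z : R) : `|z| <= 1 + `|z| ^+ 3.
Proof.
have [z1|z1] := leP `|z| 1; first by rewrite (le_trans z1)// lerDl exprn_ge0.
rewrite exprS (@le_trans _ _ (`|z| * `|z| ^+ 2))//; last by rewrite lerDr.
by rewrite ler_peMr// exprn_ege1// ltW.
Qed.

Lemma sqr_le_abs3 (z : R) : z ^+ 2 <= 1 + `|z| ^+ 3.
Proof.
rewrite -real_normK ?num_real//; have [z1|z1] := leP `|z| 1.
  by rewrite (@le_trans _ _ 1)// ?exprn_ile1// lerDl exprn_ge0.
rewrite [X in _ <= _ + X]exprS (@le_trans _ _ (`|z| * `|z| ^+ 2))//; last by rewrite lerDr.
by rewrite ler_peMl ?exprn_ge0// ltW.
Qed.

Lemma std_normal_integrable_id : (@std_normal R).-integrable setT (EFin \o (fun z => z)).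
Proof.
apply: (@std_normal_integrable _ _ 1); first by move=> x; exact: cvg_id.
by move=> z; rewrite mul1r abs_le_abs3.
Qed.

Lemma std_normal_integrable_abs : (@std_normal R).-integrable setT (EFin \o (fun z => `|z|)).
Proof.
apply: (@std_normal_integrable _ _ 1); first exact: (@norm_continuous _ R^o).
by move=> z; rewrite mul1r normr_id abs_le_abs3.
Qed.

Lemma std_normal_integrable_sqr : (@std_normal R).-integrable setT (EFin \o (fun z => z ^+ 2)).
Proof.
apply: (@std_normal_integrable _ _ 1); first exact: exprn_continuous.
by move=> z; rewrite mul1r ger0_norm ?sqr_ge0// sqr_le_abs3.
Qed.

Lemma std_normal_integrable_abs3 :
  (@std_normal R).-integrable setT (EFin \o (fun z => `|z| ^+ 3)).
Proof.
apply: (@std_normal_integrable _ _ 1).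
  move=> x; apply: (@continuous_comp _ _ _ (@Num.norm R R) (fun y => y ^+ 3)).
    exact: norm_continuous.
  exact: exprn_continuous.
by move=> z; rewrite mul1r ger0_norm ?exprn_ge0// lerDr.
Qed.

Definition std_normal_abs1 : R := \int[@std_normal R]_z `|z|.

(** Both Gaussian variables are built from the same standard [z], so they differ by [|z|] times the
    difference of the standard deviations. *)
Lemma heat_close (v w L : R) F x : bounded_lipschitz F ->
  (forall x y, `|F x - F y| <= L * `|x - y|) ->
  `|heat v F x - heat w F x| <= L * std_normal_abs1 * `|Num.sqrt v - Num.sqrt w|.
Proof.
move=> bF FL; rewrite /heat -bm_exB; [|exact: heat_bm|exact: heat_bm].
rewrite (le_trans (le_normr_Rintegral _ _))//.
  by apply: bm_integrable; apply: bmB; exact: heat_bm.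
rewrite mulrAC mulrC [L * _]mulrC /std_normal_abs1.
have i1 := std_normal_integrable_abs.
rewrite -RintegralZr//; apply: le_Rintegral => //.
- apply: integrable_norm; apply: bm_integrable; apply: bmB; exact: heat_bm.
- exact: (integrableZr measurableT _ i1).
- move=> z _; rewrite (le_trans (FL _ _))// opprD addrACA subrr add0r -mulrBl.
  rewrite normrM; move: `|Num.sqrt v - Num.sqrt w| (`|z|) => a b.
  by have -> : L * (a * b) = b * (a * L) by ring.
Qed.

(** Integrate the Taylor bound at the increment [Num.sqrt v * z]: the first moment of [z] is 0 and
    the second is 1. *)
Lemma heat_taylor (K v : R) F F1 F2 x : 0 <= v -> smooth2 K F F1 F2 ->
  `|heat v F x - F x - v / 2 * F2 x| <= K * Num.sqrt v ^+ 3 * @std_normal_abs3 R.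
Proof.
move=> v0 [bF _ _ FT]; set s := Num.sqrt v.
have s0 : 0 <= s by exact: sqrtr_ge0.
have i1 := std_normal_integrable_id.
have i2 := std_normal_integrable_sqr.
have i3 := std_normal_integrable_abs3.
have iF := bm_integrable (@std_normal R) (heat_bm v x bF).
have ic := bm_integrable (@std_normal R) (@bm_cst _ (measurableTypeR R) R (F x)).
have i1' := integrableZr measurableT (s * F1 x) i1.
have i2' := integrableZr measurableT (s ^+ 2 / 2 * F2 x) i2.
have iG := integrableB measurableT (integrableB measurableT (integrableB measurableT iF ic) i1') i2'.
have -> : heat v F x - F x - v / 2 * F2 x =
    \int[@std_normal R]_z (F (x + s * z) - F x - z * (s * F1 x) - z ^+ 2 * (s ^+ 2 / 2 * F2 x)).
  rewrite RintegralB//; last exact: (integrableB measurableT (integrableB measurableT iF ic) i1').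
  rewrite RintegralB//; last exact: (integrableB measurableT iF ic).
  rewrite RintegralB// RintegralZr// RintegralZr// ex_cst std_normal_mean mul0r subr0.
  by rewrite {2}/Rintegral std_normal_sqr /= mul1r sqr_sqrtr.
rewrite (le_trans (le_normr_Rintegral _ _))// /std_normal_abs3 -RintegralZl//.
apply: le_Rintegral => //.
- exact: (integrable_norm iG).
- exact: (integrableZl measurableT (K * s ^+ 3) i3).
- move=> z _; have := FT x (s * z); rewrite normrM (ger0_norm s0) !exprMn.
  by rewrite mulrA; congr (`|_| <= _); ring.
Qed.

(** The constant [K] does not depend on [v]; this makes the error of every replacement in
    [lindeberg] the same. *)
Lemma taylor2_heat (K v : R) F F1 F2 : smooth2 K F F1 F2 ->
  smooth2 K (heat v F) (heat v F1) (heat v F2).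
Proof.
move=> [bF bF1 bF2 FT]; split; try exact: bounded_lipschitz_heat.
move=> x y; rewrite /heat.
have hF z := heat_bm v z bF.
rewrite -bm_exB// -bm_exZ; last exact: heat_bm.
rewrite -bm_exB; [|exact: bmB|by apply: bmM; [exact: bm_cst|exact: heat_bm]].
rewrite -bm_exZ; last exact: heat_bm.
rewrite -bm_exB; last 2 first.
- by apply: bmB; [exact: bmB|apply: bmM; [exact: bm_cst|exact: heat_bm]].
- by apply: bmM; [exact: bm_cst|exact: heat_bm].
apply: bm_norm_ex.
  apply: bmB; last by apply: bmM; [exact: bm_cst|exact: heat_bm].
  by apply: bmB; [exact: bmB|apply: bmM; [exact: bm_cst|exact: heat_bm]].
by move=> z; rewrite (addrAC x y); exact: FT.
Qed.

Lemma EFin_bm_ex d (T : measurableType d) (P : probability T R) (f : T -> R) :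
  bounded_measurable f -> (\int[P]_x f x)%:E = (\int[P]_x (f x)%:E)%E.
Proof. by move=> bf; rewrite /Rintegral fineK//; apply: integrable_fin_num => //; exact: bm_integrable. Qed.

(** Independent Gaussian noises add their variances. The degenerate variances, which have no
    density, are settled before [normal_convolution] is used. *)
Lemma heat_heat (v w : R) F x : 0 <= v -> 0 <= w -> bounded_lipschitz F ->
  heat v (heat w F) x = heat (v + w) F x.
Proof.
rewrite le_eqVlt => /predU1P[<-|v0]; first by rewrite heat0 add0r.
rewrite le_eqVlt => /predU1P[<-|w0]; first by rewrite heat0 addr0.
move=> bF; case: (bF) => M [L [FM FL]].
(* The convolution formula is for nonnegative functions; the bound [M] lifts [F] above 0 and is
   subtracted at the end. *)
pose h u := F (x + u) + M.
have h0 u : 0 <= h u by rewrite /h -lerBlDr sub0r; have := FM (x + u); rewrite ler_norml => /andP[].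
have cF := bounded_lipschitz_continuous bF.
have ch : continuous h.
  move=> u; apply: cvgD; last exact: cvg_cst.
  apply: continuous_comp; last exact: cF.
  by apply: cvgD; [exact: cvg_cst|exact: cvg_id].
have sv : 0 < Num.sqrt v by rewrite sqrtr_gt0.
have sw : 0 < Num.sqrt w by rewrite sqrtr_gt0.
have svw : 0 < Num.sqrt (v + w) by rewrite sqrtr_gt0 addr_gt0.
have := @normal_convolution R _ _ _ h sv sw svw.
rewrite !sqr_sqrtr ?addr_ge0 ?ltW// => /(_ erefl ch h0).
have bM : bounded_measurable (fun _ : measurableTypeR R => M) by exact: bm_cst.
have E1 z : (\int[@std_normal R]_w0 (h (Num.sqrt v * z + Num.sqrt w * w0))%:E)%E =
    (heat w F (x + Num.sqrt v * z) + M)%:E.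
  rewrite /heat -[X in _ + X](ex_cst (@std_normal R)) -bm_exD//; last exact: heat_bm.
  rewrite EFin_bm_ex; last by apply: bmD => //; exact: heat_bm.
  by apply: eq_integral => y _; rewrite /h addrA.
under eq_integral do rewrite E1.
have bh := bounded_lipschitz_heat w bF.
rewrite -EFin_bm_ex; last by apply: bmD => //; exact: heat_bm.
rewrite /h -EFin_bm_ex; last by apply: bmD => //; exact: heat_bm.
move=> -[]; rewrite bm_exD//; last exact: heat_bm.
rewrite bm_exD//; last exact: heat_bm.
by rewrite !ex_cst => /addIr.
Qed.

Lemma integral_normal_law (v : R) F : 0 <= v -> bounded_lipschitz F ->
  \int[normal_law 0 v]_x F x = heat v F 0.
Proof.
move=> v0 bF; rewrite /normal_law; case: eqP => [->|/eqP vn0].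
  rewrite heat0 /Rintegral integral_dirac//.
    by rewrite diracT mul1e.
  apply/measurable_EFinP; apply: continuous_measurable_fun.
  exact: bounded_lipschitz_continuous.
have v1 : 0 < Num.sqrt v by rewrite sqrtr_gt0 lt_neqAle eq_sym vn0.
case: (bF) => M [L [FM FL]].
have cF := bounded_lipschitz_continuous bF.
pose h u := F u + M.
have h0 u : 0 <= h u by rewrite /h -lerBlDr sub0r; have := FM u; rewrite ler_norml => /andP[].
have ch : continuous h by move=> u; apply: cvgD; [exact: cF|exact: cvg_cst].
have H0 := @integral_normal_std_normal R 0 _ h v1 ch h0.
have bM : bounded_measurable (fun _ : measurableTypeR R => M) by exact: bm_cst.
have bFm : bounded_measurable (F : measurableTypeR R -> R) by exact: (bounded_continuous_bm cF FM).
have bh1 := bmD bFm bM; have bh2 := bmD (heat_bm v 0 bF) bM.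
have E1 := bm_exD (normal_prob 0 (Num.sqrt v)) bFm bM.
have E2 := bm_exD (@std_normal R) (heat_bm v 0 bF) bM.
have C1 := ex_cst (normal_prob 0 (Num.sqrt v) : probability (measurableTypeR R) R) M.
have C2 := ex_cst (@std_normal R) M.
rewrite C1 in E1; rewrite C2 in E2.
have L1 := EFin_bm_ex (normal_prob 0 (Num.sqrt v)) bh1.
have L2 := EFin_bm_ex (@std_normal R) bh2.
have K1 := etrans L1 H0.
have K2 := etrans K1 (esym L2).
have K3 := EFin_inj K2.
have K4 := etrans (esym E1) (etrans K3 E2).
exact (@addIr _ M _ _ K4).
Qed.

End smooth_functions.

(** * Weak convergence *)

Section smoothing.
Context (R : realType).
Notation leb := (@lebesgue_measure R).
Implicit Types (f F : R -> R).

Lemma is_derive_continuous f f' : (forall x : R, is_derive x 1 f (f' x)) -> continuous f.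
Proof.
by move=> df x; apply/differentiable_continuous/derivable1_diffP; exact: ex_derive.
Qed.

Lemma lipschitz_of_derive f f' (K : R) : (forall x : R, is_derive x 1 f (f' x)) ->
  (forall x, `|f' x| <= K) -> forall x y, `|f x - f y| <= K * `|x - y|.
Proof.
move=> df fK; have cf := is_derive_continuous df.
suff H x y : x <= y -> `|f y - f x| <= K * `|y - x|.
  move=> x y; case/orP: (le_total x y) => [/H|]; last exact: H.
  by rewrite distrC [`|y - x|]distrC.
move=> xy; have cs : {within `[x, y], continuous f} by exact: continuous_subspaceT.
have [c _ ->] := MVT_segment xy (fun z _ => df z) cs.
by rewrite normrM ler_wpM2r.
Qed.

Lemma le_of_derive0 f f' (C y : R) : (forall x : R, is_derive x 1 f (f' x)) -> f 0 = 0 ->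
  (forall s, `|s| <= `|y| -> `|f' s| <= C) -> `|f y| <= C * `|y|.
Proof.
move=> df f0 fC; have cf := is_derive_continuous df.
have cs a b : {within `[a, b], continuous f} by exact: continuous_subspaceT.
have [y0|y0] := leP 0 y.
  have [c] := MVT_segment y0 (fun z _ => df z) (cs _ _).
  rewrite in_itv/= => /andP[c0 cy]; rewrite f0 !subr0 => ->.
  by rewrite normrM ler_wpM2r// fC// !ger0_norm.
have [c] := MVT_segment (ltW y0) (fun z _ => df z) (cs _ _).
rewrite in_itv/= => /andP[yc c0]; rewrite f0 !sub0r => /(congr1 (@Num.norm R R)).
rewrite normrN normrM normrN => ->; rewrite ler_wpM2r// fC//.
by rewrite !ler0_norm ?lerN2// ltW.
Qed.

(** Three nested uses of the mean value inequality, each gaining one factor bounded by [|y|]; the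
    factorials of the sharp remainder are given up. *)
Lemma taylor2_of_derive (F F1 F2 F3 : R -> R) (K : R) :
  (forall x : R, is_derive x 1 F (F1 x)) -> (forall x : R, is_derive x 1 F1 (F2 x)) ->
  (forall x : R, is_derive x 1 F2 (F3 x)) -> (forall x, `|F3 x| <= K) ->
  taylor2 K F F1 F2.
Proof.
move=> dF dF1 dF2 FK x y.
have K0 : 0 <= K by exact: le_trans (FK 0).
have dshift (G G' : R -> R) : (forall x : R, is_derive x 1 G (G' x)) ->
    forall s : R, is_derive s 1 (fun s => G (x + s)) (G' (x + s)).
  move=> dG s; have := @is_derive1_comp R G (fun s => x + s) s _ 1 (dG _).
  rewrite mulr1; apply; have := @is_derive_shift R s 1 x.
  by rewrite /shift; under eq_fun do rewrite addrC.
have D2 s : `|F2 (x + s) - F2 x| <= K * `|s|.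
  by rewrite (le_trans (lipschitz_of_derive dF2 FK _ _))// addrAC subrr add0r.
have D1 s : `|s| <= `|y| -> `|F1 (x + s) - F1 x - s * F2 x| <= (K * `|y|) * `|s|.
  move=> sy; pose k s := F1 (x + s) - F1 x - s * F2 x.
  apply: (@le_of_derive0 k (fun s => F2 (x + s) - F2 x)).
  - move=> u; have := dshift _ _ dF1 u => dd; rewrite /k; apply: is_derive_eq.
    by rewrite subr0 scaler0 add0r; congr (_ - _); exact: mulr1.
  - by rewrite /k addr0 mul0r subr0 subrr.
  - by move=> u us; rewrite (le_trans (D2 u))// ler_wpM2l// (le_trans us).
pose k s := F (x + s) - F x - s * F1 x - s ^+ 2 / 2 * F2 x.
rewrite [X in _ <= _ * X]exprSr mulrA.
apply: (@le_of_derive0 k (fun s => F1 (x + s) - F1 x - s * F2 x)).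
- move=> u; have := dshift _ _ dF u => dd; rewrite /k; apply: is_derive_eq.
  move: (F1 _) (F1 _) (F2 _) => a b c.
  rewrite -[LHS]/(b - 0 - (u * 0 + a * 1) - (u ^+ 2 / 2 * 0 + c * (u ^+ 2 * (- 2 ^- 2 * 0) + 2^-1 * (u * 1 + u * 1)))).
  by field.
- by rewrite /k addr0 expr0n/= !mul0r !subr0 subrr.
- move=> u uy; rewrite (le_trans (D1 u uy))// expr2 mulrA ler_wpM2l//.
  by rewrite mulr_ge0.
Qed.

(** Convolution with a uniform kernel: its derivative is a difference quotient of [f], hence bounded
    as soon as [f] is. *)
Definition running_average (e : R) f (x : R) : R :=
  e^-1 * \int[leb]_(t in `[x, (x + e)%R]) f t.

Definition difference_quotient (e : R) f (x : R) : R := e^-1 * (f (x + e) - f x).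

Lemma continuous_integrable_itv f (a b : R) : continuous f ->
  leb.-integrable `[a, b] (EFin \o f).
Proof.
move=> cf; apply: (@continuous_compact_integrable _ f).
  exact: segment_compact.
exact: continuous_subspaceT.
Qed.

Lemma antiderivative f (a x : R) : continuous f -> a < x ->
  is_derive x 1 (fun y => \int[leb]_(t in `[a, y]) f t) (f x).
Proof.
move=> cf ax.
have xx1 : x < x + 1 by rewrite ltrDl.
have [dH HE] := continuous_FTC1_closed xx1 (continuous_integrable_itv a (x + 1) cf) ax (cf x).
by apply: (DeriveDef dH); rewrite -derive1E; exact: HE.
Qed.

(** With a base point [a] independent of [x], the average becomes a difference of antiderivatives,
    which can be differentiated. *)
Lemma running_averageE (e a x : R) f : continuous f -> 0 < e -> a < x ->
  running_average e f x =
  e^-1 * (\int[leb]_(t in `[a, (x + e)%R]) f t - \int[leb]_(t in `[a, x]) f t).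
Proof.
move=> cf e0 ax; rewrite /running_average; congr (_ * _).
have xxe : x <= x + e by rewrite lerDl ltW.
rewrite Rintegral_itvB.
- rewrite Rintegral_itv_obnd_cbnd//.
  apply: (integrableS _ _ _ (continuous_integrable_itv x (x + e) cf)) => //.
  by apply: subset_itvr; rewrite bnd_simp.
- exact: continuous_integrable_itv.
- by rewrite bnd_simp ltW.
- by rewrite bnd_simp.
Qed.

Lemma is_derive_running_average (e x : R) f : continuous f -> 0 < e ->
  is_derive x 1 (running_average e f) (difference_quotient e f x).
Proof.
move=> cf e0; pose H y := \int[leb]_(t in `[(x - 1)%R, y]) f t.
apply: (@near_eq_is_derive _ _ _ (fun y => e^-1 * (H (y + e) - H y))).
  near=> y; rewrite (@running_averageE e (x - 1))//.
  by near: y; apply: lt_nbhsr; rewrite ltrBlDl ltrDr.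
have d1 : is_derive x 1 H (f x) by apply: antiderivative => //; rewrite ltrBlDl ltrDr.
have d2 : is_derive (x + e) 1 H (f (x + e)).
  by apply: antiderivative => //; rewrite ltrBlDl addrCA ltrDl addr_gt0.
have d3 : is_derive x 1 (fun y => H (y + e)) (f (x + e)).
  have := @is_derive1_comp R H (fun y => y + e) x _ 1 d2.
  rewrite mulr1; apply; exact: is_derive_shift.
exact: is_derive_eq.
Unshelve. all: by end_near. Qed.

Lemma is_derive_difference_quotient (e : R) f f' :
  (forall x : R, is_derive x 1 f (f' x)) ->
  forall x : R, is_derive x 1 (difference_quotient e f) (difference_quotient e f' x).
Proof.
move=> df x.
have d3 : is_derive x 1 (fun y => f (y + e)) (f' (x + e)).
  have := @is_derive1_comp R f (fun y => y + e) x _ 1 (df _).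
  rewrite mulr1; apply; exact: is_derive_shift.
rewrite /difference_quotient; exact: is_derive_eq.
Qed.

Lemma difference_quotient_le (e M : R) f : 0 < e -> (forall x, `|f x| <= M) ->
  forall x, `|difference_quotient e f x| <= e^-1 * (M + M).
Proof.
move=> e0 fM x; rewrite normrM gtr0_norm ?invr_gt0// ler_pM2l ?invr_gt0//.
by rewrite (le_trans (ler_normB _ _))// lerD.
Qed.

Lemma running_average_mean (e x : R) f : continuous f -> 0 < e ->
  exists2 c, x <= c <= x + e & running_average e f x = f c.
Proof.
move=> cf e0; pose H y := \int[leb]_(t in `[(x - 1)%R, y]) f t.
have xxe : x <= x + e by rewrite lerDl ltW.
have dH y : x <= y -> is_derive y 1 H (f y).
  by move=> xy; apply: antiderivative => //; rewrite (lt_le_trans _ xy)// ltrBlDl ltrDr.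
have dH' y : y \in `]x, (x + e)[ -> is_derive y 1 H (f y).
  by rewrite in_itv/= => /andP[xy _]; apply: dH; exact: ltW.
have cH : {within `[x, x + e], continuous H}.
  apply: derivable_within_continuous => y; rewrite in_itv/= => /andP[xy _].
  by have := dH y xy => ?; exact: ex_derive.
have [c] := MVT_segment xxe dH' cH.
rewrite in_itv/= => xc Hc; exists c => //.
rewrite (@running_averageE e (x - 1))//; last by rewrite ltrBlDl ltrDr.
by rewrite -/(H _) -/(H _) Hc (addrC x) addrK mulrC mulfK// gt_eqF.
Qed.

Lemma running_average_le (e M : R) f : continuous f -> 0 < e -> (forall x, `|f x| <= M) ->
  forall x, `|running_average e f x| <= M.
Proof. by move=> cf e0 fM x; have [c _ ->] := running_average_mean x cf e0. Qed.

Lemma running_average_continuous (e : R) f : continuous f -> 0 < e ->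
  continuous (running_average e f).
Proof.
move=> cf e0; apply: (@is_derive_continuous _ (difference_quotient e f)) => x.
exact: is_derive_running_average.
Qed.

(* Each running average gains one derivative: take three of them. *)
Lemma smooth2_dense (h : R -> R) (M : R) : continuous h -> (forall x, `|h x| <= M) ->
  (forall e : R, 0 < e -> exists2 r : R, 0 < r & forall x y, `|x - y| < r -> `|h x - h y| < e) ->
  forall e : R, 0 < e -> exists F F1 F2 K, smooth2 K F F1 F2 /\ forall x, `|F x - h x| <= e.
Proof.
move=> ch hM uc e e0; have [r r0 hr] := uc _ e0.
(* Each average takes a value of its argument at distance at most [s]; after three the displacement
   is at most [3 * s < r]. *)
pose s := r / 4; have s0 : 0 < s by rewrite divr_gt0.
pose A := running_average s; pose D := difference_quotient s.
have cA f : continuous f -> continuous (A f) by move=> cf; exact: running_average_continuous.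
have dA f : continuous f -> forall x : R, is_derive x 1 (A f) (D f x).
  by move=> cf x; exact: is_derive_running_average.
have dD f f' : (forall x : R, is_derive x 1 f (f' x)) ->
  forall x : R, is_derive x 1 (D f) (D f' x) by exact: is_derive_difference_quotient.
have c1 := cA _ ch; have c2 := cA _ c1; have c3 := cA _ c2.
(* Each differentiation turns one [A] into a [D], so the third derivative involves only values of
   the bounded function [h]. *)
pose F := A (A (A h)); pose F1 := D (A (A h)); pose F2 := D (D (A h)); pose F3 := D (D (D h)).
have dF : forall x : R, is_derive x 1 F (F1 x) := dA _ c2.
have dF1 : forall x : R, is_derive x 1 F1 (F2 x) := dD _ _ (dA _ c1).
have dF2 : forall x : R, is_derive x 1 F2 (F3 x) := dD _ _ (dD _ _ (dA _ ch)).
have b1 := running_average_le ch s0 hM.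
have b2 := running_average_le c1 s0 b1.
have bF := running_average_le c2 s0 b2.
have bF1 := difference_quotient_le s0 b2.
have bF2 := difference_quotient_le s0 (difference_quotient_le s0 b1).
have bF3 := difference_quotient_le s0 (difference_quotient_le s0 (difference_quotient_le s0 hM)).
exists F, F1, F2, (s^-1 * (s^-1 * (s^-1 * (M + M) + s^-1 * (M + M))
   + s^-1 * (s^-1 * (M + M) + s^-1 * (M + M)))); split.
  split.
  - by exists M, (s^-1 * (M + M)); split=> //; exact: lipschitz_of_derive dF bF1.
  - exists (s^-1 * (M + M)), (s^-1 * (s^-1 * (M + M) + s^-1 * (M + M))); split=> //.
    exact: lipschitz_of_derive dF1 bF2.
  - by eexists; eexists; split; [exact: bF2|exact: lipschitz_of_derive dF2 bF3].
  - exact: taylor2_of_derive dF dF1 dF2 bF3.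
move=> x.
have [y1 /andP[xy1 y1x] E1] := running_average_mean x c2 s0.
have [y2 /andP[xy2 y2x] E2] := running_average_mean y1 c1 s0.
have [y3 /andP[xy3 y3x] E3] := running_average_mean y2 ch s0.
have EE : F x = h y3 := etrans E1 (etrans E2 E3).
rewrite EE.
apply/ltW/hr; have sE : r = 4 * s by rewrite /s; field.
by rewrite sE ger0_norm; lra.
Qed.

(** A continuous cutoff: being an admissible test function, it transfers tightness from the limit
    law to the sequence. *)
Definition tent (K x : R) : R := Num.max 0 (Num.min 1 (K + 1 - `|x|)).

Lemma tent_ge0 K x : 0 <= tent K x. Proof. by rewrite le_max lexx. Qed.

Lemma tent_le1 K x : tent K x <= 1.
Proof. by rewrite ge_max ler01/= ge_min lexx. Qed.

Lemma tent_out K x : K + 1 <= `|x| -> tent K x = 0.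
Proof. by move=> Kx; apply/max_idPl; rewrite ge_min subr_le0 Kx orbT. Qed.

Lemma tent_in K x : `|x| <= K -> tent K x = 1.
Proof.
move=> xK; rewrite /tent (min_idPl _); last by lra.
by apply/max_idPr; exact: ler01.
Qed.

Lemma tent_continuous K : continuous (tent K).
Proof.
move=> x; apply: (@continuous_max _ _ (fun=> 0) (fun y => Num.min 1 (K + 1 - `|y|)) x).
  exact: cvg_cst.
apply: (@continuous_min _ _ (fun=> 1) (fun y => K + 1 - `|y|) x).
  exact: cvg_cst.
by apply: cvgB; [exact: cvg_cst|exact: (@norm_continuous _ R^o)].
Qed.

(** Heine's theorem on [[- K, K]]; the covering property already allows the second point to lie
    anywhere, and two points outside both have value 0. *)
Lemma compact_support_uniform (h : R -> R) (K : R) : continuous h ->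
  (forall x, K <= `|x| -> h x = 0) ->
  forall e : R, 0 < e -> exists2 r : R, 0 < r & forall x y, `|x - y| < r -> `|h x - h y| < e.
Proof.
move=> ch hK e e0.
have : near_covering `[- K, K].
  by apply/compact_near_coveringP; exact: segment_compact.
move=> /(_ R (0^'+) (fun r x => forall y, `|x - y| < r -> `|h x - h y| < e) _).
have H : forall x, `[- K, K]%classic x -> \forall x' \near x & r \near 0^'+,
    forall y, `|x' - y| < r -> `|h x' - h y| < e.
  move=> x _; have e2 : 0 < e / 2 by rewrite divr_gt0.
  have /cvgrPdist_lt /(_ _ e2) /nbhs_ballP[r /= r0 Br] := ch x.
  have r2 : 0 < r / 2 by rewrite divr_gt0.
  near=> x' s => y yx'.
  have xx' : `|x - x'| < r / 2 by near: x'; apply: cvgr_dist_lt => //; exact: cvg_id.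
  have sr : s < r / 2 by near: s; exact: nbhs_right_lt.
  rewrite (splitr e) -(subrKA (h x)) (le_lt_trans (ler_normD _ _))// ltrD//.
    rewrite distrC; apply: Br; rewrite /ball/= (lt_le_trans xx')// ler_pdivrMr//; lra.
  apply: Br; rewrite /ball/= (splitr r) -(subrKA x') (le_lt_trans (ler_normD _ _))// ltrD//.
  exact: lt_trans sr.
move=> /(_ H) {}H.
near (0 : R)^'+ => r; exists r => //.
have Hr : `[- K, K]%classic `<=` [set x | forall y, `|x - y| < r -> `|h x - h y| < e].
  by near: r.
move=> x y xy; have [xK|xK] := leP `|x| K.
  by apply: Hr => //=; rewrite in_itv/= -ler_norml.
have [yK|yK] := leP `|y| K.
  rewrite distrC; apply: (Hr y _ x); last by rewrite distrC.
  by rewrite /= in_itv/= -ler_norml.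
by rewrite !hK ?ltW// subrr normr0.
Unshelve. all: by end_near. Qed.

End smoothing.

(** * Weak convergence from smooth test functions *)

Section portmanteau.
Context (R : realType) (d : nat -> measure_display)
  (Omega : forall m, measurableType (d m)) (P : forall m, probability (Omega m) R)
  (Z : forall m, Omega m -> R) (L : probability (measurableTypeR R) R).
Arguments Z : clear implicits.

Lemma tent_tail (e : R) : 0 < e -> exists K, 1 - \int[L]_x tent K x <= e.
Proof.
move=> e0.
pose A (k : nat) : set (measurableTypeR R) := [set x : R | `|x| <= k%:R].
have mA k : measurable (A k).
  rewrite (_ : A k = `[- (k%:R : R), k%:R]%classic); first exact: measurable_itv.
  by apply/seteqP; split=> x /=; rewrite in_itv/= -ler_norml.
have cA : L (A k) @[k --> \oo] --> L (\bigcup_k A k).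
  apply: nondecreasing_cvg_mu => //; first exact: bigcup_measurable.
  move=> i j ij; apply/subsetPset => x /= /le_trans; apply; by rewrite ler_nat.
have AT : \bigcup_k A k = setT.
  apply/seteqP; split=> // x _; exists (Num.bound `|x|) => //.
  by apply/ltW/archi_boundP; exact: normr_ge0.
move: cA; rewrite AT probability_setT => /fine_cvgP[_ /cvgrPdist_le /(_ _ e0)].
move=> -[k _ /(_ k (leqnn k))] /= Hk; exists k%:R.
have : fine (L (A k)) <= \int[L]_x tent k%:R x.
  rewrite -ex_indic//; apply: bm_le_ex.
  - exact: bm_indic.
  - apply: (@bounded_continuous_bm _ _ 1); first exact: tent_continuous.
    by move=> x; rewrite ger0_norm ?tent_ge0 ?tent_le1.
  - move=> x; rewrite indicE; case: (boolP (x \in A k)) => [|_]; last exact: tent_ge0.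
    by rewrite inE /A /= => /tent_in ->.
move: Hk; rewrite ler_norml => /andP[_]; lra.
Qed.

(** Uniformly continuous [h] are uniform limits of smooth functions. In particular the tents are
    covered, whence the sequence is tight, and a general [h] is replaced by its product with a
    tent. *)
Lemma cvg_in_distribution_smooth2 : (forall m, measurable_fun setT (Z m)) ->
  (forall K F F1 F2, smooth2 K F F1 F2 ->
     (\int[P m]_t F (Z m t)) @[m --> \oo] --> \int[L]_x F x) ->
  cvg_in_distribution P Z L.
Proof.
move=> mZ H.
have bmZ (h : R -> R) (M : R) m : continuous h -> (forall x, `|h x| <= M) ->
    bounded_measurable (fun t => h (Z m t)).
  move=> ch hM; apply: (@bm_le _ _ _ _ M) => //; apply: measurableT_comp => //.
  exact: continuous_measurable_fun.
have Huc (h : R -> R) (M : R) : continuous h -> (forall x, `|h x| <= M) ->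
    (forall e : R, 0 < e -> exists2 r : R, 0 < r & forall x y, `|x - y| < r -> `|h x - h y| < e) ->
    (\int[P m]_t h (Z m t)) @[m --> \oo] --> \int[L]_x h x.
  move=> ch hM uc; apply/cvgrPdist_le => e e0.
  have e3 : 0 < e / 3 by rewrite divr_gt0.
  have [F [F1 [F2 [K [sF Fh]]]]] := smooth2_dense ch hM uc e3.
  have [bF _ _ _] := sF; have cF := bounded_lipschitz_continuous bF.
  have bFZ m : bounded_measurable (fun t => F (Z m t)).
    exact: bounded_lipschitz_bm.
  have bFL : bounded_measurable (F : measurableTypeR R -> R).
    exact: (bounded_lipschitz_bm (g := fun x => x) bF).
  have bhL := bounded_continuous_bm ch hM.
  have /cvgrPdist_le /(_ _ e3) := H _ _ _ _ sF.
  apply: filterS => m Hm.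
  have E1 : `|\int[L]_x F x - \int[L]_x h x| <= e / 3.
    by rewrite -bm_exB//; apply: bm_norm_ex => //; exact: bmB.
  have E2 : `|\int[P m]_t F (Z m t) - \int[P m]_t h (Z m t)| <= e / 3.
    rewrite -bm_exB//; last exact: bmZ ch hM.
    by apply: bm_norm_ex => //; apply: bmB => //; exact: bmZ ch hM.
  move: Hm E1 E2; rewrite !ler_norml.
  move: (\int[L]_x F x) (\int[L]_x h x) (\int[P m]_t F (Z m t)) (\int[P m]_t h (Z m t)).
  by move=> a b c e' /andP[? ?] /andP[? ?] /andP[? ?]; apply/andP; split; lra.
move=> h ch [M hM].
have M0 : 0 <= M by exact: le_trans (hM 0).
apply/cvgrPdist_le => e e0.
(* The cutoff costs [M * e'] under [L] and [M * (2 * e')] under [P m], and the convergence for [g]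
   costs [e']. *)
pose e' := e / (4 * (M + 1)).
have M1 : 0 < 4 * (M + 1) by rewrite mulr_gt0// ltr_wpDl.
have e'0 : 0 < e' by rewrite divr_gt0.
have [K LK] := tent_tail e'0.
have ct := @tent_continuous R K.
have tM x : `|tent K x| <= 1 by rewrite ger0_norm ?tent_ge0 ?tent_le1.
pose g x := h x * tent K x.
have cg : continuous g by move=> x; apply: cvgM; [exact: ch|exact: ct].
have gM x : `|g x| <= M by rewrite normrM -[M]mulr1 ler_pM.
have ct0 : (\int[P m]_t tent K (Z m t)) @[m --> \oo] --> \int[L]_x tent K x.
  by apply: (Huc _ _ ct tM); apply: (compact_support_uniform ct) => x; exact: tent_out.
have cg0 : (\int[P m]_t g (Z m t)) @[m --> \oo] --> \int[L]_x g x.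
  apply: (Huc _ _ cg gM); apply: (@compact_support_uniform _ _ (K + 1) cg) => x Kx.
  by rewrite /g tent_out// mulr0.
have close d' (T : measurableType d') (Q : probability T R) (Y : T -> R) :
    measurable_fun setT Y ->
    `|\int[Q]_t h (Y t) - \int[Q]_t g (Y t)| <= M * (1 - \int[Q]_t tent K (Y t)).
  move=> mY.
  have bh : bounded_measurable (fun t => h (Y t)).
    by apply: (@bm_le _ _ _ _ M) => //; apply: measurableT_comp => //; exact: continuous_measurable_fun.
  have bg : bounded_measurable (fun t => g (Y t)).
    by apply: (@bm_le _ _ _ _ M) => //; apply: measurableT_comp => //; exact: continuous_measurable_fun.
  have bt : bounded_measurable (fun t => tent K (Y t)).
    by apply: (@bm_le _ _ _ _ 1) => //; apply: measurableT_comp => //; exact: continuous_measurable_fun.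
  have b1 : bounded_measurable (fun t => 1 - tent K (Y t)) by apply: bmB => //; exact: bm_cst.
  rewrite -bm_exB// -{1}(ex_cst Q 1) -bm_exB//; last exact: bm_cst.
  rewrite -bm_exZ// (le_trans (le_normr_Rintegral _ _))//.
    by apply: bm_integrable; exact: bmB.
  apply: bm_le_ex; last first.
  - move=> t; rewrite /g -{1}[h (Y t)]mulr1 -mulrBr normrM ler_pM//.
    by rewrite ger0_norm// subr_ge0 tent_le1.
  - by apply: bmM => //; exact: bm_cst.
  - have [mhg _] := bmB bh bg; apply: (@bm_le _ _ _ _ (M + M)).
      by apply: measurableT_comp => //; exact: (@normr_measurable R setT).
    by move=> t; rewrite normr_id (le_trans (ler_normB _ _))// lerD.
have CL := close _ _ L (fun x => x) (@measurable_id _ _ _).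
move/cvgrPdist_le : ct0 => /(_ _ e'0) ct0; move/cvgrPdist_le : cg0 => /(_ _ e'0) cg0.
near=> m.
have E1 : `|\int[L]_x tent K x - \int[P m]_t tent K (Z m t)| <= e' by near: m.
have E2 : `|\int[L]_x g x - \int[P m]_t g (Z m t)| <= e' by near: m.
have CP := close _ _ (P m) (Z m) (mZ m).
have eE : e = 4 * (M + 1) * e' by rewrite /e' mulrC divfK// gt_eqF.
move: E1 E2 CL CP LK; rewrite eE !ler_norml.
move: (\int[L]_x tent K x) (\int[P m]_t tent K (Z m t)) => a b.
move: (\int[L]_x h x) (\int[L]_x g x) (\int[P m]_t g (Z m t)) (\int[P m]_t h (Z m t)).
move=> p q r s /andP[? ?] /andP[? ?] /andP[? ?] /andP[? ?] ?.
have h1 : M * (1 - a) <= M * e' by rewrite ler_wpM2l.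
have h2 : M * (1 - b) <= M * (2 * e') by rewrite ler_wpM2l//; lra.
by apply/andP; split; nra.
Unshelve. all: by end_near. Qed.

End portmanteau.

(** * Multinomial sums and Lindeberg replacement *)

Section multinomial.
Context (R : realType) (m : nat).
Implicit Types (p a : 'I_m -> R) (F : R -> R) (N M : nat).

(* One step of a random walk with i.i.d. steps, equal to [a i] with probability
   [p i]: [iter N (average_step p a) F x] is the mean of F at its position after N
   steps from x. *)
Definition average_step p a F (x : R) : R := \sum_(i < m) p i * F (x + a i).

(** Taking one copy of [i] away divides the product of factorials by [k i] and removes one factor
    [p i]. Summing the resulting factors [k i] over [i] produces the [N.+1] missing from the
    factorial. *)
Lemma pmf_pred N p (k : 'I_m -> nat) (i : 'I_m) : (0 < k i)%N ->
  p i * multinomial_pmf N p (fun j => (k j - (j == i))%N) =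
  (k i)%:R * (if (\sum_(j < m) k j == N.+1)%N
    then (N`!)%:R / (\prod_(j < m) ((k j)`!)%:R) * \prod_(j < m) p j ^+ k j else 0).
Proof.
move=> ki; rewrite /multinomial_pmf.
have E1 : (\sum_(j < m) k j = (\sum_(j < m) (k j - (j == i))).+1)%N.
  rewrite (bigD1 i)//= [in RHS](bigD1 i)//= eqxx.
  have -> : (\sum_(j < m | j != i) (k j - (j == i)) = \sum_(j < m | j != i) k j)%N.
    by apply: eq_bigr => j /negbTE ->; rewrite subn0.
  have -> : (k i - true)%N = (k i).-1 by exact: subn1.
  by move: (\sum_(j < m | j != i) _)%N => A; lia.
rewrite E1 eqSS; case: ifP => _; last by rewrite !mulr0.
have Ef : \prod_(j < m) ((k j)`!)%:R = (k i)%:R * \prod_(j < m) (((k j - (j == i))`!)%N)%:R :> R.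
  rewrite (bigD1 i)//= [in RHS](bigD1 i)//= eqxx mulrA -natrM subn1 -[in LHS](prednK ki) factS prednK//.
  congr (_ * _); apply: eq_bigr => j /negbTE ->; by rewrite subn0.
have Ep : \prod_(j < m) p j ^+ k j = p i * \prod_(j < m) p j ^+ (k j - (j == i)).
  rewrite (bigD1 i)//= [in RHS](bigD1 i)//= eqxx mulrA subn1 -exprS prednK//.
  congr (_ * _); apply: eq_bigr => j /negbTE ->; by rewrite subn0.
have ki0 : (k i)%:R != 0 :> R by rewrite pnatr_eq0 -lt0n.
rewrite Ef Ep invfM; set A := \prod_(j < m) _; set B := \prod_(j < m) _.
move: A^-1 B ((N`!)%:R : R) (p i) ((k i)%:R : R) ki0 => V {}B n pi q q0.
by field.
Qed.

(** Conditioning on the outcome of one trial; values [i] with count 0 are excluded since subtraction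
    on naturals would truncate there. *)
Lemma pmf_rec N p (k : 'I_m -> nat) :
  multinomial_pmf N.+1 p k =
  \sum_(i < m | (0 < k i)%N) p i * multinomial_pmf N p (fun j => (k j - (j == i))%N).
Proof.
under eq_bigr => i ki do rewrite pmf_pred//.
rewrite -big_distrl /= /multinomial_pmf.
have [E|_] := eqVneq (\sum_(j < m) k j)%N N.+1; last by rewrite mulr0.
rewrite mulrA [in RHS]mulrA; congr (_ * _); rewrite factS natrM; congr (_ * _).
rewrite -E natr_sum [in LHS](bigID (fun i => (0 < k i)%N))/=.
by rewrite [X in _ + X]big1 ?addr0// => i; rewrite -eqn0Ngt => /eqP ->.
Qed.

(* The mean of [phi] under the multinomial law; [M >= N] bounds the counts, to make
   the index type finite. *)
Definition multinomial_sum M N p (phi : ('I_m -> nat) -> R) : R :=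
  \sum_(k : {ffun 'I_m -> 'I_M.+1}) multinomial_pmf N p (fun i => k i) * phi (fun i => k i).

Lemma multinomial_sum0 M p phi : multinomial_sum M 0 p phi = phi (fun=> 0%N).
Proof.
have Z (k : {ffun 'I_m -> 'I_M.+1}) : k != [ffun=> ord0] ->
    multinomial_pmf 0 p (fun i => k i) * phi (fun i => k i) = 0.
  move=> k0; rewrite /multinomial_pmf; case: eqP => [/eqP|]; last by rewrite mul0r.
  rewrite sum_nat_eq0 => /forallP H; case/negP: k0; apply/eqP/ffunP => i.
  by rewrite ffunE; apply/val_inj => /=; apply/eqP/(implyP (H i)).
rewrite /multinomial_sum (bigD1 [ffun=> ord0])//= (big1 _ _ _ Z) addr0.
have -> : (fun i => ([ffun=> ord0] : {ffun 'I_m -> 'I_M.+1}) i : nat) = fun=> 0%N.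
  by apply/funext => i; rewrite ffunE.
by rewrite /multinomial_pmf big1// eqxx fact0 !big1 ?divr1 ?mul1r.
Qed.

(** The recursion summed over counts: each term is reindexed by the counts left after removing one
    occurrence of [i]. *)
Lemma multinomial_sumS M N p (phi : ('I_m -> nat) -> R) : (N < M)%N ->
  multinomial_sum M N.+1 p phi =
  \sum_(i < m) p i * multinomial_sum M N p (fun k => phi (fun j => k j + (j == i))%N).
Proof.
move=> NM; rewrite /multinomial_sum.
under eq_bigr do rewrite pmf_rec big_distrl/= big_mkcond/=.
rewrite exchange_big /=; apply: eq_bigr => i _; rewrite -big_mkcond /= big_distrr/=.
pose inc (k : {ffun 'I_m -> 'I_M.+1}) : {ffun 'I_m -> 'I_M.+1} := [ffun j => inord (k j + (j == i))].
pose dec (k : {ffun 'I_m -> 'I_M.+1}) : {ffun 'I_m -> 'I_M.+1} := [ffun j => inord (k j - (j == i))].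
have decE k j : dec k j = (k j - (j == i))%N :> nat.
  by rewrite ffunE inordK// (leq_ltn_trans (leq_subr _ _)).
have incE (k : {ffun 'I_m -> 'I_M.+1}) j : (k i < M)%N -> inc k j = (k j + (j == i))%N :> nat.
  move=> ki; rewrite ffunE inordK//; have [->|_] := eqVneq j i; first lia.
  by rewrite addn0.
(* Counts with [k i] equal to [M] cannot be incremented within the index type, but they have
   probability 0 because the total is [N < M]. *)
rewrite [RHS](bigID (fun k : {ffun 'I_m -> 'I_M.+1} => (k i < M)%N))/= [X in _ = _ + X]big1 ?addr0; last first.
  move=> k; rewrite -leqNgt => Mk; rewrite /multinomial_pmf.
  case: eqP => [E|]; last by rewrite mul0r mulr0.
  have : (k i <= N)%N by rewrite -E (bigD1 i)//= leq_addr.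
  by move=> kN; have := leq_ltn_trans kN NM; rewrite ltnNge Mk.
rewrite (reindex_onto inc dec) /=; last first.
  move=> k ki; apply/ffunP => j; apply/val_inj => /=.
  have ki' : (dec k i < M)%N by rewrite decE eqxx; have := ltn_ord (k i); lia.
  rewrite incE// decE; have [->|_] := eqVneq j i; first lia.
  by rewrite subn0 addn0.
have cond k : (0 < inc k i)%N && (dec (inc k) == k) = (k i < M)%N.
  apply/andP/idP => [[k1 /eqP k2]|ki].
    have := decE (inc k) i; rewrite k2 eqxx; have := ltn_ord (inc k i); lia.
  rewrite incE// eqxx addn1; split=> //; apply/eqP/ffunP => j; apply/val_inj => /=.
  by rewrite decE incE// addnK.
rewrite (eq_bigl _ _ cond); apply: eq_bigr => k ki.
rewrite -mulrA; congr (_ * (multinomial_pmf N p _ * phi _)); apply/funext => j.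
  by rewrite incE// addnK.
by rewrite incE.
Qed.

(** A linear statistic of multinomial counts is a sum of N i.i.d. steps. This replaces multinomial
    algebra by induction on the number of steps. *)
Lemma multinomial_sum_iter M N p a F x : (N <= M)%N ->
  multinomial_sum M N p (fun k => F (x + \sum_(i < m) (k i)%:R * a i)) =
  iter N (average_step p a) F x.
Proof.
elim: N x => [|N IH] x NM.
  rewrite multinomial_sum0 big1 ?addr0// => i _; by rewrite mul0r.
rewrite multinomial_sumS// iterS /average_step; apply: eq_bigr => i _.
rewrite -IH ?(ltnW NM)//; congr (_ * _); apply: eq_bigr => k _.
congr (_ * F _); rewrite -addrA; congr (_ + _).
rewrite (bigD1 i)//= [in RHS](bigD1 i)//= eqxx natrD mulrDl mul1r.
rewrite [in RHS]addrA [a i + _]addrC; congr (_ + _).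
by apply: eq_bigr => j /negbTE ->; rewrite addn0.
Qed.

(** Squared mean plus variance of the walk, the variance being N times that of one step. *)
Lemma iter_average_step_sqr p a N x : \sum_(i < m) p i = 1 ->
  let mu := \sum_(i < m) p i * a i in
  iter N (average_step p a) (fun y => y ^+ 2) x =
  (x + N%:R * mu) ^+ 2 + N%:R * (\sum_(i < m) p i * a i ^+ 2 - mu ^+ 2).
Proof.
move=> p1 mu; elim: N x => [|N IH] x; first by rewrite !mul0r !addr0.
rewrite iterS /average_step; under eq_bigr do rewrite IH.
set c := N%:R * mu; set e := N%:R * _.
transitivity (\sum_(i < m) (p i * ((x + c) ^+ 2 + e) + 2 * (x + c) * (p i * a i) + p i * a i ^+ 2)).
  by apply: eq_bigr => i _; ring.
rewrite !big_split/= -big_distrl/= p1 -big_distrr/= -/mu -natr1 /e /c; ring.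
Qed.

Lemma smooth2_ge0 (K : R) F F1 F2 : smooth2 K F F1 F2 -> 0 <= K.
Proof.
by case=> _ _ _ /(_ 0 1); rewrite normr1 !expr1n mulr1; apply: le_trans.
Qed.

Lemma std_normal_abs3_ge0 : 0 <= @std_normal_abs3 R.
Proof. by apply: Rintegral_ge0 => z _; rewrite exprn_ge0. Qed.

(* The steps are replaced one at a time by centred Gaussian ones of the same variance. *)
Lemma lindeberg (K b : R) F F1 F2 p a N x : smooth2 K F F1 F2 ->
  (forall i, 0 <= p i) -> \sum_(i < m) p i = 1 -> \sum_(i < m) p i * a i = 0 ->
  0 <= b -> (forall i, `|a i| <= b) ->
  `|iter N (average_step p a) F x - heat (N%:R * \sum_(i < m) p i * a i ^+ 2) F x|
    <= N%:R * (K * (1 + @std_normal_abs3 R) * b ^+ 3).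
Proof.
move=> sF p0 p1 pa b0 ab; set v := \sum_(i < m) p i * a i ^+ 2.
have v0 : 0 <= v by apply: sumr_ge0 => i _; rewrite mulr_ge0 ?sqr_ge0.
have K0 := smooth2_ge0 sF.
have vb : v <= b ^+ 2.
  rewrite -[leRHS]mul1r -p1 big_distrl/=; apply: ler_sum => i _; rewrite ler_wpM2l//.
  by rewrite -(real_normK (num_real (a i))) lerXn2r ?nnegrE.
have sb : Num.sqrt v <= b by rewrite -[leRHS]ger0_norm// -sqrtr_sqr ler_wsqrtr.
elim: N x => [|N IH] x; first by rewrite !mul0r heat0 subrr normr0.
set C := K * (1 + _) * _ in IH *.
rewrite iterS /average_step.
have Nv0 : 0 <= N%:R * v by rewrite mulr_ge0.
(* By induction the last N steps are already Gaussian, which turns [F] into [G] with the same [K].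
   The two candidates for the remaining step are compared with the second order expansion of [G] at
   [x], where their first two moments agree; the remainders are [K * b ^+ 3] and that times the
   third absolute Gaussian moment. *)
have sG := taylor2_heat (N%:R * v) sF.
set G := heat (N%:R * v) F in sG IH; set G1 := heat _ F1 in sG; set G2 := heat _ F2 in sG.
have -> : heat (N.+1%:R * v) F x = heat v G x.
  rewrite heat_heat//; last by case: sF.
  by rewrite -natr1 mulrDl mul1r addrC.
have E1 : `|\sum_(i < m) p i * iter N (average_step p a) F (x + a i) - \sum_(i < m) p i * G (x + a i)| <= N%:R * C.
  rewrite -sumrB -[leRHS]mul1r -[in X in _ <= X * _]p1 big_distrl/=; apply: (le_trans (ler_norm_sum _ _ _)).
  by apply: ler_sum => i _; rewrite -mulrBr normrM ger0_norm// ler_wpM2l.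
have E2 : `|\sum_(i < m) p i * G (x + a i) - G x - v / 2 * G2 x| <= K * b ^+ 3.
  have -> : \sum_(i < m) p i * G (x + a i) - G x - v / 2 * G2 x =
      \sum_(i < m) p i * (G (x + a i) - G x - a i * G1 x - a i ^+ 2 / 2 * G2 x).
    transitivity (\sum_(i < m) p i * G (x + a i) - (\sum_(i < m) p i) * G x
       - (\sum_(i < m) p i * a i) * G1 x - v * (2^-1 * G2 x)).
      by rewrite p1 pa mul1r mul0r subr0 mulrA.
    rewrite /v !big_distrl/= -!sumrB; apply: eq_bigr => i _; ring.
  rewrite -[leRHS]mul1r -[in X in _ <= X * _]p1 big_distrl/=; apply: (le_trans (ler_norm_sum _ _ _)).
  apply: ler_sum => i _; rewrite normrM ger0_norm// ler_wpM2l//.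
  case: sG => _ _ _ /(_ x (a i)) /le_trans; apply.
  by rewrite ler_wpM2l// lerXn2r ?nnegrE.
have E3 := heat_taylor x v0 sG.
have E3' : K * Num.sqrt v ^+ 3 * @std_normal_abs3 R <= K * b ^+ 3 * @std_normal_abs3 R.
  apply: ler_wpM2r; first exact: std_normal_abs3_ge0.
  by apply: ler_wpM2l => //; rewrite lerXn2r ?nnegrE// sqrtr_ge0.
have -> : N.+1%:R * C = N%:R * C + (K * b ^+ 3 + K * b ^+ 3 * @std_normal_abs3 R).
  by rewrite -natr1 /C; ring.
move: E1 E2 (le_trans E3 E3'); rewrite !ler_norml.
move: (\sum_(i < m) _) (\sum_(i < m) _) (heat v G x) (v / 2 * G2 x) (G x) => q r s u w.
by move: (N%:R * C) (K * b ^+ 3) (K * b ^+ 3 * _) => e1 e2 e3 /andP[? ?] /andP[? ?] /andP[? ?]; apply/andP; split; lra.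
Qed.

End multinomial.

(** * Conditional expectation *)

Section truncn_measurable.
Context (R : realType).

Lemma measurable_truncn : measurable_fun [set: R] (@Num.truncn R).
Proof.
move=> _ Y _; rewrite setTI.
have mlt (a : R) : measurable [set x : R | x < a].
  rewrite (_ : [set x : R | x < a] = `]-oo, a[%classic); first exact: measurable_itv.
  by apply/seteqP; split=> x /=; rewrite in_itv.
have meq n : measurable [set x : R | Num.truncn x = n].
  rewrite (_ : [set x : R | Num.truncn x = n] =
    [set x | x < n.+1%:R] `\` (if n is k.+1 then [set x : R | x < k.+1%:R] else set0)).
    by apply: measurableD; [exact: mlt|case: n => // k; exact: mlt].
  apply/seteqP; split=> x /=.
    move=> xn; rewrite -truncn_le_nat xn; split=> //.
    case: n xn => [|k] xk; first by [].
    move=> xk1; have : (Num.truncn x <= k)%N by rewrite truncn_le_nat.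
    by rewrite xk ltnn.
  case: n => [|k]; rewrite -truncn_le_nat; first by rewrite leqn0 => -[/eqP].
  by move=> [xk] /=; rewrite -truncn_le_nat => /negP; rewrite -ltnNge => kx; apply/eqP; rewrite eqn_leq xk.
rewrite (_ : _ @^-1` Y = \bigcup_(n in Y) [set x : R | Num.truncn x = n]).
  exact: bigcup_measurable.
by apply/seteqP; split=> x /=; [exists (Num.truncn x)|move=> [n Yn] /= ->].
Qed.

Lemma measurable_natr d (T : measurableType d) (f : T -> nat) :
  measurable_fun setT f -> measurable_fun setT (fun t => (f t)%:R : R).
Proof. by move=> mf; apply: (@measurableT_comp _ _ _ _ _ _ (fun n : nat => n%:R : R)). Qed.

Lemma measurable_fun_truncn d (T : measurableType d) (f : T -> R) :
  measurable_fun setT f -> measurable_fun setT (fun t => Num.truncn (f t)).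
Proof. by move=> mf; apply: measurableT_comp => //; exact: measurable_truncn. Qed.

End truncn_measurable.

(** * Conditional expectation given a generated sigma-algebra *)

Section conditional_expectation.
Context d (T : measurableType d) (R : realType) (P : probability T R).
Implicit Types (f h U Y Z H : T -> R).

Lemma integrable_bmM f h : bounded_measurable h -> P.-integrable setT (EFin \o f) ->
  P.-integrable setT (EFin \o (fun t => h t * f t)).
Proof.
move=> [mh [M hM]] If; have If' := integrableZl measurableT M If.
have [/measurable_EFinP mf _] := integrableP _ _ _ If.
apply: (le_integrable measurableT _ _ If').
  by apply/measurable_EFinP; exact: measurable_funM.
move=> t _; rewrite /= lee_fin !normrM ler_wpM2r// (le_trans (hM t))//.
exact: ler_norm.
Qed.

Lemma EFin_Rintegral f : P.-integrable setT (EFin \o f) ->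
  (\int[P]_t f t)%:E = (\int[P]_t (f t)%:E)%E.
Proof. by move=> If; rewrite /Rintegral fineK//; exact: integrable_fin_num. Qed.

Lemma integral_indicE f (A : set T) : measurable A -> P.-integrable setT (EFin \o f) ->
  (\int[P]_(t in A) (f t)%:E)%E = (\int[P]_t (\1_A t * f t))%:E.
Proof.
move=> mA If; rewrite EFin_Rintegral; last by apply: integrable_bmM => //; exact: bm_indic.
rewrite integral_mkcond; apply: eq_integral => t _.
by rewrite patchE indicE; case: (t \in A); rewrite ?mul1r ?mul0r.
Qed.

Lemma integrable_addr f h : P.-integrable setT (EFin \o f) ->
  P.-integrable setT (EFin \o h) -> P.-integrable setT (EFin \o (fun t => f t + h t)).
Proof. by move=> If Ih; exact: (integrableD measurableT If Ih). Qed.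

Lemma integrable_subr f h : P.-integrable setT (EFin \o f) ->
  P.-integrable setT (EFin \o h) -> P.-integrable setT (EFin \o (fun t => f t - h t)).
Proof. by move=> If Ih; exact: (integrableB measurableT If Ih). Qed.

Lemma integrable_sumr (I : Type) (s : seq I) (F : I -> T -> R) :
  (forall i, P.-integrable setT (EFin \o F i)) ->
  P.-integrable setT (EFin \o (fun t => \sum_(i <- s) F i t)).
Proof.
move=> IF; elim: s => [|i s IH].
  rewrite (_ : (fun t => _) = fun=> 0); last by apply/funext => t; rewrite big_nil.
  by apply: bm_integrable; exact: bm_cst.
rewrite (_ : (fun t => _) = (fun t => F i t + \sum_(j <- s) F j t)).
  exact: integrable_addr.
by apply/funext => t; rewrite big_cons.
Qed.

Lemma Rintegral_sumr (I : Type) (s : seq I) (F : I -> T -> R) :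
  (forall i, P.-integrable setT (EFin \o F i)) ->
  \int[P]_t (\sum_(i <- s) F i t) = \sum_(i <- s) \int[P]_t F i t.
Proof.
move=> IF; elim: s => [|i s IH].
  by under eq_Rintegral do rewrite big_nil; rewrite big_nil ex_cst.
under eq_Rintegral do rewrite big_cons.
by rewrite big_cons RintegralD//= ?IH//; exact: integrable_sumr.
Qed.

Variable C : set (set T).
Hypothesis hC : C `<=` measurable.
Notation G := <<s C>>.
Notation TC := (g_sigma_algebraType C).

Lemma generated_measurable : G `<=` measurable.
Proof. by apply: smallest_sub => //; exact: sigma_algebra_measurable. Qed.

(** Measurability with respect to [G] becomes ordinary measurability on the type [TC], so the
    closure properties of measurable functions apply to it. *)
Lemma measurable_generatedP Y :
  (forall B : set R, measurable B -> G (Y @^-1` B)) <->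
  measurable_fun [set: TC] (Y : TC -> R).
Proof.
by split=> H; [move=> _ B mB; rewrite setTI; exact: H|move=> B mB; have := H measurableT B mB; rewrite setTI].
Qed.

Lemma measurable_fun_generated Y : measurable_fun [set: TC] (Y : TC -> R) ->
  measurable_fun setT Y.
Proof. by move=> mY _ B mB; apply: generated_measurable; exact: mY. Qed.

Lemma is_cond_expP Z Y : P.-integrable setT (EFin \o Z) ->
  is_cond_exp P G Z Y <->
  [/\ measurable_fun [set: TC] (Y : TC -> R), P.-integrable setT (EFin \o Y)
    & forall A, G A -> \int[P]_t (\1_A t * Y t) = \int[P]_t (\1_A t * Z t)].
Proof.
move=> IZ; split=> -[/measurable_generatedP mY IY YZ]; split=> // A GA.
  have mA := generated_measurable GA.
  by apply: EFin_inj; rewrite -!integral_indicE// YZ.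
have mA := generated_measurable GA.
by rewrite !integral_indicE// YZ.
Qed.

(** [H] is a uniform limit of finite combinations of indicators of sets of [G], against which [U]
    integrates to 0. *)
Lemma pull_out_ge0 U H (M : R) : P.-integrable setT (EFin \o U) ->
  (forall A, G A -> \int[P]_t (\1_A t * U t) = 0) ->
  measurable_fun [set: TC] (H : TC -> R) -> (forall t, 0 <= H t <= M) ->
  \int[P]_t (H t * U t) = 0.
Proof.
move=> IU U0 mH HM; have mH' := measurable_fun_generated mH.
have bH : bounded_measurable H.
  by apply: (@bm_le _ _ _ _ M) => // t; have /andP[H0 H1] := HM t; rewrite ger0_norm.
have M0 : 0 <= M by have /andP[H0] := HM point; exact: le_trans.
have key (n : nat) : `|\int[P]_t (H t * U t)| <= n.+1%:R^-1 * \int[P]_t `|U t|.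
  pose N := (Num.truncn (n.+1%:R * M)).+1.
  pose A j := [set t | Num.truncn (n.+1%:R * H t) = j].
  have GA j : G (A j).
    have mTC : measurable_fun [set: TC] (fun t : TC => Num.truncn (n.+1%:R * H t)).
      by apply: measurable_fun_truncn; exact: measurable_funM.
    by have := mTC measurableT [set j] I; rewrite setTI.
  have mA j := generated_measurable (GA j).
  (* [H] rounded down to a multiple of [n.+1%:R^-1]; the bound [M] leaves only [N] levels. *)
  pose Hn (t : T) : R := \sum_(j < N) (j%:R / n.+1%:R) * \1_(A j) t.
  have HnE t : Hn t = (Num.truncn (n.+1%:R * H t))%:R / n.+1%:R.
    have jN : (Num.truncn (n.+1%:R * H t) < N)%N.
      by rewrite ltnS; apply: le_truncn; rewrite ler_wpM2l//; have /andP[] := HM t.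
    rewrite /Hn (bigD1 (Ordinal jN))//= big1 ?addr0 => [|j jt].
      by rewrite indicE mem_set// mulr1.
    rewrite indicE memNset ?mulr0// /A /= => E; case/negP: jt.
    by apply/eqP/val_inj => /=; rewrite E.
  have bHn : bounded_measurable Hn.
    apply: bm_sum => j; apply: bmM; [exact: bm_cst|exact: bm_indic].
  have HHn t : `|H t - Hn t| <= n.+1%:R^-1.
    have /andP[H0 _] := HM t.
    have n0 : 0 < n.+1%:R :> R by rewrite ltr0n.
    have /andP[t1 t2] := truncn_itv (mulr_ge0 (ltW n0) H0).
    rewrite HnE -{1}[H t](mulKf (lt0r_neq0 n0)) mulrC -mulrBl normrM.
    rewrite [X in _ * X]gtr0_norm ?invr_gt0// ler_piMl ?invr_ge0//.
    rewrite ger0_norm ?subr_ge0// lerBlDr addrC natr1; exact: ltW.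
  have In : \int[P]_t (Hn t * U t) = 0.
    under eq_Rintegral do rewrite /Hn big_distrl/=.
    have IAU j : P.-integrable setT (EFin \o (fun t => \1_(A j) t * U t)).
      by apply: integrable_bmM => //; exact: bm_indic.
    rewrite Rintegral_sumr => [|j]; last first.
      by apply: integrable_bmM => //; apply: bmM; [exact: bm_cst|exact: bm_indic].
    rewrite big1// => j _.
    transitivity (j%:R / n.+1%:R * \int[P]_t (\1_(A j) t * U t)).
      by rewrite -RintegralZl//; apply: eq_Rintegral => t _; rewrite mulrA.
    by rewrite U0 ?mulr0//; exact: GA.
  rewrite -[\int[P]_t (H t * U t)]subr0 -In -RintegralB//; [|exact: integrable_bmM..].
  have bHHn := bmB bH bHn.
  rewrite (le_trans (le_normr_Rintegral _ _))//.
    exact: (integrable_subr (integrable_bmM bH IU) (integrable_bmM bHn IU)).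
  rewrite -RintegralZl//; last exact: (integrable_norm IU).
  apply: le_Rintegral => //.
  - exact: (integrable_norm (integrable_subr (integrable_bmM bH IU) (integrable_bmM bHn IU))).
  - exact: (integrableZl measurableT _ (integrable_norm IU)).
  - by move=> t _; rewrite -mulrBl normrM ler_wpM2r.
apply/eqP; rewrite -normr_eq0 eq_le normr_ge0 andbT.
apply/ler_addgt0Pl => e e0; rewrite addr0.
set V := \int[P]_t `|U t| in key.
have V0 : 0 <= V by apply: Rintegral_ge0.
have [k kV] : exists k : nat, V / e <= k.+1%:R.
  by exists (Num.bound (V / e)); rewrite (le_trans (ltW (archi_boundP _)))// ?ler_nat// divr_ge0// ltW.
apply: (le_trans (key k)); rewrite mulrC ler_pdivrMr ?ltr0n//.
by rewrite mulrC -ler_pdivrMr.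
Qed.

(** Shift [H] by its bound to make it nonnegative; the constant contributes 0 since [setT] belongs
    to [G]. *)
Lemma pull_out U H : P.-integrable setT (EFin \o U) ->
  (forall A, G A -> \int[P]_t (\1_A t * U t) = 0) ->
  measurable_fun [set: TC] (H : TC -> R) -> (exists M, forall t, `|H t| <= M) ->
  \int[P]_t (H t * U t) = 0.
Proof.
move=> IU U0 mH [M HM].
have GT : G setT by exact: (@measurableT _ TC).
have mHM : measurable_fun [set: TC] (fun t : TC => H t + M) by exact: measurable_funD.
have bH : bounded_measurable H by apply: (bm_le _ HM); exact: measurable_fun_generated.
have E : \int[P]_t ((H t + M) * U t) = 0.
  apply: (@pull_out_ge0 U _ (M + M)) => // t; rewrite lerD2r; have := HM t.
  by rewrite ler_norml => /andP[H1 ->]; rewrite -lerBlDr sub0r H1.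
move: E; under eq_Rintegral do rewrite mulrDl.
rewrite RintegralD//; [|exact: integrable_bmM|by apply: integrable_bmM => //; exact: bm_cst].
rewrite RintegralZl//; have := U0 _ GT.
by under eq_Rintegral do rewrite indicT mul1r; move=> ->; rewrite mulr0 addr0.
Qed.

Lemma is_cond_expM Z Y H : P.-integrable setT (EFin \o Z) -> is_cond_exp P G Z Y ->
  measurable_fun [set: TC] (H : TC -> R) -> (exists M, forall t, `|H t| <= M) ->
  is_cond_exp P G (fun t => H t * Z t) (fun t => H t * Y t).
Proof.
move=> IZ /(is_cond_expP _ IZ)[mY IY YZ] mH bH.
have bH' : bounded_measurable H.
  by case: bH => M HM; apply: (bm_le _ HM); exact: measurable_fun_generated.
have IHZ := integrable_bmM bH' IZ; have IHY := integrable_bmM bH' IY.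
apply/is_cond_expP => //; split=> //; first exact: measurable_funM.
move=> A GA; have mA := generated_measurable GA.
have bA : bounded_measurable (\1_A : T -> R) by exact: bm_indic.
have mA' : measurable_fun [set: TC] (\1_A : TC -> R) by exact: measurable_indic.
apply/eqP; rewrite -subr_eq0 -RintegralB//; [|exact: integrable_bmM..].
under eq_Rintegral do rewrite -mulrBr -mulrBr mulrA.
apply/eqP; apply: (@pull_out (fun t => Y t - Z t) (fun t => \1_A t * H t)).
- exact: integrable_subr.
- move=> B GB; have mB := generated_measurable GB.
  have bB : bounded_measurable (\1_B : T -> R) by exact: bm_indic.
  under eq_Rintegral do rewrite mulrBr.
  by rewrite RintegralB// ?YZ ?subrr//; exact: integrable_bmM.
- exact: measurable_funM.
- by case: (bmM bA bH').
Qed.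

Lemma is_cond_exp_sum (I : finType) (Z Y : I -> T -> R) :
  (forall i, P.-integrable setT (EFin \o Z i)) -> (forall i, is_cond_exp P G (Z i) (Y i)) ->
  is_cond_exp P G (fun t => \sum_i Z i t) (fun t => \sum_i Y i t).
Proof.
move=> IZ ZY.
have mY i : measurable_fun [set: TC] (Y i : TC -> R) by have /(is_cond_expP _ (IZ i))[] := ZY i.
have IY i : P.-integrable setT (EFin \o Y i) by have [] := ZY i.
apply/is_cond_expP; first exact: integrable_sumr.
split; [exact: measurable_sum|exact: integrable_sumr|].
move=> A GA; have bA : bounded_measurable (\1_A : T -> R).
  exact/bm_indic/generated_measurable.
under eq_Rintegral do rewrite big_distrr/=.
under [in RHS]eq_Rintegral do rewrite big_distrr/=.
rewrite !Rintegral_sumr; [|by move=> i; exact: integrable_bmM..].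
by apply: eq_bigr => i _; have /(is_cond_expP _ (IZ i))[_ _ ->] := ZY i.
Qed.

(** Restriction to [G] is the pushforward along the identity map from [T] to [TC]. The version is
    the Radon-Nikodym derivative there of the charge with density [Z], with respect to the
    pushforward of [P]. *)
Lemma is_cond_exp_exists Z : P.-integrable setT (EFin \o Z) -> exists Y, is_cond_exp P G Z Y.
Proof.
move=> IZ.
have mid : measurable_fun [set: T] (id : T -> TC).
  by move=> _ B GB; rewrite setTI; exact: generated_measurable.
have inid : (id : T -> TC) \in mfun by rewrite inE.
pose X : {RV P >-> TC} := mfun_Sub inid.
pose Q := distribution P X.
pose nu := induced_charge IZ.
have dom0 : nu `<< P.
  apply/null_content_dominatesP => A mA PA0; apply: null_set_integral => //.
  by apply: measurable_funTS; exact: measurable_int IZ.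
have domQ := @dominates_pushforward _ _ T TC R P nu X mid dom0.
have RNfin x := @Radon_Nikodym_fin_num _ TC R (pushforward nu X) Q x domQ.
have RNint := @Radon_Nikodym_integrable _ TC R (pushforward nu X) Q domQ.
have RNE A := @Radon_Nikodym_integral _ TC R (pushforward nu X) Q A domQ.
have {}RNfin := RNfin mid; have {}RNint := RNint mid; have {}RNE := RNE mid.
move: RNfin RNint RNE; set rn := Radon_Nikodym _ _ => RNfin RNint RNE.
have mrn : measurable_fun [set: TC] rn by exact: measurable_int RNint.
have mrnT : measurable_fun [set: T] rn.
  by move=> _ B mB; apply: generated_measurable; exact: mrn.
have IrnT : P.-integrable setT rn.
  apply/integrableP; split=> //; have /integrableP[_] := RNint.
  rewrite ge0_integral_distribution//.
  by apply: measurableT_comp.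
exists (fine \o rn); split.
- apply/measurable_generatedP.
  by apply: measurableT_comp => //; exact: measurable_fine.
- rewrite (_ : EFin \o _ = rn)//.
  by apply/funext => x /=; rewrite fineK.
- move=> A GA; have mA := generated_measurable GA.
  transitivity (\int[P]_(t in A) rn t)%E.
    by apply: eq_integral => x _; rewrite /= fineK.
  have IrnA : P.-integrable (X @^-1` A) (rn \o X) by apply: (integrableS measurableT).
  by rewrite -(integral_pushforward mid mrn IrnA GA) -RNE.
Qed.

Lemma cond_expP Z : P.-integrable setT (EFin \o Z) -> is_cond_exp P G Z (cond_exp P G Z).
Proof. by move=> /is_cond_exp_exists[Y HY]; exact: (xgetPex (fun=> 0) (ex_intro _ Y HY)). Qed.

Lemma Rintegral_ae_eq f h (N : set T) : measurable N -> P N = 0%E ->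
  measurable_fun setT f -> measurable_fun setT h -> (forall t, ~ N t -> f t = h t) ->
  \int[P]_t f t = \int[P]_t h t.
Proof.
move=> mN N0 mf mh fh; rewrite /Rintegral; congr fine; apply: ae_eq_integral => //.
- exact/measurable_EFinP.
- exact/measurable_EFinP.
- exists N; split=> // t /= H; apply: contrapT => Nt; apply: H => _.
  by rewrite fh.
Qed.

Lemma null_of_integral_le0 f (A : set T) : measurable A -> P.-integrable setT (EFin \o f) ->
  (forall t, A t -> 0 < f t) -> \int[P]_t (\1_A t * f t) <= 0 -> P A = 0%E.
Proof.
move=> mA If f0 int0.
have [/measurable_EFinP mf _] := integrableP _ _ _ If.
have bA : bounded_measurable (\1_A : T -> R) by exact: bm_indic.
have IAf := integrable_bmM bA If.
have g0 t : 0 <= \1_A t * f t.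
  rewrite indicE; have [At|At] := pselect (A t); first by rewrite mem_set// mul1r ltW// f0.
  by rewrite memNset// mul0r.
have : (\int[P]_t `|(\1_A t * f t)%:E| = 0)%E.
  under eq_integral do rewrite gee0_abs ?lee_fin//.
  rewrite -EFin_Rintegral//; congr EFin; apply/eqP; rewrite eq_le int0/=.
  exact: Rintegral_ge0.
have mg : measurable_fun setT (fun t => (\1_A t * f t)%:E) by exact: measurable_int IAf.
move=> /(ae_eq_integral_abs P measurableT mg) [N [mN N0 HN]].
apply: (subset_measure0 mA mN _ N0) => t At; apply: HN => /= /(_ I) [].
by rewrite indicE mem_set// mul1r => E; have := f0 _ At; rewrite E ltxx.
Qed.

(** The parts of [A0] where [Y < Y'] and where [Y' < Y] belong to [G], and the difference, strictly
    positive there, integrates to 0. Localising to [A0] matters because the resampling scheme is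
    specified only on an event. *)
Lemma cond_exp_unique Z Z' Y Y' (A0 : set T) :
  P.-integrable setT (EFin \o Z) -> P.-integrable setT (EFin \o Z') ->
  is_cond_exp P G Z Y -> is_cond_exp P G Z' Y' -> G A0 ->
  (forall A, G A -> A `<=` A0 -> \int[P]_t (\1_A t * Z t) = \int[P]_t (\1_A t * Z' t)) ->
  exists N, [/\ measurable N, P N = 0%E & forall t, A0 t -> ~ N t -> Y t = Y' t].
Proof.
move=> IZ IZ' /(is_cond_expP _ IZ)[mY IY YZ] /(is_cond_expP _ IZ')[mY' IY' YZ'] GA0 ZZ'.
have side f h : measurable_fun [set: TC] (f : TC -> R) -> measurable_fun [set: TC] (h : TC -> R) ->
    P.-integrable setT (EFin \o f) -> P.-integrable setT (EFin \o h) ->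
    (forall A, G A -> A `<=` A0 -> \int[P]_t (\1_A t * f t) = \int[P]_t (\1_A t * h t)) ->
    measurable (A0 `&` [set t | f t < h t]) /\ P (A0 `&` [set t | f t < h t]) = 0%E.
  move=> mf mh If Ih fh.
  have GA : G (A0 `&` [set t | f t < h t]).
    have := @measurable_fun_ltr _ TC R setT f h mf mh measurableT [set true] I.
    rewrite setTI => H; have := @measurableI _ TC A0 _ GA0 H.
    by congr (<<s _ >> _); apply/seteqP; split=> t /= [].
  have mA := generated_measurable GA; split=> //.
  apply: (null_of_integral_le0 mA (integrable_subr Ih If)).
    by move=> t [_ /=]; rewrite subr_gt0.
  have bA : bounded_measurable (\1_(A0 `&` [set t | f t < h t]) : T -> R) by exact: bm_indic.
  under eq_Rintegral do rewrite mulrBr.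
  rewrite RintegralB//; [|exact: integrable_bmM..].
  by rewrite fh ?subrr// => t [].
have YY' A : G A -> A `<=` A0 -> \int[P]_t (\1_A t * Y t) = \int[P]_t (\1_A t * Y' t).
  by move=> GA AA0; rewrite YZ// YZ'// ZZ'.
have [m1 N1] := side Y Y' mY mY' IY IY' YY'.
have [m2 N2] := side Y' Y mY' mY IY' IY (fun A GA AA => esym (YY' A GA AA)).
exists ((A0 `&` [set t | Y t < Y' t]) `|` (A0 `&` [set t | Y' t < Y t])); split.
- exact: measurableU.
- exact: null_set_setU.
- by move=> t At Nt; apply/eqP; rewrite eq_le !leNgt; apply/andP; split; apply/negP => H; apply: Nt; [right|left].
Qed.

(* [cond_exp] is an arbitrary version, hence bounded only almost everywhere. *)
Lemma cond_exp_bounded Z Y (K : R) : measurable_fun setT Z -> (forall t, `|Z t| <= K) ->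
  is_cond_exp P G Z Y ->
  exists N, [/\ measurable N, P N = 0%E & forall t, ~ N t -> `|Y t| <= K].
Proof.
move=> mZ ZK; have bZ : bounded_measurable Z by exact: bm_le ZK.
have IZ := bm_integrable P bZ.
move=> /(is_cond_expP _ IZ)[mY IY YZ].
(* The sign [s] is 1 or -1, so that one argument covers both tails. *)
have side (s : R) : s ^+ 2 = 1 ->
    measurable [set t | K < s * Y t] /\ P [set t | K < s * Y t] = 0%E.
  move=> s2.
  have GA : G [set t | K < s * Y t].
    have msY : measurable_fun [set: TC] (fun t : TC => s * Y t) by exact: measurable_funM.
    have := @measurable_fun_ltr _ TC R setT _ _ (measurable_cst K) msY measurableT [set true] I.
    by rewrite setTI.
  have mA := generated_measurable GA; split=> //.
  have bA : bounded_measurable (\1_[set t | (K < s * Y t)%R] : T -> R) by exact: bm_indic.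
  have IsY : P.-integrable setT (EFin \o (fun t => s * Y t)).
    by apply: integrable_bmM => //; exact: bm_cst.
  have bK : bounded_measurable (fun _ : T => K) by exact: bm_cst.
  have IK := bm_integrable P bK.
  apply: (null_of_integral_le0 mA (integrable_subr IsY IK)).
    by move=> t /=; rewrite subr_gt0.
  under eq_Rintegral do rewrite mulrBr mulrCA.
  rewrite RintegralB//; last 2 first.
  - by apply: integrable_bmM; [exact: bm_cst|exact: integrable_bmM].
  - exact: integrable_bmM.
  rewrite RintegralZl//; last exact: integrable_bmM.
  rewrite YZ// -RintegralZl//; last exact: integrable_bmM.
  rewrite -bm_exB; [|by apply: bmM; [exact: bm_cst|exact: bmM]|exact: bmM].
  rewrite -oppr_ge0 -mulN1r -bm_exZ; last first.
    by apply: bmB; [apply: bmM; [exact: bm_cst|exact: bmM]|exact: bmM].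
  apply: Rintegral_ge0 => t _; set i := \1_[set t | _] t.
  have i0 : 0 <= i by rewrite /i indicE ler0n.
  have -> : -1 * (s * (i * Z t) - i * K) = i * (K - s * Z t) by ring.
  rewrite mulr_ge0// subr_ge0 (le_trans (ler_norm _))// normrM.
  have -> : `|s| = 1.
    by apply/eqP; rewrite -(@eqrXn2 _ 2)// expr1n real_normK ?num_real// s2.
  by rewrite mul1r.
have [m1 N1] := side 1 (expr1n _ _).
have sq1 : (-1) ^+ 2 = 1 :> R by rewrite sqrrN expr1n.
have [m2 N2] := side (-1) sq1.
exists ([set t | K < 1 * Y t] `|` [set t | K < -1 * Y t]); split.
- exact: measurableU.
- exact: null_set_setU.
move=> t Nt; rewrite ler_norml; apply/andP; split; rewrite leNgt; apply/negP => H; apply: Nt.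
  by right; rewrite /= mulN1r ltrNr.
by left; rewrite /= mul1r.
Qed.

(* [Y0] and [V0] need to be the conditional mean and variance only on the event [E]. *)
Lemma cond_var_local Z Y0 V0 (K : R) (E : set T) : measurable_fun setT Z -> (forall t, `|Z t| <= K) ->
  G E -> bounded_measurable (fun t => \1_E t * Y0 t) ->
  is_cond_exp P G (fun t => \1_E t * Z t) (fun t => \1_E t * Y0 t) ->
  is_cond_exp P G (fun t => \1_E t * (Z t - Y0 t) ^+ 2) (fun t => \1_E t * V0 t) ->
  measurable_fun setT (cond_var P G Z) /\
  exists N, [/\ measurable N, P N = 0%E & forall t, E t -> ~ N t -> cond_var P G Z t = V0 t].
Proof.
move=> mZ ZK GE bY0 HY0 HV0; have mE := generated_measurable GE.
have bE : bounded_measurable (\1_E : T -> R) by exact: bm_indic.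
have bZ : bounded_measurable Z by exact: bm_le ZK.
have IZ := bm_integrable P bZ.
have HY := cond_expP IZ; set Y := cond_exp P G Z in HY *.
have /(is_cond_expP _ IZ)[mYG IY YZ] := HY.
have mY := measurable_fun_generated mYG.
have IEZ := integrable_bmM bE IZ.
(* On [E], off a null set, the chosen conditional mean is [Y0]; a second use of uniqueness below
   carries this over to the variance. *)
have [A GA AE|N1 [mN1 PN1 HN1]] := cond_exp_unique IZ IEZ HY HY0 GE.
  apply: eq_Rintegral => t _; rewrite !indicE; have [At|At] := pselect (A t).
    by rewrite (mem_set (AE _ At)) mul1r.
  by rewrite (memNset At) !mul0r.
have [N2 [mN2 PN2 HN2]] := cond_exp_bounded mZ ZK HY.
pose W t := (Z t - Y t) ^+ 2.
have mW : measurable_fun setT W by apply: measurable_funX; exact: measurable_funB.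
(* A bounded modification of [Y], introduced to show that the squared deviation is integrable. *)
pose Yb t := \1_(~` N2) t * Y t.
have bYb : bounded_measurable Yb.
  apply: (@bm_le _ _ _ _ K).
    by apply: measurable_funM => //; apply: measurable_indic; exact: measurableC.
  move=> t; rewrite /Yb indicE; have [Nt|Nt] := pselect (N2 t).
    rewrite memNset ?mul0r ?normr0; last by move=> /(_ Nt).
    exact: le_trans (ZK t).
  by rewrite mem_set// mul1r; exact: HN2.
have bWb : bounded_measurable (fun t => (Z t - Yb t) ^+ 2) by apply: bmX; exact: bmB.
have WWb t : ~ N2 t -> W t = (Z t - Yb t) ^+ 2.
  by move=> Nt; rewrite /W /Yb indicE mem_set// mul1r.
have IW : P.-integrable setT (EFin \o W).
  have /integrableP[mWb IWb] := bm_integrable P bWb.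
  apply/integrableP; split; first exact/measurable_EFinP.
  rewrite (ae_eq_integral (fun t => `|((Z t - Yb t) ^+ 2)%:E|)%E)//.
  - by apply/measurableT_comp => //; exact/measurable_EFinP.
  - exact/measurableT_comp.
  - exists N2; split=> // t /= H; apply: contrapT => Nt; apply: H => _.
    by rewrite WWb.
have HV := cond_expP IW.
have IE0 : P.-integrable setT (EFin \o (fun t => \1_E t * (Z t - Y0 t) ^+ 2)).
  apply: bm_integrable; rewrite (_ : (fun t => _) = (fun t => (\1_E t * Z t - \1_E t * Y0 t) ^+ 2)).
    by apply: bmX; apply: bmB => //; exact: bmM.
  apply/funext => t; rewrite -mulrBr exprMn; congr (_ * _); rewrite indicE.
  by case: (_ \in _); rewrite ?expr1n ?expr0n.
split; first by have /(is_cond_expP _ IW)[+ _ _] := HV; exact: measurable_fun_generated.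
have [A GA AE|N3 [mN3 PN3 HN3]] := cond_exp_unique IW IE0 HV HV0 GE; last first.
  exists N3; split=> // t Et Nt; transitivity (\1_E t * V0 t); first exact: HN3.
  by rewrite indicE mem_set// mul1r.
have mA := generated_measurable GA.
apply: (Rintegral_ae_eq mN1 PN1).
- by apply: measurable_funM => //; exact: measurable_indic.
- apply: measurable_funM; first exact: measurable_indic.
  by have /integrableP[/measurable_EFinP] := IE0.
move=> t Nt; rewrite !indicE; have [At|At] := pselect (A t); last by rewrite memNset// !mul0r.
by have Et := AE _ At; rewrite /W (HN1 t Et Nt) !indicE (mem_set Et) !mul1r.
Qed.

(** On [E] the counts take finitely many values: split along them, and for each fixed [k] take the
    known factor [F k] out of the conditional expectation. *)
Lemma is_cond_exp_multinomial (m M : nat) (E : set T) (N : T -> nat) (p : T -> 'I_m -> R)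
    (Nbar : 'I_m -> T -> nat) (F : ('I_m -> nat) -> T -> R) :
  measurable E -> (forall i, measurable_fun setT (Nbar i)) ->
  (forall t, E t -> forall i, (Nbar i t <= M)%N) ->
  (forall k : 'I_m -> nat, is_cond_exp P G
     (\1_(E `&` [set t | forall i, Nbar i t = k i]))
     (fun t => \1_E t * multinomial_pmf (N t) (p t) k)) ->
  (forall k, measurable_fun [set: TC] (F k : TC -> R)) ->
  (forall k, exists B, forall t, `|F k t| <= B) ->
  is_cond_exp P G (fun t => \1_E t * F (fun i => Nbar i t) t)
    (fun t => \1_E t * multinomial_sum M (N t) (p t) (fun k => F k t)).
Proof.
move=> mE mN NM Hk mF bF.
have mB (k : 'I_m -> nat) : measurable (E `&` [set t | forall i, Nbar i t = k i]).
  apply: measurableI => //.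
  rewrite (_ : [set t | _] = \bigcap_(i in [set: 'I_m]) (Nbar i @^-1` [set k i])).
    apply: fin_bigcap_measurable => // i _.
    by rewrite -[X in measurable X]setTI; exact: mN.
  by apply/seteqP; split=> t /= H i; [move=> _; exact: H|exact: (H i I)].
pose B (k : {ffun 'I_m -> 'I_M.+1}) := E `&` [set t | forall i, Nbar i t = k i].
have IB k : P.-integrable setT (EFin \o (\1_(B k) : T -> R)).
  by apply: bm_integrable; apply: bm_indic; exact: mB.
have HB k := is_cond_expM (IB k) (Hk (fun i => k i)) (mF (fun i => k i)) (bF (fun i => k i)).
have IFB (k : {ffun 'I_m -> 'I_M.+1}) : P.-integrable setT (EFin \o (fun t => F (fun i => k i : nat) t * \1_(B k) t)).
  have [Bd FB] := bF (fun i => k i : nat).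
  apply: integrable_bmM => //; apply: (bm_le _ FB); exact: measurable_fun_generated.
have := is_cond_exp_sum IFB HB; congr (is_cond_exp P G _ _); apply/funext => t.
- rewrite indicE; have [Et|Et] := pselect (E t).
    have lt i : (Nbar i t < M.+1)%N by rewrite ltnS NM.
    pose k0 : {ffun 'I_m -> 'I_M.+1} := [ffun i => Ordinal (lt i)].
    have k0E : (fun i => k0 i : nat) = (fun i => Nbar i t) by apply/funext => i; rewrite ffunE.
    rewrite mem_set// mul1r (bigD1 k0)//= big1 ?addr0.
      rewrite k0E indicE mem_set ?mulr1//; split=> // i.
      by rewrite ffunE.
    move=> k kk0; rewrite indicE memNset ?mulr0// => -[_ /= H].
    by case/negP: kk0; apply/eqP/ffunP => i; apply/val_inj; rewrite ffunE /= H.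
  rewrite memNset// mul0r big1// => k _.
  by rewrite indicE memNset ?mulr0// => -[].
- rewrite /multinomial_sum big_distrr/=; apply: eq_bigr => k _.
  by rewrite mulrCA [F _ _ * _]mulrC.
Qed.

End conditional_expectation.

(** * One resampling step *)

Section average_step_more.
Context (R : realType) (m : nat).
Implicit Types (p a : 'I_m -> R) (F : R -> R).

Lemma average_stepE p a F x : average_step p a F x = \sum_(i < m) p i * F (x + a i).
Proof. by []. Qed.

Lemma iter_average_step_shift p a (c : R) F N x :
  iter N (average_step p (fun i => a i + c)) F x =
  iter N (average_step p a) F (x + N%:R * c).
Proof.
elim: N x => [|N IH] x; first by rewrite mul0r addr0.
rewrite !iterS !average_stepE; apply: eq_bigr => i _.
rewrite IH; congr (_ * _); congr (iter N _ F _).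
by rewrite -natr1; move: (N%:R : R) (a i) => q b; ring.
Qed.

Lemma iter_average_step_le p a F N x (M : R) : (forall i, 0 <= p i) ->
  \sum_(i < m) p i = 1 -> (forall x, `|F x| <= M) ->
  `|iter N (average_step p a) F x| <= M.
Proof.
move=> p0 p1 FM; elim: N x => [|N IH] x //=.
rewrite /average_step (le_trans (ler_norm_sum _ _ _))//.
rewrite -[leRHS]mul1r -[in X in _ <= X * _]p1 big_distrl/=; apply: ler_sum => i _.
by rewrite normrM ger0_norm// ler_wpM2l.
Qed.

End average_step_more.

Section sample.
Context d (T : measurableType d) dX (X : measurableType dX) (R : realType)
  (P : probability T R) (m n : nat) (past : set (set T))
  (xi : 'I_m -> {RV P >-> X}) (g : X -> R) (xit : 'I_n -> {RV P >-> X}).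
Hypotheses (past_measurable : past `<=` measurable)
  (mg : measurable_fun setT g) (g_ge0 : forall x, 0 <= g x).

Notation w := (weight g xi).
Notation E := [set t | \sum_(i < m) w i t = 1].
Notation C := (past
      `|` \bigcup_(i in [set: 'I_m])
            preimage_set_system setT (xi i) (@measurable _ X)
      `|` \bigcup_(i in [set: 'I_m])
            preimage_set_system setT (w i) (@measurable _ (measurableTypeR R))).
Notation TC := (g_sigma_algebraType C).
Notation G := (sigma_before past xi w).

Lemma weight_ge0 i t : 0 <= w i t.
Proof. by rewrite /weight divr_ge0// sumr_ge0. Qed.

Lemma weight_le1 i t : w i t <= 1.
Proof.
rewrite /weight; set S := \sum_(j < m) _.
have gS : g (xi i t) <= S.
  by rewrite /S (bigD1 i)//= lerDl sumr_ge0.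
(* With a zero denominator the weight is 0 by convention. *)
have [S0|S0] := eqVneq S 0; first by rewrite S0 invr0 mulr0.
by rewrite ler_pdivrMr ?mul1r// lt_neqAle eq_sym S0 sumr_ge0.
Qed.

Lemma measurable_weight i : measurable_fun setT (w i).
Proof.
rewrite /weight; apply: measurable_funM; first by apply: measurableT_comp.
apply: measurable_fun_inv; apply: measurable_sum => j.
by apply: measurableT_comp.
Qed.

Lemma sigma_before_measurable : C `<=` measurable.
Proof.
move=> A [[/past_measurable//|]|] [i _] [B mB <-].
  by apply: measurable_funPT.
by apply: measurable_weight.
Qed.

Lemma generated_weight i : measurable_fun [set: TC] (w i : TC -> R).
Proof.
apply/measurable_generatedP => B mB; apply: sub_sigma_algebra; right; exists i => //.
by exists B => //; rewrite setTI.
Qed.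

Lemma generated_particle i (f : X -> R) : measurable_fun setT f ->
  measurable_fun [set: TC] ((fun t => f (xi i t)) : TC -> R).
Proof.
move=> mf; apply/measurable_generatedP => B mB; apply: sub_sigma_algebra; left; right.
exists i => //; exists (f @^-1` B); last by rewrite setTI.
by rewrite -[X in measurable X]setTI; exact: mf.
Qed.

Lemma generated_event : G E.
Proof.
have ms : measurable_fun [set: TC] ((fun t => \sum_(i < m) w i t) : TC -> R).
  by apply: measurable_sum => i; exact: generated_weight.
by have := ms measurableT [set 1] (measurable_set1 _); rewrite setTI.
Qed.

Lemma event_measurable : measurable E.
Proof. exact: (generated_measurable sigma_before_measurable generated_event). Qed.

Lemma sure_copies_le i t : (sure_copies n w i t)%:R <= n%:R * w i t.
Proof. by rewrite /sure_copies truncn_le mulr_ge0// weight_ge0. Qed.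

Lemma generated_sure_copies i : measurable_fun [set: TC] ((fun t => (sure_copies n w i t)%:R) : TC -> R).
Proof.
apply: measurable_natr; apply: measurable_fun_truncn; apply: measurable_funM => //.
exact: generated_weight.
Qed.

Definition residual_mass i t : R := n%:R * w i t - (sure_copies n w i t)%:R.

Lemma residual_mass_ge0 i t : 0 <= residual_mass i t.
Proof. by rewrite subr_ge0 sure_copies_le. Qed.

Lemma generated_residual_mass i : measurable_fun [set: TC] (residual_mass i : TC -> R).
Proof.
apply: measurable_funB; last exact: generated_sure_copies.
by apply: measurable_funM => //; exact: generated_weight.
Qed.

Lemma sum_sure_copies_le t : E t -> (\sum_(i < m) sure_copies n w i t <= n)%N.
Proof.
move=> /= Et; rewrite -(ler_nat R) natr_sum -[leRHS]mulr1 -[X in _ <= _ * X]Et big_distrr/=.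
by apply: ler_sum => i _; exact: sure_copies_le.
Qed.

Lemma residual_trialsE t : E t -> (residual_trials n w t)%:R = \sum_(i < m) residual_mass i t.
Proof.
move=> Et; rewrite /residual_trials natrB ?sum_sure_copies_le//.
by rewrite sumrB -big_distrr/= Et mulr1 natr_sum.
Qed.

(** Without residual trials the division yields 0, but then the nonnegative masses sum to 0 and
    vanish as well. *)
Lemma residual_massE t i : E t ->
  (residual_trials n w t)%:R * residual_prob n w t i = residual_mass i t.
Proof.
move=> Et; rewrite /residual_prob -/(residual_mass i t).
have [N0|N0] := eqVneq ((residual_trials n w t)%:R : R) 0; last by rewrite mulrC divfK.
have := residual_trialsE Et; rewrite N0 mul0r => /esym/eqP.
rewrite psumr_eq0; last by move=> j _; exact: residual_mass_ge0.
by move=> /allP /(_ i); rewrite mem_index_enum => /(_ isT)/eqP ->.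
Qed.

Lemma residual_prob_ge0 t i : 0 <= residual_prob n w t i.
Proof. by rewrite divr_ge0// residual_mass_ge0. Qed.

Lemma sum_residual_prob t : E t -> (0 < residual_trials n w t)%N ->
  \sum_(i < m) residual_prob n w t i = 1.
Proof.
move=> Et N0; have N0' : (residual_trials n w t)%:R != 0 :> R by rewrite pnatr_eq0 -lt0n.
apply: (mulfI N0'); rewrite mulr1 big_distrr/= [RHS]residual_trialsE//.
by apply: eq_bigr => i _; rewrite residual_massE.
Qed.

Definition residual_average (phi : X -> R) t : R :=
  n%:R^-1 * \sum_(i < m) residual_mass i t * phi (xi i t).

(** The empirical form of [kappa]: [residual_average] replaces the nu-mean against the residual
    density, and the average of 1 replaces the denominator. *)
Definition residual_variance (f : X -> R) t : R :=
  residual_average (fun x => f x ^+ 2) t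
  - residual_average f t ^+ 2 / residual_average (fun=> 1) t.

Lemma measurable_residual_average phi : measurable_fun setT phi ->
  measurable_fun setT (residual_average phi).
Proof.
move=> mphi; apply: measurable_funM => //; apply: measurable_sum => i.
apply: measurable_funM; last by apply: measurableT_comp.
by apply: (measurable_fun_generated sigma_before_measurable); exact: generated_residual_mass.
Qed.

Lemma measurable_residual_variance f : measurable_fun setT f ->
  measurable_fun setT (residual_variance f).
Proof.
move=> mf; apply: measurable_funB.
  by apply: measurable_residual_average; exact: measurable_funX.
apply: measurable_funM; first by apply: measurable_funX; exact: measurable_residual_average.
by apply: measurable_fun_inv; exact: measurable_residual_average.
Qed.

Definition weighted_mean (f : X -> R) t : R := \sum_(i < m) w i t * f (xi i t).

Variables (f : X -> R) (Kf : R).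
Hypotheses (mf : measurable_fun setT f) (fK : forall x, `|f x| <= Kf) (n_gt0 : (0 < n)%N).
Hypothesis Hres : residual_resampling G xi w xit.

Notation resampled_mean := (fun t => n%:R^-1 * \sum_(l < n) f (xit l t)).

Definition count_mean (k : 'I_m -> nat) t : R :=
  n%:R^-1 * \sum_(i < m) (sure_copies n w i t + k i)%N%:R * f (xi i t).

Lemma n_neq0 : n%:R != 0 :> R. Proof. by rewrite pnatr_eq0 -lt0n. Qed.

Lemma resampled_mean_measurable : measurable_fun setT resampled_mean.
Proof.
apply: measurable_funM => //; apply: measurable_sum => l; exact: measurableT_comp.
Qed.

Lemma resampled_mean_le t : `|resampled_mean t| <= Kf.
Proof.
rewrite normrM ger0_norm ?invr_ge0// -ler_pdivlMl ?invr_gt0 ?ltr0n// invrK.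
rewrite (le_trans (ler_norm_sum _ _ _))//.
have -> : n%:R * Kf = \sum_(l < n) Kf by rewrite sumr_const card_ord mulr_natl.
by apply: ler_sum => l _.
Qed.

Lemma generated_weighted_mean : measurable_fun [set: TC] (weighted_mean f : TC -> R).
Proof.
apply: measurable_sum => i; apply: measurable_funM; first exact: generated_weight.
exact: generated_particle.
Qed.

Lemma weighted_mean_le t : `|weighted_mean f t| <= m%:R * Kf.
Proof.
rewrite (le_trans (ler_norm_sum _ _ _))//.
have -> : m%:R * Kf = \sum_(l < m) Kf by rewrite sumr_const card_ord mulr_natl.
apply: ler_sum => i _; rewrite normrM -[leRHS]mul1r ler_pM//.
by rewrite ger0_norm ?weight_ge0 ?weight_le1.
Qed.

Lemma generated_count_mean k : measurable_fun [set: TC] (count_mean k : TC -> R).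
Proof.
apply: measurable_funM => //; apply: measurable_sum => i.
apply: measurable_funM; last exact: generated_particle.
rewrite (_ : (fun _ => _) = (fun t => (sure_copies n w i t)%:R + (k i)%:R)).
  by apply: measurable_funD => //; exact: generated_sure_copies.
by apply/funext => t; rewrite natrD.
Qed.

Lemma count_mean_bounded k : exists B, forall t, `|count_mean k t| <= B.
Proof.
exists (n%:R^-1 * \sum_(i < m) (n%:R + (k i)%:R) * Kf) => t.
rewrite normrM ger0_norm ?invr_ge0// ler_wpM2l ?invr_ge0//.
rewrite (le_trans (ler_norm_sum _ _ _))//; apply: ler_sum => i _.
rewrite normrM ler_pM// ger0_norm// natrD lerD2r (le_trans (sure_copies_le i t))//.
by rewrite -[leRHS]mulr1 ler_wpM2l// weight_le1.
Qed.

(** Since [n * w i] is the sure part plus the residual mass, the bracket is the residual sum minus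
    its conditional mean. *)
Lemma count_meanE t (k : 'I_m -> nat) : E t ->
  count_mean k t = weighted_mean f t
   + n%:R^-1 * (- \sum_(i < m) residual_mass i t * f (xi i t) + \sum_(i < m) (k i)%:R * f (xi i t)).
Proof.
move=> Et; apply: (mulfI n_neq0); rewrite mulrDr !mulrA divff ?n_neq0// !mul1r.
rewrite /weighted_mean big_distrr/= -sumrN -!big_split/=; apply: eq_bigr => i _.
by rewrite natrD /residual_mass; ring.
Qed.

(** Group the n new particles by their ancestor. Each group has at most n members, which bounds the
    counts. *)
Lemma resampling_counts : exists Nbar : 'I_m -> T -> nat,
  [/\ forall i, measurable_fun setT (Nbar i),
      forall t, E t -> forall i, (Nbar i t <= n)%N,
      forall t, E t -> resampled_mean t = count_mean (fun i => Nbar i t) t &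
      forall k : 'I_m -> nat, is_cond_exp P G
        (\1_(E `&` [set t | forall i, Nbar i t = k i]))
        (fun t => \1_E t
           * multinomial_pmf (residual_trials n w t) (residual_prob n w t) k)].
Proof.
have [Nbar [HJ Hk]] := Hres; exists (fun i => Nbar i); split=> //.
- move=> t /HJ [J [_ HJi]] i.
  have := HJi i; move=> /(congr1 (fun k => k <= n)%N).
  rewrite (leq_trans (max_card _)) ?card_ord// => /esym H.
  exact: leq_trans (leq_addl _ _) H.
- move=> t /HJ [J [HJl HJi]]; rewrite /count_mean; congr (_ * _).
  under eq_bigr do rewrite HJl.
  rewrite (partition_big J predT)//=; apply: eq_bigr => i _.
  rewrite -HJi; transitivity (\sum_(l < n | J l == i) f (xi i t)).
    by apply: eq_bigr => l /eqP ->.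
  by rewrite sumr_const mulr_natl; congr (_ *+ _); apply: eq_card => l; rewrite !inE.
Qed.

Lemma residual_trials_le t : (residual_trials n w t <= n)%N.
Proof. exact: leq_subr. Qed.

Lemma residual_average1 t : E t ->
  residual_average (fun=> 1) t = n%:R^-1 * (residual_trials n w t)%:R.
Proof.
by move=> Et; rewrite residual_trialsE// /residual_average; under eq_bigr do rewrite mulr1.
Qed.

Lemma residual_varianceE t : E t ->
  residual_variance f t = n%:R^-1 * (\sum_(i < m) residual_mass i t * f (xi i t) ^+ 2
    - (\sum_(i < m) residual_mass i t * f (xi i t)) ^+ 2 / (residual_trials n w t)%:R).
Proof.
move=> Et; rewrite /residual_variance residual_average1// /residual_average.
move: (\sum_(i < m) _) (\sum_(i < m) _) => a b.
have [->|N0] := eqVneq ((residual_trials n w t)%:R : R) 0; first by rewrite mulr0 !invr0 !mulr0 !subr0.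
by move: n_neq0 N0; move: (n%:R : R) (_%:R : R) => q r q0 r0; field; rewrite q0 r0.
Qed.

Lemma sum_residual_mass t F : E t ->
  \sum_(i < m) residual_mass i t * F i =
  (residual_trials n w t)%:R * \sum_(i < m) residual_prob n w t i * F i.
Proof. by move=> Et; rewrite big_distrr/=; apply: eq_bigr => i _; rewrite mulrA residual_massE. Qed.

Lemma count_mean_average t : E t ->
  multinomial_sum n (residual_trials n w t) (residual_prob n w t) (fun k => count_mean k t)
  = weighted_mean f t.
Proof.
move=> Et; rewrite /multinomial_sum; under eq_bigr do rewrite count_meanE//.
set N := residual_trials n w t; set p := residual_prob n w t.
set x := - _; pose F y : R := weighted_mean f t + n%:R^-1 * y.
rewrite -[LHS]/(multinomial_sum n N p (fun k => F (x + \sum_(i < m) (k i)%:R * f (xi i t)))).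
rewrite multinomial_sum_iter ?residual_trials_le//.
(* N steps of average size lead from the centring term [x] back to 0. *)
have xE : x + N%:R * \sum_(i < m) p i * f (xi i t) = 0.
  by rewrite /x (sum_residual_mass (fun i => f (xi i t)))// addNr.
pose mu := \sum_(i < m) p i * f (xi i t).
have Faff M y : \sum_(i < m) p i = 1 -> iter M (average_step p (fun i => f (xi i t))) F y =
    F (y + M%:R * mu).
  move=> p1; elim: M y => [|M IH] y; first by rewrite mul0r addr0.
  rewrite iterS average_stepE; under eq_bigr do rewrite IH.
  rewrite /F.
  transitivity (\sum_(i < m) (p i * (weighted_mean f t + n%:R^-1 * (y + M%:R * mu)) + n%:R^-1 * (p i * f (xi i t)))).
    by apply: eq_bigr => i _; ring.
  by rewrite big_split/= -big_distrl/= p1 -big_distrr/= -/mu -natr1; ring.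
(* With no residual trial the probabilities do not sum to 1, but [x] is then 0 by [xE]. *)
have [N0|N0] := posnP N; last by rewrite Faff ?sum_residual_prob// xE /F mulr0 addr0.
by move: xE; rewrite N0 /= mul0r addr0 => ->; rewrite /F mulr0 addr0.
Qed.

Lemma count_mean_variance t : E t ->
  multinomial_sum n (residual_trials n w t) (residual_prob n w t)
    (fun k => (count_mean k t - weighted_mean f t) ^+ 2)
  = n%:R^-1 * residual_variance f t.
Proof.
move=> Et; rewrite /multinomial_sum; under eq_bigr do rewrite count_meanE// addrAC subrr add0r exprMn mulrCA.
rewrite -big_distrr/=.
set N := residual_trials n w t; set p := residual_prob n w t.
set x := - _.
rewrite -[X in _ * X]/(multinomial_sum n N p (fun k => (fun y => y ^+ 2) (x + \sum_(i < m) (k i)%:R * f (xi i t)))).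
rewrite multinomial_sum_iter ?residual_trials_le//.
rewrite residual_varianceE// -/N.
have xE : x + N%:R * \sum_(i < m) p i * f (xi i t) = 0.
  by rewrite /x (sum_residual_mass (fun i => f (xi i t)))// addNr.
rewrite !sum_residual_mass// -/N -/p mulrA -expr2; congr (_ * _).
have [N0|N0] := posnP N.
  by move: xE; rewrite N0 /= mul0r addr0 => ->; rewrite !mul0r expr0n/= mul0r subr0.
rewrite iter_average_step_sqr ?sum_residual_prob// xE expr0n/= add0r.
have N0' : N%:R != 0 :> R by rewrite pnatr_eq0 -lt0n.
by move: (N%:R : R) N0' (\sum_(i < m) _) (\sum_(i < m) _) => q q0 a b; field.
Qed.

Lemma sample_cond_var : measurable_fun setT (cond_var P G resampled_mean) /\
  exists N, [/\ measurable N, P N = 0%E & forall t, E t -> ~ N t ->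
    n%:R * cond_var P G resampled_mean t = residual_variance f t].
Proof.
have [Nbar [mN Nn NE Nk]] := resampling_counts.
have hC := sigma_before_measurable; have mE := event_measurable.
have bE : bounded_measurable (\1_E : T -> R) by exact: bm_indic.
have bwm : bounded_measurable (weighted_mean f).
  apply: (bm_le _ weighted_mean_le).
  by apply: (measurable_fun_generated hC); exact: generated_weighted_mean.
have H1 := @is_cond_exp_multinomial _ T R P C hC m n E (residual_trials n w) (residual_prob n w)
  Nbar count_mean mE mN Nn Nk generated_count_mean count_mean_bounded.
have mF2 k : measurable_fun [set: TC] ((fun t => (count_mean k t - weighted_mean f t) ^+ 2) : TC -> R).
  apply: measurable_funX; apply: measurable_funB; first exact: generated_count_mean.
  exact: generated_weighted_mean.
have bF2 k : exists B, forall t, `|(count_mean k t - weighted_mean f t) ^+ 2| <= B.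
  have [B kB] := count_mean_bounded k; exists ((B + m%:R * Kf) ^+ 2) => t.
  rewrite normrX lerXn2r ?nnegrE//; last first.
    by rewrite (le_trans (ler_normB _ _))// lerD// weighted_mean_le.
  by rewrite addr_ge0// ?(le_trans _ (kB t))// (le_trans _ (weighted_mean_le t)).
have H2 := @is_cond_exp_multinomial _ T R P C hC m n E (residual_trials n w) (residual_prob n w)
  Nbar (fun k t => (count_mean k t - weighted_mean f t) ^+ 2) mE mN Nn Nk mF2 bF2.
(* Residual resampling is conditionally unbiased on [E]. *)
have HY : is_cond_exp P G (fun t => \1_E t * resampled_mean t) (fun t => \1_E t * weighted_mean f t).
  move: H1; congr (is_cond_exp P G _ _); apply/funext => t; rewrite indicE;
    have [Et|Et] := pselect (E t); rewrite ?(memNset Et) ?mul0r// (mem_set Et) !mul1r.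
    by rewrite NE.
  exact: count_mean_average.
have HV : is_cond_exp P G (fun t => \1_E t * (resampled_mean t - weighted_mean f t) ^+ 2)
    (fun t => \1_E t * (n%:R^-1 * residual_variance f t)).
  move: H2; congr (is_cond_exp P G _ _); apply/funext => t; rewrite indicE;
    have [Et|Et] := pselect (E t); rewrite ?(memNset Et) ?mul0r// (mem_set Et) !mul1r.
    by rewrite NE.
  exact: count_mean_variance.
have [mV [N [mN0 PN VN]]] := cond_var_local hC resampled_mean_measurable resampled_mean_le
   generated_event (bmM bE bwm) HY HV.
split=> //; exists N; split=> // t Et Nt.
by rewrite (VN t Et Nt) mulVKf// n_neq0.
Qed.

(** [I] is the conditional expectation of the integrand on the left. As an average over multinomial
    counts it is an iterated step average, so [lindeberg] applies at each point of [E]. *)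
Lemma sample_clt (K b M : R) (F F1 F2 : R -> R) : smooth2 K F F1 F2 ->
  (forall x, `|F x| <= M) ->
  exists I : T -> R, [/\ measurable_fun setT I, forall t, `|I t| <= M,
    \int[P]_t (\1_E t * F (Num.sqrt n%:R * (resampled_mean t - b))) = \int[P]_t I t
  & forall t, E t -> (0 < residual_trials n w t)%N ->
    `|I t - heat (residual_variance f t) F (Num.sqrt n%:R * (weighted_mean f t - b))|
      <= K * (1 + @std_normal_abs3 R) * (2 * Kf) ^+ 3 * (Num.sqrt n%:R / n%:R)].
Proof.
move=> sF FM; have [bF _ _ _] := sF.
have cF := bounded_lipschitz_continuous bF.
have [Nbar [mN Nn NE Nk]] := resampling_counts.
have hC := sigma_before_measurable; have mE := event_measurable.
have bE : bounded_measurable (\1_E : T -> R) by exact: bm_indic.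
pose Fk k t := F (Num.sqrt n%:R * (count_mean k t - b)).
have mFk k : measurable_fun [set: TC] (Fk k : TC -> R).
  apply: (@measurableT_comp _ _ _ _ _ _ F); first exact: continuous_measurable_fun.
  apply: measurable_funM => //; apply: measurable_funB => //; exact: generated_count_mean.
have bFk k : exists B, forall t, `|Fk k t| <= B by exists M => t; exact: FM.
have H := @is_cond_exp_multinomial _ T R P _ hC m n E (residual_trials n w) (residual_prob n w)
  Nbar Fk mE mN Nn Nk mFk bFk.
pose I t := \1_E t * multinomial_sum n (residual_trials n w t) (residual_prob n w t) (fun k => Fk k t).
set s := Num.sqrt n%:R / n%:R.
have s0 : 0 <= s by rewrite divr_ge0.
have s2 : s ^+ 2 = n%:R^-1.
  by rewrite exprMn sqr_sqrtr//; move: n_neq0; move: (n%:R : R) => q q0; field.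
pose fbar t := \sum_(i < m) residual_prob n w t i * f (xi i t).
(* Steps scaled by [s], which is the inverse square root of n, and centred under the residual
   probabilities. *)
pose a t i := s * (f (xi i t) - fbar t).
have IE t : E t -> I t = iter (residual_trials n w t) (average_step (residual_prob n w t) (a t)) F
    (Num.sqrt n%:R * (weighted_mean f t - b)).
  move=> Et; rewrite /I indicE mem_set// mul1r.
  set N := residual_trials n w t; set p := residual_prob n w t.
  have rf : \sum_(i < m) residual_mass i t * f (xi i t) = N%:R * fbar t.
    exact: (sum_residual_mass (fun i => f (xi i t))).
  (* The uncentred walk starts here; its total drift [s * (N%:R * fbar t)] then moves the start of
     the centred walk to the scaled weighted mean. *)
  pose x := Num.sqrt n%:R * (weighted_mean f t - b) - s * (N%:R * fbar t).
  transitivity (multinomial_sum n N p (fun k => F (x + \sum_(i < m) (k i)%:R * (a t i + s * fbar t)))).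
    apply: eq_bigr => k _; congr (_ * F _); rewrite count_meanE// rf.
    have -> : \sum_(i < m) (k i)%:R * (a t i + s * fbar t) = s * \sum_(i < m) (k i)%:R * f (xi i t).
      by rewrite [RHS]mulr_sumr; apply: eq_bigr => i _; rewrite /a; ring.
    rewrite /x /s; move: (\sum_(i < m) _) (weighted_mean f t) (N%:R * fbar t) => u v q.
    by move: (Num.sqrt _) (n%:R^-1) => c e; ring.
  rewrite multinomial_sum_iter ?residual_trials_le// iter_average_step_shift; congr (iter _ _ _ _).
  by rewrite /x; ring.
have Kf0 : 0 <= Kf by exact: le_trans (fK point).
exists I; split.
- have [/measurable_generatedP mI _ _] := H.
  exact: (measurable_fun_generated hC).
- move=> t; have [Et|Et] := pselect (E t); last first.
    by rewrite /I indicE memNset// mul0r normr0 (le_trans _ (FM 0)).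
  rewrite IE//; have [N0|N0] := posnP (residual_trials n w t).
    by rewrite N0 /=.
  apply: iter_average_step_le => //; last exact: sum_residual_prob.
  by move=> i; exact: residual_prob_ge0.
- have bZ : bounded_measurable (fun t => \1_E t * F (Num.sqrt n%:R * (resampled_mean t - b))).
    apply: bmM => //; apply: (bounded_lipschitz_bm bF).
    by apply: measurable_funM => //; apply: measurable_funB => //; exact: resampled_mean_measurable.
  have EE : (fun t => \1_E t * F (Num.sqrt n%:R * (resampled_mean t - b))) =
      (fun t => \1_E t * Fk (fun i => Nbar i t) t).
    apply/funext => t; rewrite indicE; have [Et|Et] := pselect (E t).
      by rewrite mem_set// NE.
    by rewrite memNset// !mul0r.
  rewrite EE in bZ *.
  have /(is_cond_expP hC _ (bm_integrable P bZ))[_ _ HI] := H.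
  have GT : G setT by exact: (@measurableT _ TC).
  have := HI _ GT; under eq_Rintegral do rewrite indicT mul1r.
  by under [in RHS]eq_Rintegral do rewrite indicT mul1r; move=> <-.
- move=> t Et N0; rewrite IE//.
  set N := residual_trials n w t; set p := residual_prob n w t.
  have p1 : \sum_(i < m) p i = 1 by exact: sum_residual_prob.
  have N0' : N%:R != 0 :> R by rewrite pnatr_eq0 -lt0n.
  have pa : \sum_(i < m) p i * a t i = 0.
    transitivity (s * (\sum_(i < m) p i * f (xi i t) - (\sum_(i < m) p i) * fbar t)).
      by rewrite big_distrl/= -sumrB big_distrr/=; apply: eq_bigr => i _; rewrite /a; ring.
    by rewrite p1 mul1r /fbar subrr mulr0.
  have vE : N%:R * \sum_(i < m) p i * a t i ^+ 2 = residual_variance f t.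
    have -> : \sum_(i < m) p i * a t i ^+ 2 = n%:R^-1 * (\sum_(i < m) p i * f (xi i t) ^+ 2 - fbar t ^+ 2).
      transitivity (s ^+ 2 * (\sum_(i < m) p i * f (xi i t) ^+ 2 - 2 * fbar t * (\sum_(i < m) p i * f (xi i t))
          + (\sum_(i < m) p i) * fbar t ^+ 2)).
        rewrite big_distrl/= big_distrr/= -sumrB -big_split/= big_distrr/=.
        by apply: eq_bigr => i _; rewrite /a; ring.
      by rewrite p1 s2 -/(fbar t); congr (_ * _); ring.
    rewrite residual_varianceE// -/N.
    rewrite (sum_residual_mass (fun i => f (xi i t) ^+ 2))// (sum_residual_mass (fun i => f (xi i t)))//.
    rewrite -/N -/p -/(fbar t).
    move: (N%:R : R) N0' (\sum_(i < m) _) (fbar t) (n%:R^-1) => q q0 u v e; by field.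
  have fbarK : `|fbar t| <= Kf.
    rewrite (le_trans (ler_norm_sum _ _ _))// -[leRHS]mul1r -p1 big_distrl/=.
    by apply: ler_sum => i _; rewrite normrM ger0_norm ?residual_prob_ge0// ler_wpM2l// residual_prob_ge0.
  have ab i : `|a t i| <= 2 * Kf * s.
    rewrite normrM ger0_norm// mulrC ler_wpM2r// (le_trans (ler_normB _ _))//.
    by rewrite mulr_natl mulr2n lerD.
  have b0 : 0 <= 2 * Kf * s by rewrite !mulr_ge0.
  have p0 i : 0 <= p i by exact: residual_prob_ge0.
  have := lindeberg N (Num.sqrt n%:R * (weighted_mean f t - b)) sF p0 p1 pa b0 ab.
  rewrite vE => /le_trans; apply.
  have K0 := smooth2_ge0 sF; have c0 := std_normal_abs3_ge0 R.
  (* As [s ^+ 2] is the inverse of n, at most n errors of order [s ^+ 3] add up to order [s]. *)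
  have -> : K * (1 + @std_normal_abs3 R) * (2 * Kf) ^+ 3 * s =
      n%:R * (K * (1 + @std_normal_abs3 R) * (2 * Kf * s) ^+ 3).
    rewrite [(2 * Kf * s) ^+ 3]exprMn [s ^+ 3]exprS s2; move: n_neq0; move: (n%:R : R) => q q0.
    by field.
  apply: ler_wpM2r; last by rewrite ler_nat residual_trials_le.
  by rewrite !mulr_ge0 ?exprn_ge0// addr_ge0.
Qed.

End sample.

(** * Densities and the limit variance *)

Section density_mean.
Context d (X : measurableType d) (R : realType)
  (lambda : {measure set X -> \bar R}) (p : X -> R) (hp : is_density lambda p).

Lemma density_integrable f : bounded_measurable f ->
  lambda.-integrable setT (fun x => (f x * p x)%:E).
Proof.
have [mp p0 p1] := hp; move=> [mf [M fM]].
have ip : lambda.-integrable setT (EFin \o p).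
  apply/integrableP; split; first exact/measurable_EFinP.
  rewrite (_ : (\int[lambda]_x _)%E = 1%E) ?ltry// -p1.
  by apply: eq_integral => x _; rewrite /= ger0_norm.
apply: (le_integrable _ _ _ (integrableZl measurableT M ip)) => //.
  by apply/measurable_EFinP; exact: measurable_funM.
move=> x _; rewrite /= lee_fin normrM [leRHS]normrM ler_wpM2r//.
exact: le_trans (fM x) (ler_norm _).
Qed.

Lemma density_meanD f g : bounded_measurable f -> bounded_measurable g ->
  density_mean lambda p (fun x => f x + g x) =
  density_mean lambda p f + density_mean lambda p g.
Proof.
move=> bf bg; rewrite /density_mean; under eq_Rintegral do rewrite mulrDl.
by rewrite RintegralD//; exact: density_integrable.
Qed.

Lemma density_meanB f g : bounded_measurable f -> bounded_measurable g ->
  density_mean lambda p (fun x => f x - g x) =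
  density_mean lambda p f - density_mean lambda p g.
Proof.
move=> bf bg; rewrite /density_mean; under eq_Rintegral do rewrite mulrBl.
by rewrite RintegralB//; exact: density_integrable.
Qed.

Lemma density_meanZ f (r : R) : bounded_measurable f ->
  density_mean lambda p (fun x => r * f x) = r * density_mean lambda p f.
Proof.
move=> bf; rewrite /density_mean; under eq_Rintegral do rewrite -mulrA.
by rewrite RintegralZl//; exact: density_integrable.
Qed.

Lemma density_mean_cst (r : R) : density_mean lambda p (fun=> r) = r.
Proof.
rewrite -[RHS]mulr1 -[X in density_mean _ _ X]/(fun x => r).
have -> : (fun=> r : R) = (fun _ : X => r * 1) by apply/funext => x; rewrite mulr1.
rewrite (@density_meanZ (fun=> 1)); last exact: bm_cst.
have [_ _ p1] := hp; congr (_ * _); rewrite /density_mean /Rintegral.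
by under eq_integral do rewrite mul1r; rewrite p1.
Qed.

Lemma density_mean_ge0 f : (forall x, 0 <= f x) -> 0 <= density_mean lambda p f.
Proof. by have [_ p0 _] := hp => f0; apply: Rintegral_ge0 => x _; rewrite mulr_ge0. Qed.

Lemma density_mean_le f g : bounded_measurable f -> bounded_measurable g ->
  (forall x, f x <= g x) -> density_mean lambda p f <= density_mean lambda p g.
Proof.
move=> bf bg fg; rewrite -subr_ge0 -density_meanB//.
by apply: density_mean_ge0 => x; rewrite subr_ge0.
Qed.

End density_mean.

(* If the integer parts differ, an integer k >= 1 separates [a * r] from [alpha * r]; it
   lies within [delta] of [alpha * r] and is at most [2 * alpha * r]. *)
Lemma truncn_close (R : realType) (a alpha r delta : R) : 0 <= r -> 0 < alpha ->
  `|a - alpha| <= alpha -> `|a - alpha| * r < delta ->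
  `|(Num.truncn (a * r))%:R - (Num.truncn (alpha * r))%:R|
    <= 3 * alpha * (r * \1_(\bigcup_k [set y : R | `|y - k%:R| < delta]) (alpha * r)).
Proof.
move=> r0 a0 aa ad; set B := \bigcup_k _.
have a1 : 0 <= a by move: aa; rewrite ler_norml; lra.
set x := a * r; set y := alpha * r.
have x0 : 0 <= x by rewrite mulr_ge0.
have y0 : 0 <= y by rewrite mulr_ge0// ltW.
have xy : `|x - y| < delta by rewrite /x /y -mulrBl normrM [`|r|]ger0_norm.
have x2 : x <= 2 * y.
  rewrite /x /y mulrA ler_wpM2r//; move: aa; rewrite ler_norml; lra.
have indB k : `|y - k%:R| < delta -> \1_B y = 1 :> R.
  by move=> yk; rewrite indicE mem_set//; exists k.
have yE : 3 * alpha * (r * \1_B y) = 3 * (y * \1_B y) by rewrite /y; ring.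
have tx : (Num.truncn x)%:R <= x by rewrite truncn_le.
have ty : (Num.truncn y)%:R <= y by rewrite truncn_le.
rewrite yE; case: (ltngtP (Num.truncn x) (Num.truncn y)) => [xy'|xy'|->].
- have xk : x < (Num.truncn y)%:R by rewrite ltNge -truncn_ge_nat// -ltnNge.
  rewrite (indB (Num.truncn y)); last by move: xy; rewrite !ltr_norml; lra.
  have : 0 <= (Num.truncn x)%:R :> R by [].
  by rewrite ler_norml; lra.
- have yk : y < (Num.truncn x)%:R by rewrite ltNge -truncn_ge_nat// -ltnNge.
  rewrite (indB (Num.truncn x)); last by move: xy; rewrite !ltr_norml; lra.
  have : 0 <= (Num.truncn y)%:R :> R by [].
  by rewrite ler_norml; lra.
- by rewrite subrr normr0; apply: mulr_ge0 => //; apply: mulr_ge0; rewrite ?indicE.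
Qed.

(** * The residual density and the limit variance *)

Section residual_density.
Context d (X : measurableType d) (R : realType)
  (lambda : {measure set X -> \bar R}) (mu nu : X -> R) (alpha Mr : R).
Hypotheses (hmu : is_density lambda mu) (hnu : is_density lambda nu)
  (hdom : forall x, nu x = 0 -> mu x = 0)
  (ratio_le : forall x, mu x / nu x <= Mr)
  (halpha : 0 < alpha)
  (hfrac : (\int[lambda]_(x in [set x : X | exists k : nat,
                                   (alpha * (mu x / nu x) = k%:R)%R])
              (mu x)%:E = 0)%E).

Notation r := (fun x => mu x / nu x).
Notation "'nu_' f" := (density_mean lambda nu f) (at level 10, f at level 9).
Notation copies := (fun x => (Num.truncn (alpha * (mu x / nu x)))%:R : R).

(** Up to the factor [alpha], the fractional part of [alpha * (mu x / nu x)]: the part of the mass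
    left to random trials. *)
Definition residual_density (x : X) : R := mu x / nu x - alpha^-1 * copies x.

Definition near_integer (delta : R) : set X :=
  [set x | (\bigcup_k [set y : R | `|y - k%:R| < delta]) (alpha * (mu x / nu x))].

Lemma ratio_ge0 x : 0 <= mu x / nu x.
Proof. by have [_ ? _] := hmu; have [_ ? _] := hnu; rewrite divr_ge0. Qed.

Lemma measurable_ratio : measurable_fun setT r.
Proof.
have [? _ _] := hmu; have [? _ _] := hnu.
by apply: measurable_funM => //; exact: measurable_fun_inv.
Qed.

Lemma bm_ratio : bounded_measurable r.
Proof.
by apply: (bm_le measurable_ratio) => x; rewrite ger0_norm ?ratio_ge0; [exact: ratio_le|].
Qed.

Lemma density_mean_ratio f : density_mean lambda mu f = nu_ (fun x => mu x / nu x * f x).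
Proof.
apply: eq_Rintegral => x _; have [n0|n0] := eqVneq (nu x) 0.
  by rewrite n0 hdom// !mulr0.
by rewrite mulrAC divfK// mulrC.
Qed.

Lemma density_mean_ratio1 : nu_ r = 1.
Proof.
rewrite -(density_mean_cst hmu 1) density_mean_ratio.
by under [in RHS]eq_fun do rewrite mulr1.
Qed.

Lemma copies_le x : alpha^-1 * copies x <= mu x / nu x.
Proof. by rewrite ler_pdivrMl// truncn_le// mulr_ge0 ?ratio_ge0// ltW. Qed.

Lemma measurable_copies : measurable_fun setT copies.
Proof.
apply: measurable_natr; apply: measurable_fun_truncn; apply: measurable_funM => //.
exact: measurable_ratio.
Qed.

Lemma bm_copies : bounded_measurable copies.
Proof.
apply: (@bm_le _ _ _ _ (alpha * Mr)); first exact: measurable_copies.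
move=> x; rewrite ger0_norm// -ler_pdivrMl//; exact: le_trans (copies_le x) (ratio_le x).
Qed.

Lemma bm_residual_density : bounded_measurable residual_density.
Proof.
apply: bmB; first exact: bm_ratio; apply: bmM; [exact: bm_cst|exact: bm_copies].
Qed.

Lemma residual_density_ge0 x : 0 <= residual_density x.
Proof. by rewrite subr_ge0 copies_le. Qed.

Lemma measurable_near_integer delta : measurable (near_integer delta).
Proof.
rewrite (_ : near_integer delta =
    \bigcup_k [set x | `|alpha * (mu x / nu x) - k%:R| < delta]) //.
apply: bigcupT_measurable => k; apply: whp_dist_measurable.
by apply: measurable_funM => //; exact: measurable_ratio.
Qed.

(** As [delta] decreases to 0 these sets shrink to the points where [alpha * (mu x / nu x)] is an
    integer, which is mu-null by [hfrac]; dominated convergence concludes. *)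
Lemma near_integer_small (e : R) : 0 < e ->
  exists2 delta : R, 0 < delta & density_mean lambda mu (\1_(near_integer delta)) <= e.
Proof.
move=> e0; have [mmu mu0 mu1] := hmu.
pose D k := near_integer (k.+1%:R^-1 : R).
have mD k : measurable (D k) by exact: measurable_near_integer.
pose r_alpha x := alpha * (mu x / nu x).
pose N := [set x : X | exists k : nat, (alpha * (mu x / nu x) = k%:R)%R].
pose F k x := (\1_(D k) x * mu x)%:E.
have mF k : measurable_fun setT (F k).
  by apply/measurable_EFinP; apply: measurable_funM.
have FN x : setT x -> F^~ x @ \oo --> (\1_N x * mu x)%:E.
  move=> _; apply: cvg_near_cst; have [[k0 xk]|xN] := pselect (N x).
    apply: nearW => k; rewrite /F !indicE !mem_set//; first by exists k0.
    by exists k0 => //=; rewrite xk subrr normr0 invr_gt0.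
  (* A non-integer [y] lies strictly between [q] and [q.+1], so no integer is within [k.+1%:R^-1] of
     it for large [k]. *)
  pose y := alpha * (mu x / nu x).
  have y0 : 0 <= y by rewrite mulr_ge0 ?ratio_ge0// ltW.
  pose q := Num.truncn y.
  have [qy yq] : q%:R <= y /\ y < q.+1%:R by apply/andP; exact: truncn_itv.
  have qy' : 0 < y - q%:R.
    by rewrite subr_gt0 lt_neqAle qy andbT; apply/eqP => qE; apply: xN; exists q.
  have yq' : 0 < q.+1%:R - y by rewrite subr_gt0.
  near=> k.
  have k1 : k.+1%:R^-1 < y - q%:R by near: k; exact: near_infty_natSinv_lt (PosNum qy').
  have k2 : k.+1%:R^-1 < q.+1%:R - y by near: k; exact: near_infty_natSinv_lt (PosNum yq').
  rewrite /F !indicE memNset; last first.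
    move=> [j _ /=]; rewrite -/y ltr_norml => /andP[j1 j2].
    have [jq|jq] := leqP j q.
      by have := lt_trans j2 k1; rewrite ltrD2l ltrN2 ltr_nat ltnNge jq.
    have j1' : j%:R - y < k.+1%:R^-1 by rewrite -ltrN2 opprB.
    by have := lt_trans j1' k2; rewrite ltrD2r ltr_nat ltnNge jq.
  by rewrite memNset.
have iF : lambda.-integrable setT (EFin \o mu).
  have := @density_integrable _ _ _ _ _ hmu (fun=> 1) (bm_cst _ 1).
  by congr (_.-integrable _ _); apply/funext => x; rewrite mul1r.
have mN : measurable N.
  rewrite (_ : N = \bigcup_k (r_alpha @^-1` [set k%:R])); last first.
    by apply/seteqP; split=> x [k]; [exists k|move=> _; exists k].
  apply: bigcupT_measurable => k; rewrite -[X in measurable X]setTI.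
  apply: (_ : measurable_fun setT r_alpha) => //.
  by apply: measurable_funM => //; exact: measurable_ratio.
have mFN : measurable_fun setT (fun x => (\1_N x * mu x)%:E).
  by apply/measurable_EFinP; apply: measurable_funM.
have Fmu : {ae lambda, forall x n, setT x -> (`|F n x| <= (mu x)%:E)%E}.
  apply: aeW => x k _; rewrite /F lee_fin normrM [`|mu x|]ger0_norm// -[leRHS]mul1r ler_wpM2r//.
  by rewrite indicE; case: (_ \in _); rewrite ?normr1 ?normr0.
have [_ _ H] := dominated_convergence measurableT mF mFN (aeW _ FN) iF Fmu.
have N0 : (\int[lambda]_x (\1_N x * mu x)%:E = 0)%E.
  rewrite -hfrac [RHS]integral_mkcond; apply: eq_integral => x _; rewrite patchE indicE.
  by case: ifP => _; rewrite ?mul1r ?mul0r.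
move: H; rewrite N0 => /fine_cvgP[_ /cvgrPdist_le /(_ _ e0)] [k0 _ /(_ k0 (leqnn k0))].
rewrite /= sub0r normrN => H; exists k0.+1%:R^-1; first by rewrite invr_gt0.
exact: le_trans (ler_norm _) H.
Unshelve. all: by end_near. Qed.

(* Otherwise [alpha * r] would be nu-almost everywhere an integer, against [hfrac]. *)
Lemma residual_density_gt0 : 0 < nu_ residual_density.
Proof.
have h2 : 0 < 2^-1 :> R by rewrite invr_gt0.
have [delta d0 Bd] := near_integer_small h2.
set B := near_integer delta in Bd.
have bB : bounded_measurable (\1_B : X -> R) by apply: bm_indic; exact: measurable_near_integer.
have b1B : bounded_measurable (fun x => 1 - \1_B x : R) by exact: (bmB (bm_cst X 1) bB).
have brB : bounded_measurable (fun x => r x * (1 - \1_B x)) by apply: bmM => //; exact: bm_ratio.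
(* Off [B] the fractional part [alpha * residual_density x] is at least [delta], and [r x <= Mr].
   Integrating against [nu] bounds [delta * (1 - mu(B))], which is positive because [mu(B)] is at
   most one half. *)
have H x : delta * (r x * (1 - \1_B x)) <= Mr * alpha * residual_density x.
  rewrite indicE; have [Bx|Bx] := pselect (B x).
    rewrite mem_set// subrr !mulr0; apply: mulr_ge0; last exact: residual_density_ge0.
    apply: mulr_ge0; last exact: ltW.
    exact: le_trans (ratio_ge0 x) (ratio_le x).
  rewrite memNset// subr0 mulr1.
  have dx : delta <= alpha * residual_density x.
    rewrite /residual_density mulrBr mulVKf ?gt_eqF//.
    rewrite leNgt; apply/negP => dx; apply: Bx; exists (Num.truncn (alpha * (mu x / nu x))) => //=.
    rewrite ger0_norm// subr_ge0 truncn_le// mulr_ge0 ?ratio_ge0// ltW//.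
  rewrite [leLHS]mulrC -[leRHS]mulrA.
  by apply: ler_pM; [exact: ratio_ge0|exact: ltW|exact: ratio_le|].
have := density_mean_le hnu (bmM (bm_cst _ _) brB) (bmM (bm_cst _ _) bm_residual_density) H.
rewrite !density_meanZ//; last exact: bm_residual_density.
rewrite -density_mean_ratio density_meanB//; last exact: bm_cst.
rewrite density_mean_cst// => H1.
have H2 : 0 < delta * (1 - density_mean lambda mu \1_B) by rewrite mulr_gt0//; lra.
have H3 := lt_le_trans H2 H1.
have := density_mean_ge0 hnu residual_density_ge0.
by rewrite le_eqVlt => /orP[/eqP E|//]; move: H3; rewrite -E mulr0 ltxx.
Qed.

(** The denominator in [kappa] is the total residual mass, because the ratio has nu-mean 1. *)
Lemma kappaE f : kappa lambda mu nu alpha f =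
  nu_ (fun x => residual_density x * f x ^+ 2)
  - nu_ (fun x => residual_density x * f x) ^+ 2 / nu_ residual_density.
Proof.
rewrite /kappa/=; congr (_ - _ / _).
rewrite [RHS]density_meanB//; first by rewrite density_mean_ratio1.
  exact: bm_ratio.
by apply: bmM; [exact: bm_cst|exact: bm_copies].
Qed.

(** [kappa] is an unnormalised variance of [f] under the residual density: it is the integral of the
    squared deviation from the weighted mean [a]. *)
Lemma kappa_ge0 f : bounded_measurable f -> 0 <= kappa lambda mu nu alpha f.
Proof.
move=> bf; have br := bm_residual_density; have r0 := residual_density_gt0.
set a := nu_ (fun x => residual_density x * f x) / nu_ residual_density.
have brf : bounded_measurable (fun x => residual_density x * f x) by exact: bmM.
have brf2 : bounded_measurable (fun x => residual_density x * f x ^+ 2).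
  by apply: bmM => //; exact: bmX.
have : 0 <= nu_ (fun x => residual_density x * (f x - a) ^+ 2).
  by apply: (density_mean_ge0 hnu) => x; rewrite mulr_ge0 ?sqr_ge0// residual_density_ge0.
have -> : (fun x => residual_density x * (f x - a) ^+ 2) = (fun x =>
    (residual_density x * f x ^+ 2 - 2 * a * (residual_density x * f x)) + a ^+ 2 * residual_density x).
  by apply/funext => x; ring.
have b1 := bmM (bm_cst X (2 * a)) brf; have b2 := bmM (bm_cst X (a ^+ 2)) br.
rewrite (density_meanD hnu (bmB brf2 b1) b2) (density_meanB hnu brf2 b1) !density_meanZ// kappaE.
suff -> : forall u v w : R, w != 0 -> u - 2 * (v / w) * v + (v / w) ^+ 2 * w = u - v ^+ 2 / w by rewrite ?gt_eqF.
by move=> u v w w0; field.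
Qed.

End residual_density.

(** * Limits in probability and Slutsky *)

Section in_probability_more.
Context (R : realType) (d : nat -> measure_display)
  (Omega : forall m, measurableType (d m)) (P : forall m, probability (Omega m) R).

Lemma cvg_in_probability_near (Z Z' : forall m, Omega m -> R) (c : R) :
  (\forall m \near \oo, Z m = Z' m) -> cvg_in_probability P Z c -> cvg_in_probability P Z' c.
Proof.
move=> ZZ' H e e0; apply: cvg_trans (H e e0).
by apply: near_eq_cvg; apply: filterS ZZ' => m ->.
Qed.

Lemma cvg_in_probability_sqrt (Z : forall m, Omega m -> R) (c : R) :
  (forall m, measurable_fun setT (Z m)) -> cvg_in_probability P Z c ->
  cvg_in_probability P (fun m t => Num.sqrt (Z m t)) (Num.sqrt c).
Proof.
move=> mZ Zc; apply: (@cvg_in_probability_map2 _ _ _ _ Z Z c c (fun x _ => Num.sqrt x)) => //.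
  by move=> m; apply: measurableT_comp => //; apply: continuous_measurable_fun; exact: sqrt_continuous.
by apply: cvg_comp; [exact: cvg_fst|exact: sqrt_continuous].
Qed.

Lemma whp_cvg (Z : forall m, Omega m -> R) (c e : R) : (forall m, measurable_fun setT (Z m)) ->
  cvg_in_probability P Z c -> 0 < e -> whp P (fun m => [set t | `|Z m t - c| < e]).
Proof. by move=> mZ Zc; move/(cvg_in_probabilityP P c mZ) : Zc; apply. Qed.

Lemma cvg_mean_whp (f g : forall m, Omega m -> R) (M : R) :
  (forall m, bounded_measurable (f m)) -> (forall m, bounded_measurable (g m)) ->
  (forall m t, `|f m t| <= M) -> (forall m t, `|g m t| <= M) ->
  (forall e : R, 0 < e -> exists2 A, whp P A &
     \forall m \near \oo, forall t, A m t -> `|f m t - g m t| <= e) ->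
  (\int[P m]_t f m t) - (\int[P m]_t g m t) @[m --> \oo] --> (0 : R).
Proof.
move=> bf bg fM gM H; apply/cvgrPdist_le => e e0.
have M0 : 0 <= M by exact: le_trans (fM 0%N point).
pose e' := e / (1 + 2 * M).
have M1 : 0 < 1 + 2 * M by lra.
have e'0 : 0 < e' by rewrite divr_gt0.
have [A [mA PA] Hm] := H _ e'0.
near=> m.
have fg : `|\int[P m]_t f m t - \int[P m]_t g m t| <= e' + (M + M) * fine (P m (~` A m)).
  apply: bm_ex_close => //; last exact: ltW.
    by near: m.
  by move=> t; rewrite (le_trans (ler_normB _ _))// lerD.
rewrite sub0r normrN (le_trans fg)//.
have eE : e = e' + (M + M) * e' by rewrite /e'; field; rewrite gt_eqF.
rewrite [leRHS]eE lerD2l ler_wpM2l ?addr_ge0//; near: m; exact: PA e'0.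
Unshelve. all: by end_near. Qed.

(** With [c0] in place of [c m] this is the definition of weak convergence. The replacement is
    harmless where [W m] is bounded, by the Lipschitz bound, and tightness confines the rest. *)
Lemma cvg_mean_slutsky (W c : forall m, Omega m -> R) (L : probability (measurableTypeR R) R)
  (c0 : R) (H : R -> R) :
  (forall m, measurable_fun setT (W m)) -> (forall m, measurable_fun setT (c m)) ->
  cvg_in_distribution P W L -> cvg_in_probability P c c0 -> bounded_lipschitz H ->
  (\int[P m]_t H (c m t * W m t)) @[m --> \oo] --> \int[L]_x H (c0 * x).
Proof.
move=> mW mc WL cc0 bH; have [M [Lh [HM HL]]] := bH.
have cH := bounded_lipschitz_continuous bH.
have M0 : 0 <= M by exact: le_trans (HM 0).
have Lh0 : 0 <= Lh by have := HL 1 0; rewrite subr0 normr1 mulr1; exact: le_trans.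
have H1 : (\int[P m]_t H (c0 * W m t)) @[m --> \oo] --> \int[L]_x H (c0 * x).
  apply: (WL (fun x => H (c0 * x))); last by exists M => x.
  by move=> x; apply: continuous_comp; [exact: mulrl_continuous|exact: cH].
rewrite -[X in _ --> X]add0r.
rewrite (_ : (fun m => _) = (fun m => (\int[P m]_t H (c m t * W m t) - \int[P m]_t H (c0 * W m t))
    + \int[P m]_t H (c0 * W m t))); last by apply/funext => m; rewrite subrK.
apply: cvgD H1; apply/cvgrPdist_le => e e0.
(* The good event costs [e'], and its complement, of probability at most [3 * e'], costs
   [(M + M) * (3 * e')]. *)
pose e' := e / (1 + 8 * M).
have M1 : 0 < 1 + 8 * M by lra.
have e'0 : 0 < e' by rewrite divr_gt0.
have [K LK] := tent_tail L e'0.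
pose K' := `|K| + 1.
have K'0 : 0 < K' by rewrite ltr_wpDl.
pose delta := e' / ((Lh + 1) * K').
have Lh1 : 0 < Lh + 1 by lra.
have delta0 : 0 < delta by rewrite divr_gt0// mulr_gt0.
have [mc1 /(_ _ e'0) Pc] := whp_cvg mc cc0 delta0.
have tW := WL (tent K) (@tent_continuous R K) _.
have {tW} /cvgrPdist_le /(_ _ e'0) tW : (\int[P m]_t tent K (W m t)) @[m --> \oo] --> \int[L]_x tent K x.
  by apply: tW; exists 1 => x; rewrite ger0_norm ?tent_ge0 ?tent_le1.
near=> m.
pose A1 := [set t | `|c m t - c0| < delta]; pose A2 := [set t | `|W m t - 0| < K'].
have mA1 : measurable A1 by exact: mc1.
have mA2 : measurable A2 by exact: whp_dist_measurable.
have bt : bounded_measurable (fun t => tent K (W m t)).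
  apply: (@bm_le _ _ _ _ 1); last by move=> t; rewrite ger0_norm ?tent_ge0 ?tent_le1.
  by apply: measurableT_comp => //; apply: continuous_measurable_fun; exact: tent_continuous.
have PA1 : fine (P m (~` A1)) <= e' by rewrite /A1; near: m.
(* The tent vanishes beyond [K'], so the tail is at most 1 minus the mean of the tent, which is
   within [e'] of its value under [L]. *)
have PA2 : fine (P m (~` A2)) <= 2 * e'.
  have mA2' := measurableC mA2.
  apply: (@le_trans _ _ (1 - \int[P m]_t tent K (W m t))); last first.
    have : `|\int[L]_x tent K x - \int[P m]_t tent K (W m t)| <= e' by near: m.
    move: LK; rewrite ler_norml.
    move: (\int[L]_x tent K x) (\int[P m]_t tent K (W m t)) => a b ? /andP[]; lra.
  rewrite -ex_indic// -{1}(ex_cst (P m) 1) -bm_exB//; last exact: bm_cst.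
  apply: bm_le_ex; [exact: bm_indic|exact: (bmB (bm_cst _ 1) bt)|].
  move=> t; rewrite indicE; case: (boolP (t \in _)) => [|_]; last by rewrite subr_ge0 tent_le1.
  rewrite inE /A2/= => /negP; rewrite subr0 -leNgt => WK.
  by rewrite tent_out ?subr0// (le_trans _ WK)// lerD2r ler_norm.
have bHc (u : Omega m -> R) : measurable_fun setT u -> bounded_measurable (fun t => H (u t * W m t)).
  by move=> mu; apply: (bounded_lipschitz_bm bH); exact: measurable_funM.
rewrite sub0r normrN.
have H12 t : (A1 `&` A2) t -> `|H (c m t * W m t) - H (c0 * W m t)| <= e'.
  move=> [/= ct]; rewrite /A2/= subr0 => Wt; rewrite (le_trans (HL _ _))// -mulrBl normrM.
  apply: (@le_trans _ _ (Lh * (delta * K'))); first by rewrite ler_wpM2l// ler_pM// ltW.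
  have -> : delta * K' = e' / (Lh + 1) by rewrite /delta; field; rewrite !gt_eqF.
  by rewrite mulrCA -ler_pdivlMl// mulVf ?gt_eqF// ler_pdivrMr// mul1r lerDl.
have HMM t : `|H (c m t * W m t) - H (c0 * W m t)| <= M + M.
  by rewrite (le_trans (ler_normB _ _))// lerD.
have HH := bm_ex_close (P m) (measurableI _ _ mA1 mA2) (bHc _ (mc m)) (bHc (fun=> c0) (measurable_cst _))
  H12 HMM (ltW e'0).
apply: (le_trans HH).
have PA : fine (P m (~` (A1 `&` A2))) <= 3 * e'.
  have mA1' := measurableC mA1; have mA2' := measurableC mA2.
  rewrite setCI fine_prob_le; last exact: measurableU.
  rewrite (le_trans (measureU2 _ _ _))// (_ : 3 * e' = e' + 2 * e'); last by ring.
  by rewrite EFinD leeD// -fine_prob_le.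
have eE : e = e' + (M + M) * (4 * e') by rewrite /e'; field; rewrite gt_eqF.
rewrite [leRHS]eE lerD2l ler_wpM2l ?addr_ge0//; lra.
Unshelve. all: by end_near. Qed.

End in_probability_more.

(** * Asymptotics of the residual variance *)

Section asymptotics.
Context (R : realType) (dX : measure_display)
  (X : measurableType dX) (lambda : {measure set X -> \bar R})
  (mu nu : X -> R)
  (d : nat -> measure_display) (Omega : forall m, measurableType (d m))
  (P : forall m, probability (Omega m) R)
  (xi : forall m, 'I_m -> {RV (P m) >-> X})
  (n : nat -> nat) (alpha Mr : R).
Arguments xi : clear implicits.
Hypotheses (hmu : is_density lambda mu) (hnu : is_density lambda nu)
  (hdom : forall x, nu x = 0 -> mu x = 0)
  (ratio_le : forall x, mu x / nu x <= Mr)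
  (hlln : forall f, bounded_measurable f ->
     cvg_in_probability P
       (fun m t => m%:R^-1 * \sum_(i < m) f (xi m i t))
       (density_mean lambda nu f))
  (halpha : 0 < alpha)
  (hn : (n m)%:R / m%:R @[m --> \oo] --> alpha)
  (hfrac : (\int[lambda]_(x in [set x : X | exists k : nat,
                                   (alpha * (mu x / nu x) = k%:R)%R])
              (mu x)%:E = 0)%E).

Notation r := (fun x => mu x / nu x).
Notation "'nu_' f" := (density_mean lambda nu f) (at level 10, f at level 9).
Notation copies := (fun x => (Num.truncn (alpha * (mu x / nu x)))%:R : R).
Notation rho := (residual_density mu nu alpha).

Definition sample_mean (phi : X -> R) m (t : Omega m) : R :=
  m%:R^-1 * \sum_(i < m) phi (xi m i t).

Lemma measurable_sample_mean phi m : measurable_fun setT phi -> measurable_fun setT (@sample_mean phi m).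
Proof.
move=> mphi; apply: measurable_funM => //; apply: measurable_sum => i.
exact: measurableT_comp.
Qed.

(** The random factor standing where [alpha] stands in the limit: n times a weight is [scale] times
    the ratio. *)
Definition scale m (t : Omega m) : R := (n m)%:R / m%:R * (sample_mean r t)^-1.

Lemma measurable_scale m : measurable_fun setT (@scale m).
Proof.
apply: measurable_funM => //; apply: measurable_fun_inv; apply: measurable_sample_mean.
exact: measurable_ratio hmu hnu.
Qed.

Lemma scale_weight m i (t : Omega m) : (0 < m)%N ->
  (n m)%:R * weight r (xi m) i t = scale t * (mu (xi m i t) / nu (xi m i t)).
Proof.
move=> m0; rewrite /weight /scale /sample_mean invfM invrK.
move: (\sum_(j < m) _)^-1 (mu (xi m i t) / nu (xi m i t)) => S q.
have : m%:R != 0 :> R by rewrite pnatr_eq0 -lt0n.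
by move: (m%:R : R) => z z0; field.
Qed.

Lemma ratio_mean_cvg : cvg_in_probability P (sample_mean r) 1.
Proof.
have := hlln (bm_ratio hmu hnu ratio_le).
by rewrite (density_mean_ratio1 hmu hdom).
Qed.

Lemma measurable_ratio_mean m : measurable_fun setT (@sample_mean r m).
Proof. by apply: measurable_sample_mean; exact: measurable_ratio hmu hnu. Qed.

Lemma scale_cvg : cvg_in_probability P scale alpha.
Proof.
have mr := measurable_ratio_mean.
rewrite -[alpha]mulr1 -[X in _ * X]invr1.
apply: (cvg_in_probabilityM (Z1 := fun m t => (n m)%:R / m%:R)) => //.
- by move=> m; exact: measurable_fun_inv.
- exact: cvg_in_probability_cst.
- by apply: cvg_in_probabilityV => //; exact: ratio_mean_cvg.
Qed.

Definition sample_copies (phi : X -> R) m (t : Omega m) : R :=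
  m%:R^-1 * \sum_(i < m) (Num.truncn (scale t * (mu (xi m i t) / nu (xi m i t))))%:R * phi (xi m i t).

Lemma measurable_sample_copies phi m : measurable_fun setT phi -> measurable_fun setT (@sample_copies phi m).
Proof.
move=> mphi; apply: measurable_funM => //; apply: measurable_sum => i.
apply: measurable_funM; last by apply: measurableT_comp.
apply: measurable_natr; apply: measurable_fun_truncn; apply: measurable_funM.
  exact: measurable_scale.
by apply: (measurableT_comp (f := r)) => //; exact: measurable_ratio hmu hnu.
Qed.

(** With [alpha] instead of [scale] this is the law of large numbers. By [truncn_close] the error is
    at most a constant times the empirical mean of the ratio over [B], which converges to
    [mu(B)]. *)
Lemma sample_copies_cvg phi : bounded_measurable phi ->
  cvg_in_probability P (sample_copies phi) (nu_ (fun x => copies x * phi x)).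
Proof.
move=> bphi; have [mphi [K phiK]] := bphi.
have K0 : 0 <= K by exact: le_trans (phiK point).
have Mr0 : 0 <= Mr by exact: le_trans (ratio_ge0 hmu hnu point) (ratio_le point).
have bc := bm_copies hmu hnu ratio_le halpha.
have mcphi m : measurable_fun setT (@sample_mean (fun x => copies x * phi x) m).
  by apply: measurable_sample_mean; apply: bm_meas; exact: bmM.
have mscphi m : measurable_fun setT (@sample_copies phi m) by exact: measurable_sample_copies.
have := hlln (bmM bc bphi); rewrite -[X in cvg_in_probability P X]/(sample_mean (fun x => copies x * phi x)).
set l := nu_ _ => Hl.
apply: (@cvg_in_probability_near _ _ _ _ (fun m t =>
    (sample_copies phi t - sample_mean (fun x => copies x * phi x) t) + sample_mean (fun x => copies x * phi x) t)).
  by apply: nearW => m; apply/funext => t; rewrite subrK.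
rewrite -[l]add0r; apply: cvg_in_probabilityD => //.
  by move=> m; exact: measurable_funB.
apply: cvg_in_probability_whp; first by move=> m; exact: measurable_funB.
move=> e e0.
pose C := 3 * alpha * K.
have C0 : 0 <= C by rewrite mulr_ge0// mulr_ge0// ltW.
pose e' := e / (2 * C + 1).
have C1 : 0 < 2 * C + 1 by rewrite ltr_wpDl// mulr_ge0.
have e'0 : 0 < e' by rewrite divr_gt0.
have [delta delta0 Bd] := near_integer_small hmu hnu halpha hfrac e'0.
set B := near_integer mu nu alpha delta in Bd.
have mB : measurable B by exact: (measurable_near_integer alpha hmu hnu).
have brB : bounded_measurable (fun x => r x * \1_B x : R).
  by apply: bmM; [exact: bm_ratio hmu hnu ratio_le|exact: bm_indic].
(* The two requirements of [truncn_close], the second one uniformly over ratios at most [Mr]. *)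
pose delta' := Num.min alpha (delta / (Mr + 1)).
have delta'0 : 0 < delta' by rewrite lt_min halpha divr_gt0// ltr_wpDl.
have mrB m : measurable_fun setT (@sample_mean (fun x => r x * \1_B x) m).
  by apply: measurable_sample_mean; case: brB.
exists (fun m => [set t | `|@scale m t - alpha| < delta'] `&`
    [set t | `|sample_mean (fun x => r x * \1_B x) t - nu_ (fun x => r x * \1_B x)| < e']).
  apply: whpI; first exact: whp_cvg measurable_scale scale_cvg delta'0.
  by apply: (whp_cvg mrB) => //; exact: hlln.
apply: nearW => m t [/= ]; rewrite lt_min => /andP[s1 s2].
rewrite -density_mean_ratio// => H.
have HB : sample_mean (fun x => r x * \1_B x) t < 2 * e'.
  by move: H Bd; rewrite ltr_norml => /andP[_]; lra.
rewrite subr0 /sample_copies /sample_mean -mulrBr -sumrB normrM ger0_norm ?invr_ge0//.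
have : m%:R^-1 * `|\sum_(i < m) ((Num.truncn (scale t * (mu (xi m i t) / nu (xi m i t))))%:R * phi (xi m i t)
   - copies (xi m i t) * phi (xi m i t))| <= C * sample_mean (fun x => r x * \1_B x) t.
  rewrite /sample_mean mulrCA ler_wpM2l ?invr_ge0// mulr_sumr (le_trans (ler_norm_sum _ _ _))//.
  apply: ler_sum => i _; rewrite -mulrBl normrM /C.
  set x := xi m i t.
  have r0 : 0 <= mu x / nu x by exact: ratio_ge0 hmu hnu x.
  have s3 : `|scale t - alpha| * (mu x / nu x) < delta.
    apply: (@le_lt_trans _ _ (`|scale t - alpha| * (Mr + 1))).
      by rewrite ler_wpM2l// (le_trans (ratio_le x))// lerDl.
    by rewrite -ltr_pdivlMr// ltr_wpDl.
  have := truncn_close r0 halpha (ltW s1) s3.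
  move=> /(fun h => ler_pM (normr_ge0 _) (normr_ge0 _) h (phiK x)) /le_trans; apply.
  rewrite (_ : \1__ (alpha * _) = \1_B x)//.
  by rewrite le_eqVlt; apply/orP; left; apply/eqP; ring.
move=> /le_lt_trans; apply.
apply: (@le_lt_trans _ _ (C * (2 * e'))); first by rewrite ler_wpM2l// ltW.
have -> : e = C * (2 * e') + e' by rewrite /e'; field; rewrite gt_eqF.
by rewrite ltrDl.
Qed.

(** For m positive the average is [m / n] times the difference between the scaled mean of the ratio
    times [phi] and [sample_copies phi]; each factor converges. *)
Lemma residual_average_cvg phi : bounded_measurable phi ->
  cvg_in_probability P (fun m => residual_average (n m) (xi m) r phi) (nu_ (fun x => rho x * phi x)).
Proof.
move=> bphi; have [mphi _] := bphi; have br := bm_ratio hmu hnu ratio_le.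
have bc := bm_copies hmu hnu ratio_le halpha.
have brphi := bmM br bphi; have [mrphi _] := brphi; have bcphi := bmM bc bphi.
have -> : nu_ (fun x => rho x * phi x) = alpha^-1 * (alpha * nu_ (fun x => r x * phi x) - nu_ (fun x => copies x * phi x)).
  rewrite mulrBr mulKf ?gt_eqF// -(density_meanZ hnu)// -(density_meanB hnu)//; last exact: (bmM (bm_cst X alpha^-1) bcphi).
  by congr (density_mean _ _ _); apply/funext => x; rewrite /residual_density; ring.
apply: (@cvg_in_probability_near _ _ _ _ (fun m t => (m%:R / (n m)%:R) *
   (scale t * sample_mean (fun x => r x * phi x) t - sample_copies phi t))).
  near=> m; apply/funext => t.
  have m0 : (0 < m)%N by near: m; exists 1%N.
  rewrite /residual_average /sample_mean /sample_copies mulrCA -mulrBr mulrA.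
  have -> : m%:R / (n m)%:R * m%:R^-1 = (n m)%:R^-1 :> R.
    have : m%:R != 0 :> R by rewrite pnatr_eq0 -lt0n.
    by move: (m%:R : R) ((n m)%:R^-1 : R) => z y z0; field.
  congr (_ * _); rewrite mulr_sumr -sumrB; apply: eq_bigr => i _.
  by rewrite /residual_mass /sure_copies scale_weight//; ring.
apply: cvg_in_probabilityM => //.
- by move=> m; apply: measurable_funB; [apply: measurable_funM|exact: measurable_sample_copies];
    [exact: measurable_scale|exact: measurable_sample_mean].
- apply: cvg_in_probability_cst.
  rewrite (_ : (fun m => _) = (fun m => ((n m)%:R / m%:R)^-1)); first by apply: cvgV; rewrite ?gt_eqF.
  by apply/funext => m; rewrite invfM invrK mulrC.
- apply: cvg_in_probabilityB.
  + by move=> m; apply: measurable_funM; [exact: measurable_scale|exact: measurable_sample_mean].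
  + by move=> m; exact: measurable_sample_copies.
  + apply: cvg_in_probabilityM; [exact: measurable_scale|by move=> m; exact: measurable_sample_mean|exact: scale_cvg|].
    exact: hlln.
  + exact: sample_copies_cvg.
Unshelve. all: by end_near. Qed.

Lemma residual_average1_cvg :
  cvg_in_probability P (fun m => residual_average (n m) (xi m) r (fun=> 1)) (nu_ rho).
Proof.
rewrite (_ : nu_ rho = nu_ (fun x => rho x * 1)); first exact/residual_average_cvg/bm_cst.
by congr (density_mean _ _ _); apply/funext => x; rewrite mulr1.
Qed.

Lemma residual_variance_cvg f : bounded_measurable f ->
  cvg_in_probability P (fun m => residual_variance (n m) (xi m) r f) (kappa lambda mu nu alpha f).
Proof.
move=> bf; have mr := measurable_ratio hmu hnu; have r0 := ratio_ge0 hmu hnu.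
have rg := residual_density_gt0 hmu hnu hdom ratio_le halpha hfrac.
rewrite (kappaE hmu hnu hdom ratio_le halpha).
have [mf _] := bf.
have ma phi m : measurable_fun setT phi -> measurable_fun setT (residual_average (n m) (xi m) r phi).
  exact: (measurable_residual_average (n m) (xi m) (@sub0set _ _) mr).
have mf2 : measurable_fun setT (fun x => f x ^+ 2) by exact: measurable_funX.
apply: cvg_in_probabilityB => //.
- by move=> m; exact: ma.
- move=> m; apply: measurable_funM; first by apply: measurable_funX; exact: ma.
  by apply: measurable_fun_inv; exact: ma.
- by apply: residual_average_cvg; exact: bmX.
- apply: cvg_in_probabilityM.
  + by move=> m; apply: measurable_funX; exact: ma.
  + by move=> m; apply: measurable_fun_inv; exact: ma.
  + by apply: cvg_in_probabilityM; [move=> m; exact: ma|move=> m; exact: ma| |]; exact: residual_average_cvg.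
  + apply: cvg_in_probabilityV; [by move=> m; exact: ma|by rewrite gt_eqF|exact: residual_average1_cvg].
Qed.

(** The weights sum to 1 once their denominator is nonzero, and the empirical mean of the ratio
    tends to 1. *)
Lemma whp_weights : whp P (fun m => [set t | \sum_(i < m) weight r (xi m) i t = 1]).
Proof.
apply: whp_le (whp_cvg measurable_ratio_mean ratio_mean_cvg ltr01).
  move=> m; apply: (event_measurable (past := set0)).
  - exact: sub0set.
  - exact: measurable_ratio hmu hnu.
near=> m => t /= H.
have S0 : \sum_(i < m) mu (xi m i t) / nu (xi m i t) != 0.
  apply/eqP => S0; move: H; rewrite /sample_mean S0 mulr0 sub0r normrN normr1 ltxx//.
by rewrite /weight -mulr_suml mulfV.
Unshelve. all: by end_near. Qed.

(** On the second event the proportion of residual trials is within its positive limit of that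
    limit, hence nonzero, as [sample_clt] requires. *)
Lemma whp_residual_trials :
  whp P (fun m => [set t | \sum_(i < m) weight r (xi m) i t = 1] `&`
    [set t | `|residual_average (n m) (xi m) r (fun=> 1) t - nu_ rho| < nu_ rho]).
Proof.
apply: whpI; first exact: whp_weights.
apply: whp_cvg; last exact: residual_density_gt0 hmu hnu hdom ratio_le halpha hfrac.
  move=> m; apply: (measurable_residual_average (n m) (xi m) (@sub0set _ _) (measurable_ratio hmu hnu)).
  exact: measurable_cst.
exact: residual_average1_cvg.
Qed.

End asymptotics.

(** * The central limit theorem *)

(** Self-normalised weights make the error an inverse sample mean times a sum of [r * (f - b)], to
    which the hypothesis on the initial sample applies. *)
Lemma scaled_weighted_mean d (T : measurableType d) dX (X : measurableType dX) (R : realType)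
  (P : probability T R) (m n : nat) (xi : 'I_m -> {RV P >-> X}) (r f : X -> R) (b : R) (t : T) :
  (0 < m)%N -> \sum_(i < m) weight r xi i t = 1 ->
  Num.sqrt n%:R * (weighted_mean xi r f t - b) =
  Num.sqrt (n%:R / m%:R) * (m%:R^-1 * \sum_(i < m) r (xi i t))^-1
  * (Num.sqrt m%:R * (m%:R^-1 * \sum_(i < m) r (xi i t) * (f (xi i t) - b))).
Proof.
move=> m0 Et.
have mR : m%:R != 0 :> R by rewrite pnatr_eq0 -lt0n.
have -> : weighted_mean xi r f t - b =
    (\sum_(i < m) r (xi i t))^-1 * \sum_(i < m) r (xi i t) * (f (xi i t) - b).
  rewrite -[b]mul1r -{1}Et mulr_suml -sumrB mulr_sumr; apply: eq_bigr => i _.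
  by rewrite mul1r -mulrBr /weight; ring.
have -> : Num.sqrt n%:R = Num.sqrt (n%:R / m%:R) * Num.sqrt m%:R :> R.
  by rewrite -sqrtrM ?divr_ge0// divfK.
rewrite invfM invrK.
move: (\sum_(i < m) r (xi i t))^-1 (\sum_(i < m) r (xi i t) * (f (xi i t) - b)) => S y.
move: (Num.sqrt _) (Num.sqrt _) => a c.
by move: (m%:R : R) mR => q q0; field.
Qed.

Theorem corollary5 (R : realType) (dX : measure_display)
  (X : measurableType dX) (lambda : {measure set X -> \bar R})
  (mu nu g : X -> R) (c : R)
  (d : nat -> measure_display) (Omega : forall m, measurableType (d m))
  (P : forall m, probability (Omega m) R)
  (past : forall m, set (set (Omega m)))
  (xi : forall m, 'I_m -> {RV (P m) >-> X})
  (sigma2 : (X -> R) -> R) (n : nat -> nat) (alpha : R)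
  (xit : forall m, 'I_(n m) -> {RV (P m) >-> X})
  (hmu : is_density lambda mu) (hnu : is_density lambda nu)
  (hdom : forall x, nu x = 0 -> mu x = 0)
  (hc : 0 < c) (hg : forall x, g x = c * (mu x / nu x))
  (hbound : exists M : R, forall x, g x <= M)
  (hpast : forall m, past m `<=` measurable)
  (hsigma2 : forall f, bounded_measurable f -> 0 <= sigma2 f)
  (hlln : forall f, bounded_measurable f ->
     cvg_in_probability P
       (fun m t => m%:R^-1 * \sum_(i < m) f (xi m i t))
       (density_mean lambda nu f))
  (hclt : forall f, bounded_measurable f ->
     cvg_in_distribution P
       (fun m t => Num.sqrt m%:R
          * (m%:R^-1 * \sum_(i < m) f (xi m i t) - density_mean lambda nu f))
       (normal_law 0 (sigma2 f)))
  (hninfty : n m @[m --> \oo] --> \oo)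
  (halpha : 0 < alpha)
  (hn : (n m)%:R / m%:R @[m --> \oo] --> alpha)
  (hfrac : (\int[lambda]_(x in [set x : X | exists k : nat,
                                   (alpha * (mu x / nu x) = k%:R)%R])
              (mu x)%:E = 0)%E)
  (hres : forall m,
     residual_resampling
       (sigma_before (past m) (xi m) (weight g (xi m)))
       (xi m) (weight g (xi m)) (xit m)) :
  forall f, bounded_measurable f ->
    cvg_in_probability P
      (fun m t => (n m)%:R
         * cond_var (P m) (sigma_before (past m) (xi m) (weight g (xi m)))
             (fun t' => (n m)%:R^-1 * \sum_(i < n m) f (xit m i t')) t)
      (kappa lambda mu nu alpha f)
    /\
    cvg_in_distribution P
      (fun m t => Num.sqrt (n m)%:R
         * ((n m)%:R^-1 * \sum_(i < n m) f (xit m i t)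
            - density_mean lambda mu f))
      (normal_law 0
         (kappa lambda mu nu alpha f
          + alpha * sigma2 (fun x => mu x / nu x
                                     * (f x - density_mean lambda mu f)))).
Proof.
move=> f bf; have [mf [Kf fK]] := bf.
pose r x := mu x / nu x.
(* The unknown constant [c] cancels in the weights. *)
have wE m : weight g (xi m) = weight r (xi m).
  apply/funext => i; apply/funext => t; rewrite /weight hg.
  under eq_bigr do rewrite hg.
  by rewrite -mulr_sumr invfM mulrACA divff ?mul1r// gt_eqF.
have [Mg gM] := hbound.
have ratio_le x : mu x / nu x <= c^-1 * Mg by rewrite ler_pdivlMl// -hg.
have mr : measurable_fun setT r := measurable_ratio hmu hnu.
have r0 x : 0 <= r x := ratio_ge0 hmu hnu x.
have hres' m : residual_resampling (sigma_before (past m) (xi m) (weight r (xi m)))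
    (xi m) (weight r (xi m)) (xit m) by rewrite -wE.
have n_gt0 : \forall m \near \oo, (0 < n m)%N by move/cvgnyPge : hninfty; apply.
pose E m := [set t | \sum_(i < m) weight r (xi m) i t = 1].
have mE m : measurable (E m) := event_measurable (xi m) (@hpast m) mr.
have whpE : whp P E := whp_weights hmu hnu hdom ratio_le hlln.
have mV m : measurable_fun setT (residual_variance (n m) (xi m) r f).
  exact: (@measurable_residual_variance _ _ _ _ _ (P m) m (n m) (past m) (xi m) r (hpast m) mr f mf).
have V_cvg := residual_variance_cvg hmu hnu hdom ratio_le hlln halpha hn hfrac bf.
have V_ge0 := kappa_ge0 hmu hnu hdom ratio_le halpha hfrac bf.
set kap := kappa _ _ _ _ _ in V_cvg V_ge0 *.
split.
  set Z := (X in cvg_in_probability _ X _).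
  have ZE m : (0 < n m)%N -> measurable_fun setT (Z m) /\
      exists N, [/\ measurable N, P m N = 0%E & forall t, E m t -> ~ N t ->
        Z m t = residual_variance (n m) (xi m) r f t].
    move=> n0; have [mcv [N HN]] := sample_cond_var (@hpast m) mr r0 mf fK n0 (hres' m).
    rewrite /Z wE; split; last by exists N.
    by apply: measurable_funM.
  have mZ m : measurable_fun setT (Z m).
    (* For small m the number n may be 0; the factor n then makes [Z m] zero. *)
    have [n0|/ZE[]//] := posnP (n m).
    rewrite (_ : Z m = fun=> 0); first exact: measurable_cst.
    apply/funext => t; rewrite /Z.
    have -> : (n m)%:R = 0 :> R by rewrite n0.
    by rewrite mul0r.
  apply/(cvg_in_probabilityP P kap mZ) => e e0.
  split=> [m|e' e'0]; first exact: whp_dist_measurable.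
  have [mB PB] := whpI whpE (whp_cvg mV V_cvg e0).
  near=> m.
  have n0 : (0 < n m)%N by near: m.
  have [_ [N [mN PN ZN]]] := ZE m n0.
  have PBm : fine (P m (~` (E m `&` [set t | `|residual_variance (n m) (xi m) r f t - kap| < e]))) <= e'.
    by near: m; exact: PB.
  have mA : measurable (~` [set t | `|Z m t - kap| < e]) by apply: measurableC; exact: whp_dist_measurable.
  have mB' := measurableC (mB m).
  move: PBm; rewrite !fine_prob_le// => /(le_trans _); apply.
  rewrite -[leRHS]adde0 -PN; apply: le_trans (measureU2 _ mB' mN).
  apply: le_measure; rewrite ?inE//; first exact: measurableU.
  move=> t /= At; have [Nt|Nt] := pselect (N t); [by right|left].
  by move=> [Et /= Vt]; apply: At; rewrite ZN.
set b := density_mean lambda mu f.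
(* Under [nu] this has mean [mu(f) - b], which is 0, so no centring term remains. *)
pose psi x := r x * (f x - b).
have bpsi : bounded_measurable psi.
  apply: bmM; first exact: bm_ratio hmu hnu ratio_le.
  exact: (bmB bf (bm_cst X b)).
have psi0 : density_mean lambda nu psi = 0.
  rewrite -(density_mean_ratio lambda hdom (fun x => f x - b)).
  by rewrite (density_meanB hmu bf (bm_cst X b)) (density_mean_cst hmu) subrr.
have s2 := hsigma2 psi bpsi.
set s := sigma2 psi in s2 *.
pose W m (t : Omega m) := Num.sqrt m%:R * (m%:R^-1 * \sum_(i < m) psi (xi m i t) - density_mean lambda nu psi).
have W_cvg : cvg_in_distribution P W (normal_law 0 s) := hclt psi bpsi.
have mW m : measurable_fun setT (W m).
  apply: measurable_funM => //; apply: measurable_funB => //.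
  exact: (measurable_sample_mean xi (bm_meas bpsi)).
pose C m (t : Omega m) := Num.sqrt ((n m)%:R / m%:R) * (sample_mean xi r t)^-1.
have mC m : measurable_fun setT (C m).
  apply: measurable_funM => //; apply: measurable_fun_inv.
  exact: (measurable_ratio_mean xi hmu hnu).
have C_cvg : cvg_in_probability P C (Num.sqrt alpha).
  rewrite -[Num.sqrt alpha]mulr1 -[X in _ * X]invr1.
  apply: (cvg_in_probabilityM (Z1 := fun m _ => Num.sqrt ((n m)%:R / m%:R))) => //.
  - by move=> m; apply: measurable_fun_inv; exact: (measurable_ratio_mean xi hmu hnu).
  - apply: cvg_in_probability_cst; apply: (cvg_comp _ _ hn); exact: sqrt_continuous.
  - apply: cvg_in_probabilityV => //; last exact: ratio_mean_cvg hmu hnu hdom ratio_le hlln.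
    by move=> m; exact: (measurable_ratio_mean xi hmu hnu).
set Z := (X in cvg_in_distribution _ X _).
have mZ m : measurable_fun setT (Z m).
  by apply: measurable_funM => //; apply: measurable_funB => //; exact: resampled_mean_measurable.
apply: cvg_in_distribution_smooth2 => // K F F1 F2 sF.
have [bF _ _ _] := sF; have [M [L [FM FL]]] := bF.
have M0 : 0 <= M by exact: le_trans (FM 0).
have L0 : 0 <= L by have := FL 1 0; rewrite subr0 normr1 mulr1; exact: le_trans.
have bH := bounded_lipschitz_heat kap bF.
have HM x : `|heat kap F x| <= M by exact: heat_le.
have slutsky := cvg_mean_slutsky mW mC W_cvg C_cvg bH.
have EI m : exists I : Omega m -> R, [/\ measurable_fun setT I, forall t, `|I t| <= M &
    (0 < n m)%N -> \int[P m]_t (\1_(E m) t * F (Z m t)) = \int[P m]_t I t /\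
    forall t, E m t -> (0 < residual_trials (n m) (weight r (xi m)) t)%N ->
    `|I t - heat (residual_variance (n m) (xi m) r f t) F
        (Num.sqrt (n m)%:R * (weighted_mean (xi m) r f t - b))|
      <= K * (1 + @std_normal_abs3 R) * (2 * Kf) ^+ 3 * (Num.sqrt (n m)%:R / (n m)%:R)].
  (* If n is 0 only measurability and the bound are claimed, and the zero function serves. *)
  have [n0|n0] := posnP (n m).
    by exists (fun=> 0); split=> [|t|]; rewrite ?normr0//; exact: measurable_cst.
  have [I [mI IM IE IH]] := sample_clt (@hpast m) mr r0 mf fK n0 (hres' m) b sF FM.
  exists I; split; [exact: mI|exact: IM|move=> _; split; [exact: IE|exact: IH]].
pose I m := sval (cid (EI m)).
have mI m : measurable_fun setT (I m) by rewrite /I; case: cid => I0 [].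
have IM m t : `|I m t| <= M by rewrite /I; case: cid => I0 [].
have IP m : (0 < n m)%N -> \int[P m]_t (\1_(E m) t * F (Z m t)) = \int[P m]_t I m t /\
    forall t, E m t -> (0 < residual_trials (n m) (weight r (xi m)) t)%N ->
    `|I m t - heat (residual_variance (n m) (xi m) r f t) F
        (Num.sqrt (n m)%:R * (weighted_mean (xi m) r f t - b))|
      <= K * (1 + @std_normal_abs3 R) * (2 * Kf) ^+ 3 * (Num.sqrt (n m)%:R / (n m)%:R).
  by rewrite /I; case: cid => I0 [].
have bFZ m : bounded_measurable (fun t => F (Z m t)) by exact: bounded_lipschitz_bm.
have bEFZ m : bounded_measurable (fun t => \1_(E m) t * F (Z m t)).
  by apply: bmM; [apply: bm_indic; exact: mE|exact: bFZ].
have bHCW m : bounded_measurable (fun t => heat kap F (C m t * W m t)).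
  by apply: (bounded_lipschitz_bm bH); exact: measurable_funM.
(* Restricting to the event where the scheme is specified costs a vanishing amount. *)
have D1 : (\int[P m]_t F (Z m t)) - (\int[P m]_t (\1_(E m) t * F (Z m t))) @[m --> \oo] --> (0 : R).
  apply: (@cvg_mean_whp _ _ _ P (fun m t => F (Z m t)) (fun m t => \1_(E m) t * F (Z m t)) M) => //.
    move=> m t; rewrite normrM -[M]mul1r ler_pM// indicE.
    by case: (_ \in _); rewrite ?normr1 ?normr0.
  move=> e e0; exists E => //; apply: nearW => m t Et.
  by rewrite indicE mem_set// mul1r subrr normr0 ltW.
(* Lindeberg's bound makes the residual noise Gaussian with a random variance; [heat_close] then
   replaces that variance by its limit [kap]. *)
have D2 : (\int[P m]_t I m t) - (\int[P m]_t heat kap F (C m t * W m t)) @[m --> \oo] --> (0 : R).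
  apply: (@cvg_mean_whp _ _ _ P I (fun m t => heat kap F (C m t * W m t)) M) => //.
    by move=> m; exact: bm_le.
  move=> e e0.
  pose c1 := L * @std_normal_abs1 R.
  pose c3 := K * (1 + @std_normal_abs3 R) * (2 * Kf) ^+ 3.
  (* [heat_close] is linear in the difference of standard deviations, so convergence is required of
     the square roots. *)
  pose delta := e / 2 / (`|c1| + 1).
  have c1_gt0 : 0 < `|c1| + 1 by rewrite ltr_wpDl.
  have delta0 : 0 < delta by rewrite !divr_gt0.
  have msV m : measurable_fun setT (fun t => Num.sqrt (residual_variance (n m) (xi m) r f t)).
    by apply: measurableT_comp => //; apply: continuous_measurable_fun; exact: sqrt_continuous.
  have wT := whp_residual_trials hmu hnu hdom ratio_le hlln halpha hn hfrac.
  have wV := whp_cvg msV (cvg_in_probability_sqrt mV V_cvg) delta0.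
  eexists; first exact: whpI wT wV.
  near=> m => t [[Et /= Nt] Vt].
  have n0 : (0 < n m)%N by near: m.
  have m0 : (0 < m)%N by near: m; exists 1%N.
  have N0 : (0 < residual_trials (n m) (weight r (xi m)) t)%N.
    move: Nt; rewrite (residual_average1 (n m) r0 Et) lt0n; apply: contraTneq => ->.
    by rewrite mulr0 sub0r normrN -leNgt ler_norm.
  have [_ /(_ t Et N0)] := IP m n0.
  have -> : Num.sqrt (n m)%:R * (weighted_mean (xi m) r f t - b) = C m t * W m t.
    by rewrite (scaled_weighted_mean (n m) f b m0 Et) /W psi0 subr0.
  move=> H1.
  have H2 := heat_close (residual_variance (n m) (xi m) r f t) kap (C m t * W m t) bF FL.
  have H3 : c3 * (Num.sqrt (n m)%:R / (n m)%:R) <= e / 2.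
    have Hn : (Num.bound ((`|c3| / (e / 2)) ^+ 2) <= n m)%N.
      by near: m; move/cvgnyPge : hninfty; apply.
    have nR : 0 < (n m)%:R :> R by rewrite ltr0n.
    have sn : 0 < Num.sqrt (n m)%:R :> R by rewrite sqrtr_gt0.
    have -> : Num.sqrt (n m)%:R / (n m)%:R = (Num.sqrt (n m)%:R)^-1 :> R.
      by rewrite -[X in _ / X](sqr_sqrtr (ltW nR)); field; rewrite gt_eqF.
    rewrite ler_pdivrMr// mulrC -ler_pdivrMr ?divr_gt0//.
    apply: (@le_trans _ _ (`|c3| / (e / 2))); first by rewrite ler_wpM2r ?ler_norm// ltW// invr_gt0 divr_gt0.
    have q0 : 0 <= `|c3| / (e / 2) by rewrite divr_ge0// ltW// divr_gt0.
    have qn : (`|c3| / (e / 2)) ^+ 2 <= (n m)%:R.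
      by rewrite (le_trans (ltW (archi_boundP (exprn_ge0 2 q0))))// ler_nat.
    by rewrite -(ger0_norm q0) -sqrtr_sqr ler_wsqrtr.
  have H4 : c1 * `|Num.sqrt (residual_variance (n m) (xi m) r f t) - Num.sqrt kap| <= e / 2.
    apply: (@le_trans _ _ ((`|c1| + 1) * delta)).
      apply: (le_trans (ler_norm _)); rewrite normrM normr_id.
      by apply: ler_pM; [exact: normr_ge0|exact: normr_ge0|rewrite lerDl|exact: ltW].
    by rewrite /delta mulrC divfK// gt_eqF.
  rewrite (splitr e) -(subrKA (heat (residual_variance (n m) (xi m) r f t) F (C m t * W m t))).
  rewrite (le_trans (ler_normD _ _))// lerD//; first exact: le_trans H1 H3.
  exact: le_trans H2 H4.
(* The two Gaussian laws convolve: scaling by [Num.sqrt alpha] turns variance [s] into [alpha * s],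
   and the semigroup identity adds [kap]. *)
have limE : \int[normal_law 0 (kap + alpha * s)]_x F x =
    \int[normal_law 0 s]_x heat kap F (Num.sqrt alpha * x).
  have bHa : bounded_lipschitz (fun x => heat kap F (Num.sqrt alpha * x)).
    have [_ [L' [_ HL]]] := bH; exists M, (L' * Num.sqrt alpha); split=> // x y.
    by rewrite (le_trans (HL _ _))// -mulrBr normrM ger0_norm// mulrA.
  have as0 : 0 <= alpha * s by rewrite mulr_ge0// ltW.
  apply: (etrans (integral_normal_law (addr_ge0 V_ge0 as0) bF)).
  apply/esym; apply: (etrans (integral_normal_law s2 bHa)).
  rewrite addrC -(heat_heat 0 as0 V_ge0 bF).
  apply: eq_Rintegral => z _; congr (heat kap F _).
  by rewrite !add0r sqrtrM ?ltW// mulrA.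
rewrite limE {limE}.
(* Once n is positive the integral of [I m] equals the restricted integral, and the sum telescopes
   to the mean of [F (Z m)]. *)
have D : (\int[P m]_t F (Z m t)) - (\int[P m]_t (\1_(E m) t * F (Z m t)))
    + ((\int[P m]_t I m t) - (\int[P m]_t heat kap F (C m t * W m t)))
    + \int[P m]_t heat kap F (C m t * W m t) @[m --> \oo]
   --> \int[normal_law 0 s]_x heat kap F (Num.sqrt alpha * x).
  by rewrite -[X in _ --> X]add0r -[X in _ --> X + _]addr0; apply: cvgD slutsky; exact: cvgD.
apply: cvg_trans D; apply: near_eq_cvg; near=> m.
have n0 : (0 < n m)%N by near: m.
by have [-> _] := IP m n0; rewrite addrA subrK subrK.
Unshelve. all: by end_near. Qed.
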